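(* Let $d\ge 3$, $s\in(0,1]$, and $p:=s/(d+s-2)$. There exists $q=q(d,s)>0$, depending only on $d$ and $s$, such that the following holds. Let $E\subset\mathbb{R}^d$ be a compact set with $W(E)<\infty$ for which there is a constant $A(E)>0$ with $$g_E(x)\le A(E)\,(d_E(x))^s\quad\text{for all } x\in\Omega_E,\ x\ne\infty,$$ and let $C_1>0$. Then there exist constants $C_2>0$ and $C_3>0$ such that for every $n\ge 2$ and every set of $n$ points $X_n=\{x_{k,n}\}_{k=1}^n\subset E$ satisfying $$\hat I[\tau(X_n)]-W(E)\le C_1 n^{-p},$$ one has, for all $y\in E^c$, $y\neq\infty$, $$\left|U^{\mu_E}(y)-U^{\tau(X_n)}(y)\right|\le C_2\left((d_E(y))^{1-d}n^{-p/s}+(d_E(y))^{1-d/2}n^{-p/2}\right),$$ and $$\sup_{y\in\mathbb{R}^d}\left(U^{\mu_E}(y)-U^{\tau(X_n)}(y)\right)\le C_3 n^{-q}.$$ (The constants $C_2$ and $C_3$ are independent of $n$ and $X_n$, and $C_2$ is also independent of $y$.)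
   Context: All potential-theoretic notions are with respect to the Newtonian kernel $|x|^{2-d}$ on $\mathbb{R}^d$, $d\ge3$ (with value $+\infty$ at $x=0$), where $|\cdot|$ is the Euclidean norm. For a Borel measure $\mu$ with compact support, $I[\mu]=\iint|x-y|^{2-d}\,d\mu(x)\,d\mu(y)$ and $U^\mu(x)=\int|x-y|^{2-d}\,d\mu(y)$. Robin's constant of a compact set $E$ is $W(E)=\inf_{\mu\in\mathcal{M}(E)}I[\mu]$, where $\mathcal{M}(E)$ is the set of all probability Borel measures supported on $E$. If $W(E)<\infty$, the infimum is attained by a unique measure $\mu_E\in\mathcal{M}(E)$ (the equilibrium measure), and $g_E(x)=W(E)-U^{\mu_E}(x)$, $x\in\mathbb{R}^d$. For a set of $n$ points $X_n=\{x_{k,n}\}_{k=1}^n$, let $\tau(X_n)=\frac1n\sum_{k=1}^n\delta_{x_{k,n}}$ be its counting measure, so that $U^{\tau(X_n)}(y)=\frac1n\sum_{k=1}^n|y-x_{k,n}|^{2-d}$, and let its discrete energy be $$\hat I[\tau(X_n)]=\frac{2}{n(n-1)}\sum_{1\le j<k\le n}|x_{j,n}-x_{k,n}|^{2-d}.$$ The distance to $E$ is $d_E(x)=\min_{t\in E}|x-t|$, $x\in\mathbb{R}^d$. Further, $E^c=(\mathbb{R}^d\cup\{\infty\})\setminus E$, and $\Omega_E$ is the unbounded connected component of $E^c$ (the one containing $\infty$). *)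

(* Defs.v *)
From HB Require Import structures.
From mathcomp Require Import all_boot all_order all_algebra.
From mathcomp Require Import all_classical all_reals all_analysis.

Set Implicit Arguments.
Unset Strict Implicit.
Unset Printing Implicit Defensive.

Import Order.TTheory GRing.Theory Num.Theory.
Import numFieldNormedType.Exports.

Local Open Scope classical_set_scope.
Local Open Scope ring_scope.
Local Open Scope ereal_scope.

(* The library norm on ['rV[R]_d] is the sup norm, hence a separate Euclidean
   norm.  The topology used below (compact, open, one-point compactification)
   is the library one, which is the usual topology of R^d. *)
Definition enorm (R : realType) (d : nat) (x : 'rV[R]_d) : R :=
  Num.sqrt (\sum_(i < d) x ord0 i ^+ 2)%R.

(* R^d with its Borel sigma-algebra. *)
Definition borel_rV (R : realType) (d : nat) :=
  g_sigma_algebraType (@open 'rV[R]_d).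

(* Since [0 `^ a = 0] for [a != 0] in the library, the value at the diagonal
   has to be singled out. *)
Definition newton (R : realType) (d : nat) (x y : 'rV[R]_d) : \bar R :=
  if x == y then +oo else (enorm (x - y)%R `^ (2 - d%:R))%:E.

Definition potential (R : realType) (d : nat)
    (mu : {measure set (borel_rV R d) -> \bar R}) (x : 'rV[R]_d) : \bar R :=
  \int[mu]_(y in setT) newton x y.

Definition energy (R : realType) (d : nat)
    (mu : {measure set (borel_rV R d) -> \bar R}) : \bar R :=
  \int[mu]_(x in setT) \int[mu]_(y in setT) newton x y.

Definition prob_on (R : realType) (d : nat) (E : set 'rV[R]_d) :
    set (probability (borel_rV R d) R) :=
  [set mu | mu (~` E) = 0].

Definition robin (R : realType) (d : nat) (E : set 'rV[R]_d) : \bar R :=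
  ereal_inf [set energy mu | mu in prob_on E].

Definition equilibrium (R : realType) (d : nat) (E : set 'rV[R]_d)
    (mu : probability (borel_rV R d) R) : Prop :=
  prob_on E mu /\ energy mu = robin E.

(* The function g_E, when [mu] is the equilibrium measure of [E]. *)
Definition green (R : realType) (d : nat) (E : set 'rV[R]_d)
    (mu : probability (borel_rV R d) R) (x : 'rV[R]_d) : \bar R :=
  robin E - potential mu x.

(* For nonempty compact [E] the infimum is attained. *)
Definition euclid_dist (R : realType) (d : nat) (E : set 'rV[R]_d)
    (x : 'rV[R]_d) : R :=
  inf [set enorm (x - t)%R | t in E].

(* The component of infinity (i.e. [None]) in the complement of [E] in the
   one-point compactification of R^d. *)
Definition Omega (R : realType) (d : nat) (E : set 'rV[R]_d) :
    set (one_point_compactification 'rV[R]_d) :=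
  connected_component
    (~` [set Some x | x in E] : set (one_point_compactification 'rV[R]_d)) None.

Definition tau (R : realType) (d n : nat) (X : 'I_n -> 'rV[R]_d)
    (A : set (borel_rV R d)) : \bar R :=
  (n%:R^-1)%:E * \sum_(k < n) \d_(X k : borel_rV R d) A.

Section tau_measure.
Variables (R : realType) (d n : nat) (X : 'I_n -> 'rV[R]_d).

Let tau0 : tau X set0 = 0.
Proof. by rewrite /tau big1 ?mule0// => k _; rewrite measure0. Qed.

Let tau_ge0 A : 0 <= tau X A.
Proof. by rewrite /tau mule_ge0 ?lee_fin ?invr_ge0// sume_ge0. Qed.

Let tau_sigma_additive : semi_sigma_additive (tau X).
Proof.
have n0 : (0 <= n%:R^-1 :> R)%R by rewrite invr_ge0.
pose m := mscale (NngNum n0)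
  (msum (fun k => \d_(oapp X point (insub k) : borel_rV R d)) n).
have -> : tau X = m.
  apply/funext => A; rewrite /tau /m /mscale /= /msum; congr (_ * _).
  by apply: eq_bigr => k _; rewrite valK.
exact: measure_semi_sigma_additive.
Qed.

HB.instance Definition _ := isMeasure.Build _ (borel_rV R d) R (tau X)
  tau0 tau_ge0 tau_sigma_additive.

End tau_measure.

Definition discrete_energy (R : realType) (d n : nat)
    (X : 'I_n -> 'rV[R]_d) : \bar R :=
  (2 / (n%:R * (n%:R - 1)))%:E *
    \sum_(j < n) \sum_(k < n | (j < k)%N) newton (X j) (X k).

(* Main.v *)
Require Import Defs.
From HB Require Import structures.
From mathcomp Require Import all_boot all_order all_algebra.
From mathcomp Require Import all_classical all_reals all_analysis.
From mathcomp Require Import measurable_realfun.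
From mathcomp Require Import ring lra.

Set Implicit Arguments.
Unset Strict Implicit.
Unset Printing Implicit Defensive.

Import Order.TTheory GRing.Theory Num.Theory.
Import numFieldNormedType.Exports.

Local Open Scope classical_set_scope.
Local Open Scope ring_scope.

(** Replace each point [x_k] by the uniform measure [b_k] of the sphere of radius
    [r] about it, and [y] by the uniform measure [c] of a sphere about [y].  All
    energies are then finite, and the energy form is positive semidefinite, so
    the Cauchy-Schwarz inequality bounds the mutual energy of [c] with the
    signed measure [mu - n^-1 \sum_k b_k], which is close to the difference of the
    potentials at [y], by the energies of [c] and of this signed measure
    ([deviation]).  With [W] the Robin constant, the energy of the latter is

      W - 2 n^-1 \sum_k (mu, b_k) + n^-2 \sum_j \sum_k (b_j, b_k).

    The double sum is at most the discrete energy plus [r^(2-d) / n], and the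
    bound on the Green function gives [(mu, b_k) >= W - A r^s], because the sphere
    about [x_k] stays within distance [r] of [E] ([mutual_lower]).  The choice
    [r = n^(-1/(d+s-2))] makes every error of order [n^(-p)].  The two estimates
    differ in the sphere about [y]: for [y] outside [E] it stays away from [E]
    ([outer_estimate]); for the supremum its radius is a small power of [1/n], and
    replacing the potential of [mu] at [y] by its mean costs little, because it is
    at most [W] everywhere and almost [W] near [E] ([upper_estimate]).

    The potential theory behind this is obtained as follows.

    - Positivity of the energy ([energy_form_ge0]): up to a positive factor
      [f(x) f(y)], the kernel [|x - y|^(2-d)] is a power series with nonnegative
      coefficients in a kernel of finite rank, hence an increasing limit of kernels
      of finite rank.  The same limit gives joint measurability.

    - Harmonic measure ([harmonic_measure]): weak limits of the laws of lattice
      walks whose steps are proportional to the distance to [E] sweep a unit mass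
      onto [E].  In a ball this yields the uniform measure of a sphere
      ([sphere_measure]); in the bounded components of the complement of [E] it
      shows that the equilibrium potential is at least [W] ([potential_inner]).

    - The equilibrium potential is at least [W] quasi-everywhere on [E]
      ([variation]), at most [W] almost everywhere for [mu], and therefore at most
      [W] everywhere by the maximum principle ([potential_le_robin]). *)

(** * Euclidean geometry of row vectors *)

Section Euclid.
Context {R : realType} {d : nat}.
Implicit Types (x y z p : 'rV[R]_d) (E : set 'rV[R]_d).

Definition edot x y : R := \sum_(i < d) x ord0 i * y ord0 i.

Lemma edotC x y : edot x y = edot y x.
Proof. by apply: eq_bigr => i _; rewrite mulrC. Qed.

Lemma edotDl x y z : edot (x + y) z = edot x z + edot y z.
Proof. by rewrite -big_split; apply: eq_bigr => i _; rewrite mxE mulrDl. Qed.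

Lemma edotZl a x y : edot (a *: x) y = a * edot x y.
Proof. by rewrite mulr_sumr; apply: eq_bigr => i _; rewrite mxE mulrA. Qed.

Lemma edotDr x y z : edot x (y + z) = edot x y + edot x z.
Proof. by rewrite edotC edotDl !(edotC _ x). Qed.

Lemma edotZr a x y : edot x (a *: y) = a * edot x y.
Proof. by rewrite edotC edotZl edotC. Qed.

Lemma edotNl x y : edot (- x) y = - edot x y.
Proof. by rewrite -scaleN1r edotZl mulN1r. Qed.

Lemma edotNr x y : edot x (- y) = - edot x y.
Proof. by rewrite edotC edotNl edotC. Qed.

Lemma edot_ge0 x : 0 <= edot x x.
Proof. by apply: sumr_ge0 => i _; rewrite -expr2 sqr_ge0. Qed.

Lemma enormE x : enorm x = Num.sqrt (edot x x).
Proof. by congr Num.sqrt; apply: eq_bigr => i _; rewrite expr2. Qed.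

Lemma sqr_enorm x : enorm x ^+ 2 = edot x x.
Proof. by rewrite enormE sqr_sqrtr// edot_ge0. Qed.

Lemma enorm_ge0 x : 0 <= enorm x.
Proof. exact: sqrtr_ge0. Qed.

Lemma coord_le_enorm x i : `|x ord0 i| <= enorm x.
Proof.
rewrite -sqrtr_sqr ler_wsqrtr// (bigD1 i)//= lerDl.
by apply: sumr_ge0 => j _; rewrite sqr_ge0.
Qed.

Lemma enorm0 : enorm (0 : 'rV[R]_d) = 0.
Proof. by rewrite enormE /edot big1 ?sqrtr0// => i _; rewrite mxE mul0r. Qed.

Lemma enorm_eq0 x : (enorm x == 0) = (x == 0).
Proof.
apply/eqP/eqP => [x0|->]; last exact: enorm0.
apply/rowP => i; rewrite mxE; apply/eqP.
by rewrite -normr_eq0 eq_le normr_ge0 andbT -x0 coord_le_enorm.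
Qed.

Lemma enorm_gt0 x : (0 < enorm x) = (x != 0).
Proof. by rewrite lt_neqAle enorm_ge0 andbT eq_sym enorm_eq0. Qed.

Lemma enormN x : enorm (- x) = enorm x.
Proof. by rewrite !enormE edotNl edotNr opprK. Qed.

Lemma enormB x y : enorm (x - y) = enorm (y - x).
Proof. by rewrite -enormN opprB. Qed.

Lemma enormZ a x : enorm (a *: x) = `|a| * enorm x.
Proof.
by rewrite !enormE edotZl edotZr mulrA -expr2 sqrtrM ?sqr_ge0// sqrtr_sqr.
Qed.

Lemma edot_le x y : edot x y <= enorm x * enorm y.
Proof.
have [->|y0] := eqVneq y 0.
  by rewrite enorm0 mulr0 -(scale0r 0) edotZr mul0r.
have ny : 0 < enorm y by rewrite enorm_gt0.
have := edot_ge0 ((enorm y ^+ 2) *: x - edot x y *: y).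
rewrite !(edotDl, edotDr, edotNl, edotNr, edotZl, edotZr) (edotC y x).
rewrite -!sqr_enorm => h.
have {}h : 0 <= enorm y ^+ 2 * ((enorm x * enorm y) ^+ 2 - edot x y ^+ 2).
  by apply: le_trans h _; rewrite le_eqVlt; apply/orP; left; apply/eqP; ring.
move: h; rewrite pmulr_rge0 ?exprn_gt0// subr_ge0 => h.
apply: le_trans (ler_norm _) _.
by rewrite -(@ler_pXn2r _ 2)// ?nnegrE ?mulr_ge0 ?enorm_ge0// real_normK ?num_real.
Qed.

Lemma edot_norm x y : `|edot x y| <= enorm x * enorm y.
Proof.
by rewrite ler_norml edot_le andbT lerNl -edotNl -(enormN x) edot_le.
Qed.

Lemma sqr_enormD x y :
  enorm (x + y) ^+ 2 = enorm x ^+ 2 + enorm y ^+ 2 + 2 * edot x y.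
Proof. by rewrite !sqr_enorm !(edotDl, edotDr) (edotC y x); ring. Qed.

Lemma sqr_enormB x y :
  enorm (x - y) ^+ 2 = enorm x ^+ 2 + enorm y ^+ 2 - 2 * edot x y.
Proof. by rewrite sqr_enormD enormN edotNr mulrN. Qed.

Lemma ler_enormD x y : enorm (x + y) <= enorm x + enorm y.
Proof.
rewrite -(@ler_pXn2r _ 2)// ?nnegrE ?addr_ge0 ?enorm_ge0// sqr_enormD sqrrD.
have := edot_le x y; set a := edot _ _; set b := enorm x * _ => ab.
by rewrite mulr_natl -addrA [_ + a *+ 2]addrC addrA lerD2r // lerD2l lerMn2r.
Qed.

Lemma ler_enorm_dist x y z : enorm (x - z) <= enorm (x - y) + enorm (y - z).
Proof. by apply: le_trans (ler_enormD _ _); rewrite addrA subrK. Qed.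

Lemma mx_norm_le_enorm x : `|x| <= enorm x.
Proof.
rewrite {1}/Num.norm /= mx_normrE; apply/bigmax_leP; split; first exact: enorm_ge0.
by move=> [i j] _ /=; rewrite ord1 coord_le_enorm.
Qed.

Lemma enorm_le_mx_norm x : enorm x <= d%:R * `|x|.
Proof.
have le i : `|x ord0 i| <= `|x|.
  rewrite [leRHS]/Num.norm /= mx_normrE.
  exact: (le_bigmax _ (fun ij : 'I_1 * 'I_d => `|x ij.1 ij.2|) (ord0, i)).
rewrite -(@ler_pXn2r _ 2)// ?nnegrE ?enorm_ge0 ?mulr_ge0//.
rewrite sqr_enorm exprMn.
apply: (@le_trans _ _ (\sum_(i < d) `|x| ^+ 2)).
  apply: ler_sum => i _; rewrite -expr2 -(@real_normK _ (x ord0 i)) ?num_real//.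
  by rewrite ler_pXn2r// ?nnegrE.
rewrite sumr_const card_ord -[leLHS]mulr_natl ler_wpM2r ?sqr_ge0//.
by rewrite -natrX ler_nat; case: (d) => // m; rewrite expnS leq_pmulr.
Qed.

(** The sup norm and the Euclidean norm are equivalent, so that Lipschitz
    estimates in the Euclidean norm give continuity for the given topology. *)
Lemma elip_continuous (k : R) (f : 'rV[R]_d -> R) :
  (forall x y, `|f x - f y| <= k * enorm (x - y)) -> continuous f.
Proof.
move=> lf x; apply/(@cvgrPdist_le _ _ _ _ (nbhs_filter x)) => e e0.
pose K := (`|k| * d%:R) + 1.
have K0 : 0 < K by rewrite ltr_wpDl ?mulr_ge0.
near=> z; apply: le_trans (lf _ _) _.
apply: (@le_trans _ _ (`|k| * (d%:R * `|x - z|))).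
  apply: le_trans (ler_wpM2r (enorm_ge0 _) (ler_norm k)) _.
  by rewrite ler_wpM2l// enorm_le_mx_norm.
rewrite mulrA; apply: (@le_trans _ _ (K * `|x - z|)).
  by rewrite ler_wpM2r// lerDl.
rewrite -ler_pdivlMl// mulrC.
near: z; apply: cvgr_dist_le; last by rewrite divr_gt0.
exact: cvg_id.
Unshelve. all: by end_near. Qed.

Lemma enorm_dist_continuous p : continuous (fun z => enorm (z - p)).
Proof.
apply: (@elip_continuous 1) => x y; rewrite mul1r ler_norml.
have := ler_enorm_dist x y p; have := ler_enorm_dist y x p.
rewrite (enormB y x); lra.
Qed.

Lemma closed_eball p r : closed [set z | enorm (z - p) <= r].
Proof.
have := closed_comp (fun x _ => @enorm_dist_continuous p x) (@closed_le R r).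
exact.
Qed.

Lemma closed_eball_compl p r : closed [set z | r <= enorm (z - p)].
Proof.
have := closed_comp (fun x _ => @enorm_dist_continuous p x) (@closed_ge R r).
exact.
Qed.

Lemma compact_eball p r : compact [set z | enorm (z - p) <= r].
Proof.
apply: bounded_closed_compact; last exact: closed_eball.
exists (r + enorm p); split; first exact: num_real.
move=> M hM z /= hz; apply: le_trans (mx_norm_le_enorm z) _.
apply/ltW/(le_lt_trans _ hM); rewrite -[z in enorm z](subrK p).
by apply: le_trans (ler_enormD _ _) _; rewrite lerD2r.
Qed.

(** ** Distance to a set *)

Lemma euclid_dist_has_inf E x : E !=set0 ->
  has_inf [set enorm (x - t) | t in E].
Proof.
move=> [e Ee]; split; first by exists (enorm (x - e)), e.
by exists 0 => _ [t _ <-]; exact: enorm_ge0.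
Qed.

Lemma euclid_dist_le E x t : E t -> euclid_dist E x <= enorm (x - t).
Proof.
move=> Et; apply: ge_inf; last by exists t.
by exists 0 => _ [u _ <-]; exact: enorm_ge0.
Qed.

Lemma euclid_dist_ge E x a : E !=set0 ->
  (forall t, E t -> a <= enorm (x - t)) -> a <= euclid_dist E x.
Proof.
move=> E0 h; apply: lb_le_inf; first by have [] := euclid_dist_has_inf x E0.
by move=> _ [t Et <-]; exact: h.
Qed.

Lemma euclid_dist_ge0 E x : E !=set0 -> 0 <= euclid_dist E x.
Proof. by move=> E0; apply: euclid_dist_ge => // t _; exact: enorm_ge0. Qed.

Lemma euclid_dist_lip E x y : E !=set0 ->
  euclid_dist E x <= enorm (x - y) + euclid_dist E y.
Proof.
move=> E0; rewrite -lerBlDl; apply: euclid_dist_ge => // t Et.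
by rewrite lerBlDl; apply: le_trans (euclid_dist_le _ Et) _; exact: ler_enorm_dist.
Qed.

Lemma euclid_dist_continuous E : E !=set0 -> continuous (euclid_dist E).
Proof.
move=> E0; apply: (@elip_continuous 1) => x y; rewrite mul1r ler_norml.
have := euclid_dist_lip x y E0; have := euclid_dist_lip y x E0.
rewrite (enormB y x); lra.
Qed.

Lemma euclid_dist_in E x : E x -> euclid_dist E x = 0.
Proof.
move=> Ex; apply/eqP; rewrite eq_le euclid_dist_ge0 ?andbT; last by exists x.
by apply: le_trans (euclid_dist_le _ Ex) _; rewrite subrr enorm0.
Qed.

Lemma euclid_dist_approx E x e : E !=set0 -> 0 < e ->
  exists2 t, E t & enorm (x - t) < euclid_dist E x + e.
Proof.
move=> E0 e0; have [_ [t Et <-] h] := inf_adherent e0 (euclid_dist_has_inf x E0).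
by exists t.
Qed.

Lemma euclid_dist_gt0 E x : E !=set0 -> closed E -> ~ E x -> 0 < euclid_dist E x.
Proof.
move=> E0 cE nEx; rewrite lt_neqAle euclid_dist_ge0// andbT eq_sym.
apply/eqP => dx0; apply: nEx; rewrite (closure_id E).1//.
move=> B /nbhs_ballP[e /= e0 eB].
have [t Et xt] := euclid_dist_approx x E0 e0; exists t; split=> //.
apply: eB; rewrite mx_norm_ball /ball_ /=.
by apply: le_lt_trans (mx_norm_le_enorm _) _; rewrite dx0 add0r in xt.
Qed.

End Euclid.

(** * The Newtonian kernel and its truncations *)

Section Newton.
Context {R : realType} {d : nat}.
Implicit Types (x y z p : 'rV[R]_d) (e : R).

(** Because [0^-1 = 0], this differs from [newton] on the diagonal, where it
    vanishes. *)
Definition nker x y : R := (enorm (x - y))^-1 ^+ (d - 2).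

(** As a function of [y] this is the potential of the uniform measure of the
    sphere of radius [e] about [x]; it is continuous and increases to the kernel
    as [e] tends to [0]. *)
Definition tker e x y : R := (Num.max e (enorm (x - y)))^-1 ^+ (d - 2).

Hypothesis hd : (3 <= d)%N.

Lemma newton_neq x y : x != y -> newton x y = (nker x y)%:E.
Proof.
move=> xy; rewrite /newton (negbTE xy); congr (_%:E).
have -> : 2 - d%:R = - (d - 2)%:R :> R.
  by rewrite natrB ?(leq_trans _ hd)// opprB.
by rewrite powR_invn ?enorm_ge0// /nker exprVn.
Qed.

Lemma newton_diag x : newton x x = +oo%E.
Proof. by rewrite /newton eqxx. Qed.

Lemma nker_ge0 x y : 0 <= nker x y.
Proof. by rewrite exprn_ge0// invr_ge0 enorm_ge0. Qed.

Lemma newton_ge0 x y : (0 <= newton x y)%E.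
Proof.
have [->|xy] := eqVneq x y; first by rewrite newton_diag.
by rewrite newton_neq// lee_fin nker_ge0.
Qed.

Lemma nkerC x y : nker x y = nker y x.
Proof. by rewrite /nker enormB. Qed.

Lemma newtonC x y : newton x y = newton y x.
Proof. by rewrite /newton eq_sym enormB. Qed.

Lemma tkerC e x y : tker e x y = tker e y x.
Proof. by rewrite /tker enormB. Qed.

Lemma tker_ge0 e x y : 0 <= tker e x y.
Proof. by rewrite exprn_ge0// invr_ge0 le_max enorm_ge0 orbT. Qed.

Lemma exprV_anti (a b : R) n : 0 < a -> a <= b -> b^-1 ^+ n <= a^-1 ^+ n.
Proof.
move=> a0 ab; have b0 : 0 < b by apply: lt_le_trans ab.
by rewrite lerXn2r ?nnegrE ?invr_ge0 ?(ltW a0) ?(ltW b0)// lef_pV2.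
Qed.

Lemma tker_le e x y : 0 < e -> tker e x y <= e^-1 ^+ (d - 2).
Proof. by move=> e0; apply: exprV_anti => //; rewrite le_max lexx. Qed.

Lemma tker_anti e e' x y : 0 < e -> e <= e' -> tker e' x y <= tker e x y.
Proof.
move=> e0 ee'; apply: exprV_anti; first by rewrite lt_max e0.
by rewrite ge_max !le_max ee' lexx orbT.
Qed.

Lemma tkerE e x y : e <= enorm (x - y) -> tker e x y = nker x y.
Proof. by move=> h; rewrite /tker max_r. Qed.

Lemma tker_eq e x y : enorm (x - y) <= e -> tker e x y = e^-1 ^+ (d - 2).
Proof. by move=> h; rewrite /tker max_l. Qed.

Lemma tker_le_newton e x y : 0 < e -> ((tker e x y)%:E <= newton x y)%E.
Proof.
move=> e0; have [->|xy] := eqVneq x y; first by rewrite newton_diag leey.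
rewrite newton_neq// lee_fin; apply: exprV_anti; last by rewrite le_max lexx orbT.
by rewrite enorm_gt0 subr_eq0.
Qed.

Lemma newtonE e x y : 0 < e -> e <= enorm (x - y) -> newton x y = (tker e x y)%:E.
Proof.
move=> e0 h; rewrite tkerE// newton_neq//.
by rewrite -subr_eq0 -enorm_gt0 (lt_le_trans e0).
Qed.

Lemma newton_le e x y : 0 < e -> e <= enorm (x - y) ->
  (newton x y <= (e^-1 ^+ (d - 2))%:E)%E.
Proof. by move=> e0 h; rewrite (newtonE e0 h) lee_fin tker_le. Qed.

Lemma cvg_tker x y :
  (fun k => (tker (k.+1%:R^-1) x y)%:E) @ \oo --> newton x y.
Proof.
have [->|xy] := eqVneq x y.
  rewrite newton_diag; apply/cvgeyPge => A; near=> k.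
  rewrite tker_eq; last by rewrite subrr enorm0.
  rewrite lee_fin invrK; apply: (@le_trans _ _ k.+1%:R).
    apply: (@le_trans _ _ k%:R); last by rewrite ler_nat.
    by near: k; exact: nbhs_infty_ger.
  rewrite -[leLHS]expr1 ler_weXn2l ?ler1n//.
  by rewrite subn_gt0.
apply: cvg_near_cst; near=> k; apply/esym/newtonE; first by rewrite invr_gt0.
rewrite ltW//; near: k.
have xy0 : 0 < enorm (x - y) by rewrite enorm_gt0 subr_eq0.
exact: (near_infty_natSinv_lt (PosNum xy0)).
Unshelve. all: by end_near. Qed.

Lemma tker_continuous e y : 0 < e -> continuous (fun x => tker e x y).
Proof.
move=> e0 x; apply: (@continuous_comp _ _ _
  (fun z => Num.max e (enorm (z - y))) (fun r : R => r^-1 ^+ (d - 2))).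
  apply: (@continuous_max _ _ (cst e) (fun z => enorm (z - y))).
    exact: cst_continuous.
  exact: enorm_dist_continuous.
apply: (@continuous_comp _ _ _ (fun r : R => r^-1) (fun r : R => r ^+ (d - 2))).
    by apply: inv_continuous; rewrite gt_eqF// lt_max e0.
exact: exprn_continuous.
Qed.

Lemma continuous_measurable_rV (f : 'rV[R]_d -> R) : continuous f ->
  measurable_fun [set: borel_rV R d] (f : borel_rV R d -> R).
Proof.
move=> cf; apply: (measurability _ (RGenOpens.measurableE R)).
move=> _ [_ [a [b ->] <-]]; rewrite setTI.
apply: sub_sigma_algebra; apply: open_comp; first by move=> ? _; exact: cf.
exact: interval_open.
Qed.

Lemma open_measurable_rV (A : set 'rV[R]_d) : open A ->
  measurable (A : set (borel_rV R d)).
Proof. by move=> oA; apply: sub_sigma_algebra. Qed.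

Lemma closed_measurable_rV (A : set 'rV[R]_d) : closed A ->
  measurable (A : set (borel_rV R d)).
Proof.
move=> cA; rewrite -[A]setCK; apply: measurableC.
by apply: open_measurable_rV; exact: closed_openC.
Qed.

Lemma measurable_sphere (y : 'rV[R]_d) (r : R) :
  measurable ([set z | enorm (z - y) = r] : set (borel_rV R d)).
Proof.
rewrite (_ : [set z | _] = [set z | r <= enorm (z - y)] `&` [set z | enorm (z - y) <= r]).
  by apply: measurableI; apply: closed_measurable_rV;
    [exact: closed_eball_compl|exact: closed_eball].
apply/seteqP; split => z /=; first by move=> ->.
by move=> [h1 h2]; apply/eqP; rewrite eq_le h2.
Qed.

Lemma measurable_tker e y : 0 < e ->
  measurable_fun [set: borel_rV R d] (fun x : borel_rV R d => tker e x y).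
Proof. by move=> e0; apply: continuous_measurable_rV; exact: tker_continuous. Qed.

Lemma measurable_newton y :
  measurable_fun [set: borel_rV R d] ((fun x => newton x y) : borel_rV R d -> \bar R).
Proof.
apply: (emeasurable_fun_cvg (fun k (x : borel_rV R d) => (tker (k.+1%:R^-1) x y)%:E)).
  by move=> k; apply/measurable_EFinP; apply: measurable_tker; rewrite invr_gt0.
by move=> x _; exact: cvg_tker.
Qed.

Lemma measurable_newton' y :
  measurable_fun [set: borel_rV R d] ((fun x => newton y x) : borel_rV R d -> \bar R).
Proof.
rewrite (_ : (fun x => _) = fun x : borel_rV R d => newton x y).
  exact: measurable_newton.
by apply/funext => x; exact: newtonC.
Qed.

End Newton.

(** * Positive definiteness of the Newtonian kernel *)

Section InvSqrt.
Context {R : realType}.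
Implicit Types (t : R) (n : nat).

(** Newton's iteration for [(1 - t)^(-1/2)]: the defect
    [e_n = 1 - (1 - t) * v_n^2] of the iterate [v_n] satisfies
    [e_{n+1} = (3 e_n^2 + e_n^3) / 4], so that both are polynomials in [t]
    with nonnegative coefficients: for [t] in [[0, 1]] the iterates increase,
    and a kernel of finite rank in place of [t] yields one of finite rank. *)
Fixpoint isqrt_err n t : R :=
  if n is m.+1 then (3 * isqrt_err m t ^+ 2 + isqrt_err m t ^+ 3) / 4 else t.

Fixpoint isqrt n t : R :=
  if n is m.+1 then isqrt m t * (1 + isqrt_err m t / 2) else 1.

Lemma isqrtP n t : (1 - t) * isqrt n t ^+ 2 = 1 - isqrt_err n t.
Proof.
elim: n => [|n IH] /=; first by rewrite expr1n mulr1.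
by rewrite exprMn mulrA IH; field.
Qed.

Lemma isqrt_err_ge0 n t : 0 <= t -> 0 <= isqrt_err n t.
Proof.
move=> t0; elim: n => //= n IH.
by rewrite divr_ge0// addr_ge0// ?mulr_ge0 ?exprn_ge0.
Qed.

Lemma isqrt_err_le n t : 0 <= t <= 1 -> isqrt_err n t <= t ^+ n.+1.
Proof.
move=> /andP[t0 t1].
suff /andP[] : isqrt_err n t <= t ^+ n.+1 <= t by [].
elim: n => [|n /andP[IH IH']] /=; first by rewrite expr1 lexx.
have e0 := isqrt_err_ge0 n t0.
have e1 : isqrt_err n t <= t by apply: le_trans IH'.
apply/andP; split; last by rewrite exprS ler_piMr// exprn_ile1.
rewrite exprSr; set e := isqrt_err n t in e0 e1 IH *.
apply: (@le_trans _ _ (e * e)); last by rewrite ler_pM.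
by rewrite ler_pdivrMr//; nra.
Qed.

Lemma isqrt_err1 n : isqrt_err n 1 = 1.
Proof. by elim: n => //= n ->; field. Qed.

Lemma isqrt1 n : isqrt n 1 = (1 + 2^-1) ^+ n.
Proof. by elim: n => //= n ->; rewrite isqrt_err1 exprSr mul1r. Qed.

Lemma isqrt_ge1 n t : 0 <= t -> 1 <= isqrt n t.
Proof.
move=> t0; elim: n => //= n IH; rewrite -[leLHS]mulr1 ler_pM//.
by rewrite lerDl divr_ge0// isqrt_err_ge0.
Qed.

Lemma isqrt_ndec n m t : 0 <= t -> (n <= m)%N -> isqrt n t <= isqrt m t.
Proof.
move=> t0; elim: m => [|k IH]; first by rewrite leqn0 => /eqP ->.
rewrite leq_eqVlt ltnS => /predU1P[->//|/IH] /le_trans; apply.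
rewrite /= ler_peMr//; first by apply: le_trans (isqrt_ge1 k t0).
by rewrite lerDl divr_ge0// isqrt_err_ge0.
Qed.

End InvSqrt.

Section FiniteRank.
Context {R : realType} {d : nat}.
Local Notation T := 'rV[R]_d.
Implicit Types (x y z p : T) (f : T -> R) (K : T -> T -> R).

Definition feature f :=
  measurable_fun [set: borel_rV R d] (f : borel_rV R d -> R) /\
  exists M, forall x, `|f x| <= M.

(** Kernels [sum_i f_i(x) f_i(y)]: they are positive definite by inspection,
    jointly measurable, and closed under sums and products. *)
Definition finrank K := exists (I : finType) (F : I -> T -> R),
  (forall i, feature (F i)) /\ forall x y, K x y = \sum_i F i x * F i y.

Lemma feature_mul f g : feature f -> feature g -> feature (fun x => f x * g x).
Proof.
move=> [mf [M fM]] [mg [N gN]]; split; first exact: measurable_funM.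
by exists (M * N) => x; rewrite normrM ler_pM.
Qed.

Lemma finrank_rank1 f : feature f -> finrank (fun x y => f x * f y).
Proof.
move=> ff; exists unit, (fun=> f); split => // x y.
by rewrite big_const card_unit /= addr0.
Qed.

Lemma finrank_add K K' : finrank K -> finrank K' ->
  finrank (fun x y => K x y + K' x y).
Proof.
move=> [I [F [fF KE]]] [I' [F' [fF' KE']]].
exists (I + I')%type, (fun s => match s with inl i => F i | inr i => F' i end).
split; first by case.
by move=> x y; rewrite KE KE' big_sumType.
Qed.

Lemma finrank_mul K K' : finrank K -> finrank K' ->
  finrank (fun x y => K x y * K' x y).
Proof.
move=> [I [F [fF KE]]] [I' [F' [fF' KE']]].
exists (I * I')%type, (fun s x => F s.1 x * F' s.2 x).
split; first by move=> s; apply: feature_mul.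
move=> x y; rewrite KE KE' big_distrlr /= pair_bigA /=.
by apply: eq_bigr => s _; rewrite mulrACA.
Qed.

Lemma feature_cst (c : R) : feature (fun=> c).
Proof. by split; [exact: measurable_cst|exists `|c| => x]. Qed.

Lemma finrank_cst c : 0 <= c -> finrank (fun _ _ => c).
Proof.
move=> c0; have := finrank_rank1 (feature_cst (Num.sqrt c)); congr finrank.
by do 2 apply/funext => ?; rewrite -expr2 sqr_sqrtr.
Qed.

Lemma finrank_exp K n : finrank K -> finrank (fun x y => K x y ^+ n).
Proof.
move=> fK; elim: n => [|n IH].
  exact: (finrank_cst ler01).
have := finrank_mul fK IH; congr finrank.
by do 2 apply/funext => ?; rewrite exprS.
Qed.

Lemma finrank_isqrt_err K n : finrank K ->
  finrank (fun x y => isqrt_err n (K x y)).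
Proof.
move=> fK; elim: n => //= n IH.
apply: finrank_mul; last by apply: finrank_cst; rewrite invr_ge0.
apply: finrank_add; last exact: finrank_exp.
by apply: finrank_mul; [exact: finrank_cst|exact: finrank_exp].
Qed.

Lemma finrank_isqrt K n : finrank K -> finrank (fun x y => isqrt n (K x y)).
Proof.
move=> fK; elim: n => /= [|n IH]; first exact: (finrank_cst ler01).
apply: finrank_mul => //; apply: finrank_add; first exact: (finrank_cst ler01).
apply: finrank_mul; last by apply: finrank_cst; rewrite invr_ge0.
exact: finrank_isqrt_err.
Qed.

Lemma finrank_measurable K : finrank K ->
  measurable_fun [set: borel_rV R d * borel_rV R d]
    ((fun q => K q.1 q.2) : borel_rV R d * borel_rV R d -> R).
Proof.
move=> [I [F [fF KE]]].
rewrite (_ : (fun q => _) = fun q : borel_rV R d * borel_rV R d =>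
  \sum_i F i q.1 * F i q.2); last by apply/funext => q; rewrite KE.
apply: measurable_sum => i; apply: measurable_funM.
  by apply: (measurableT_comp (fF i).1); exact: measurable_fst.
by apply: (measurableT_comp (fF i).1); exact: measurable_snd.
Qed.

End FiniteRank.

Section Approximants.
Context {R : realType} {d : nat}.
Local Notation T := 'rV[R]_d.
Implicit Types (x y z : T).

(** Up to a scaling this is the stereographic weight: [|x - y|^2] equals
    [conf x * conf y * (1 - ccos x y)], where [ccos] has finite rank and takes
    its values in [[0, 1]]. *)
Definition conf x : R := 1 + enorm x ^+ 2.

Definition ccos x y : R :=
  (1 + enorm x ^+ 2 * enorm y ^+ 2 + 2 * edot x y) / (conf x * conf y).

Lemma conf_gt0 x : 0 < conf x.
Proof. by rewrite ltr_wpDr// sqr_ge0. Qed.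

Lemma conf_neq0 x : conf x != 0. Proof. by rewrite gt_eqF// conf_gt0. Qed.

Lemma ccosP x y : conf x * conf y * (1 - ccos x y) = enorm (x - y) ^+ 2.
Proof.
rewrite sqr_enormB /ccos; have := conf_neq0 x; have := conf_neq0 y.
by rewrite /conf => ? ?; field; apply/andP.
Qed.

Lemma ccos_itv x y : 0 <= ccos x y <= 1.
Proof.
have c0 : 0 < conf x * conf y by rewrite mulr_gt0 ?conf_gt0.
apply/andP; split; last first.
  rewrite -subr_ge0 -(pmulr_rge0 _ c0) ccosP; exact: sqr_ge0.
rewrite divr_ge0 ?(ltW c0)//.
have : 0 <= (1 - enorm x * enorm y) ^+ 2 by exact: sqr_ge0.
by have := edot_norm x y; rewrite ler_norml => /andP[h _]; nra.
Qed.

Lemma enorm_continuous : continuous (@enorm R d).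
Proof.
rewrite (_ : @enorm R d = fun x => enorm (x - 0)); last first.
  by apply/funext => x; rewrite subr0.
exact: enorm_dist_continuous.
Qed.

Lemma conf_continuous : continuous conf.
Proof.
move=> x.
have h : {for x, continuous (fun z : T => enorm z ^+ 2)}.
  apply: (@continuous_comp _ _ _ (@enorm R d) (fun r : R => r ^+ 2)).
    exact: enorm_continuous.
  exact: exprn_continuous.
exact: (cvgD (cvg_cst _) h).
Qed.

Lemma feature_confV : feature (fun x => (conf x)^-1).
Proof.
split; last first.
  exists 1 => x; rewrite ger0_norm ?invr_ge0 ?(ltW (conf_gt0 x))//.
  by rewrite invf_le1 ?conf_gt0// /conf lerDl sqr_ge0.
apply: continuous_measurable_rV => x.
apply: (@continuous_comp _ _ _ conf (fun r : R => r^-1)).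
  exact: conf_continuous.
by apply: inv_continuous; exact: conf_neq0.
Qed.

Lemma feature_sqrt_confV : feature (fun x => (Num.sqrt (conf x))^-1).
Proof.
split; last first.
  exists 1 => x; rewrite ger0_norm ?invr_ge0 ?sqrtr_ge0//.
  rewrite invf_le1 ?sqrtr_gt0 ?conf_gt0// -[leLHS]sqrtr1 ler_wsqrtr//.
  by rewrite /conf lerDl sqr_ge0.
apply: continuous_measurable_rV => x.
apply: (@continuous_comp _ _ _ (fun z => Num.sqrt (conf z)) (fun r : R => r^-1)).
  apply: (@continuous_comp _ _ _ conf Num.sqrt); first exact: conf_continuous.
  exact: sqrt_continuous.
by apply: inv_continuous; rewrite gt_eqF// sqrtr_gt0 conf_gt0.
Qed.

Lemma feature_sqr_enorm : feature (fun x => enorm x ^+ 2 * (conf x)^-1).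
Proof.
split; last first.
  exists 1 => x; rewrite ger0_norm ?divr_ge0 ?sqr_ge0 ?(ltW (conf_gt0 x))//.
  by rewrite ler_pdivrMr ?conf_gt0// mul1r /conf lerDr.
apply: measurable_funM; last exact: feature_confV.1.
apply: measurable_funX; apply: continuous_measurable_rV; exact: enorm_continuous.
Qed.

Lemma feature_coord i :
  feature (fun x => Num.sqrt 2 * (x ord0 i * (conf x)^-1)).
Proof.
split; last first.
  exists (Num.sqrt 2) => x; rewrite normrM ger0_norm ?sqrtr_ge0//.
  rewrite ler_piMr ?sqrtr_ge0// normrM normfV (gtr0_norm (conf_gt0 x)).
  rewrite ler_pdivrMr ?conf_gt0// mul1r /conf.
  apply: le_trans (coord_le_enorm x i) _.
  have : 0 <= (enorm x - 2^-1) ^+ 2 by exact: sqr_ge0.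
  by have := enorm_ge0 x; nra.
apply: measurable_funM; first exact: measurable_cst.
apply: measurable_funM; last exact: feature_confV.1.
by apply: continuous_measurable_rV; exact: coord_continuous.
Qed.

Lemma finrank_sum (I : Type) (r : seq I) (K : I -> T -> T -> R) :
  (forall i, finrank (K i)) -> finrank (fun x y => \sum_(i <- r) K i x y).
Proof.
move=> fK; elim: r => [|i r IH].
  have := @finrank_cst R d 0 (lexx _); congr finrank.
  by do 2 apply/funext => ?; rewrite big_nil.
have := finrank_add (fK i) IH; congr finrank.
by do 2 apply/funext => ?; rewrite big_cons.
Qed.

Lemma finrank_ccos : finrank ccos.
Proof.
have := finrank_add (finrank_add (finrank_rank1 feature_confV)
  (finrank_rank1 feature_sqr_enorm))
  (finrank_sum (index_enum 'I_d) (fun i => finrank_rank1 (feature_coord i))).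
congr finrank; apply/funext => x; apply/funext => y.
have -> : \sum_i (Num.sqrt 2 * (x ord0 i * (conf x)^-1)) *
    (Num.sqrt 2 * (y ord0 i * (conf y)^-1)) = 2 * edot x y / (conf x * conf y).
  rewrite mulrAC -mulrA mulr_sumr mulr_sumr; apply: eq_bigr => i _.
  rewrite mulrACA -expr2 sqr_sqrtr// mulrACA invfM; congr (2 * _).
  by rewrite mulrC.
rewrite /ccos; have := conf_neq0 x; have := conf_neq0 y => ? ?.
by field; apply/andP.
Qed.

(** As [|x - y|^-1] is [(conf x * conf y)^(-1/2)] times
    [(1 - ccos x y)^(-1/2)], iterates for the inverse square root give kernels
    of finite rank that increase to the Newtonian kernel. *)
Definition nappx n x y : R :=
  (isqrt n (ccos x y) *
   ((Num.sqrt (conf x))^-1 * (Num.sqrt (conf y))^-1)) ^+ (d - 2).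

Lemma finrank_nappx n : finrank (nappx n).
Proof.
apply/finrank_exp/finrank_mul; first exact/finrank_isqrt/finrank_ccos.
exact/finrank_rank1/feature_sqrt_confV.
Qed.

Let sqrtV_gt0 x : 0 < (Num.sqrt (conf x))^-1.
Proof. by rewrite invr_gt0 sqrtr_gt0 conf_gt0. Qed.

Let base_ge0 n x y : 0 <= isqrt n (ccos x y) *
   ((Num.sqrt (conf x))^-1 * (Num.sqrt (conf y))^-1).
Proof.
have /andP[c0 _] := ccos_itv x y.
rewrite mulr_ge0 ?mulr_ge0 ?(ltW (sqrtV_gt0 _))//.
exact: le_trans (isqrt_ge1 n c0).
Qed.

Lemma nappx_ge0 n x y : 0 <= nappx n x y.
Proof. by rewrite exprn_ge0 ?base_ge0. Qed.

Lemma nappx_ndec n m x y : (n <= m)%N -> nappx n x y <= nappx m x y.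
Proof.
move=> nm; have /andP[c0 _] := ccos_itv x y.
rewrite /nappx lerXn2r ?nnegrE ?base_ge0// ler_wpM2r ?isqrt_ndec//.
Qed.

Lemma nappx_neq n x y : x != y -> nappx n x y =
  (Num.sqrt (1 - isqrt_err n (ccos x y)) / enorm (x - y)) ^+ (d - 2).
Proof.
move=> xy; congr (_ ^+ _).
have e0 : 0 < enorm (x - y) by rewrite enorm_gt0 subr_eq0.
apply: (@mulIf _ (enorm (x - y))); first by rewrite gt_eqF.
rewrite divfK ?gt_eqF//; apply/eqP.
rewrite -(@eqrXn2 _ 2)// ?(mulr_ge0 (base_ge0 _ _ _) (enorm_ge0 _)) ?sqrtr_ge0//.
have /andP[c0 c1] := ccos_itv x y.
rewrite sqr_sqrtr; last first.
  rewrite subr_ge0 (le_trans (isqrt_err_le _ (ccos_itv x y)))//.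
  exact: exprn_ile1.
rewrite -isqrtP !exprMn !exprVn (sqr_sqrtr (ltW (conf_gt0 x))) (sqr_sqrtr (ltW (conf_gt0 y))) -ccosP.
have := conf_neq0 x; have := conf_neq0 y => ? ?.
by apply/eqP; field; apply/andP.
Qed.

Lemma cvg_isqrt_err x y : x != y ->
  (fun n => isqrt_err n (ccos x y)) @ \oo --> (0 : R).
Proof.
move=> xy; have /andP[c0 _] := ccos_itv x y.
have c1 : ccos x y < 1.
  rewrite -subr_gt0 -(pmulr_rgt0 _ (mulr_gt0 (conf_gt0 x) (conf_gt0 y))) ccosP.
  by rewrite exprn_gt0// enorm_gt0 subr_eq0.
apply: (@squeeze_cvgr _ _ _ _ (cst 0) (fun n => ccos x y ^+ n)).
- near=> n; rewrite isqrt_err_ge0//= (le_trans (isqrt_err_le _ (ccos_itv x y)))//.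
  by rewrite exprSr ler_piMr ?exprn_ge0// ltW.
- exact: cvg_cst.
- by apply: cvg_expr; rewrite ger0_norm.
Unshelve. all: by end_near. Qed.

Hypothesis hd : (3 <= d)%N.

Lemma cvg_nappx x y : (fun n => (nappx n x y)%:E) @ \oo --> newton x y.
Proof.
have [->|xy] := eqVneq x y.
  rewrite newton_diag; apply/cvgeyPge => A; near=> n; rewrite lee_fin.
  have c1 : ccos y y = 1.
    apply/eqP; rewrite eq_sym -subr_eq0.
    have /eqP := ccosP y y; rewrite subrr enorm0 expr0n /= mulf_eq0.
    by rewrite mulf_eq0 !(negbTE (conf_neq0 y)).
  have h : Num.max A 1 <= isqrt n (ccos y y) *
      ((Num.sqrt (conf y))^-1 * (Num.sqrt (conf y))^-1).
    rewrite -invfM -expr2 sqr_sqrtr ?(ltW (conf_gt0 _))// c1 isqrt1.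
    rewrite ler_pdivlMr ?conf_gt0//; apply: (@le_trans _ _ (n%:R / 2)).
      rewrite ler_pdivlMr//; near: n; exact: nbhs_infty_ger.
    have bern : forall k, 1 + k%:R / 2 <= (1 + 2^-1 : R) ^+ k.
      elim=> [|k IH]; first by rewrite mul0r addr0.
      rewrite exprS -natr1; have : 0 <= k%:R :> R by []. nra.
    by apply: le_trans (bern n); rewrite lerDr.
  rewrite /nappx; apply: le_trans (_ : Num.max A 1 <= _).
    by rewrite le_max lexx.
  apply: (le_trans h); rewrite -[leLHS]expr1 ler_weXn2l//.
    by apply: le_trans h; rewrite le_max lexx orbT.
  by rewrite subn_gt0.
rewrite newton_neq//; apply: cvg_EFin; first by apply: nearW.
pose w n : R := Num.sqrt (1 - isqrt_err n (ccos x y)).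
have h1 : (fun n => 1 - isqrt_err n (ccos x y)) @ \oo --> (1 : R).
  rewrite -[X in _ --> X]subr0.
  exact: (cvgB (cvg_cst _) (cvg_isqrt_err xy)).
have h2 : w @ \oo --> (1 : R).
  have h2 := continuous_cvg _ (@sqrt_continuous R 1) h1.
  rewrite sqrtr1 in h2; exact: h2.
have h : (fun n => w n * (enorm (x - y))^-1) @ \oo --> (enorm (x - y))^-1.
  have h3 := @cvgMr_tmp R nat \oo _ w 1 (enorm (x - y))^-1 h2.
  rewrite mul1r in h3; exact: h3.
have := continuous_cvg _ (@exprn_continuous R (d - 2) _) h.
move=> hf; rewrite (_ : _ \o _ = fun n => (w n * (enorm (x - y))^-1) ^+ (d - 2)).
  exact: hf.
by apply/funext => n; rewrite /= nappx_neq.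
Unshelve. all: by end_near. Qed.

End Approximants.

Section Mutual.
Context {R : realType} {d : nat}.
Hypothesis hd : (3 <= d)%N.
Local Notation T := 'rV[R]_d.
Local Notation B := (borel_rV R d).
Local Open Scope ereal_scope.

(** Joint measurability, needed for Tonelli's theorem, is inherited from the
    finite-rank approximants. *)
Lemma measurable_newton2 : measurable_fun [set: B * B]
  ((fun q => newton (q.1 : T) q.2) : B * B -> \bar R).
Proof.
apply: (emeasurable_fun_cvg (fun n (q : B * B) => (nappx n (q.1 : T) q.2)%:E)).
  by move=> n; apply/measurable_EFinP; apply: finrank_measurable; exact: finrank_nappx.
by move=> q _; exact: cvg_nappx.
Qed.

(** The bilinear form of the energy: [mutual mu mu] is [energy mu]. *)
Definition mutual (mu nu : {measure set B -> \bar R}) : \bar R :=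
  \int[mu]_x potential nu x.

Lemma potential_ge0 (nu : {measure set B -> \bar R}) x : 0 <= potential nu x.
Proof. by apply: integral_ge0 => y _; exact: newton_ge0. Qed.

Lemma mutual_ge0 (mu nu : {measure set B -> \bar R}) : 0 <= mutual mu nu.
Proof. by apply: integral_ge0 => y _; exact: potential_ge0. Qed.

Lemma measurable_potential (nu : {finite_measure set B -> \bar R}) :
  measurable_fun setT (potential nu : B -> \bar R).
Proof.
exact: (measurable_fun_fubini_tonelli_F (m2 := nu) _ measurable_newton2
  (fun q => newton_ge0 hd _ _)).
Qed.

Lemma mutualC (mu nu : {finite_measure set B -> \bar R}) :
  mutual mu nu = mutual nu mu.
Proof.
have h := fubini_tonelli (m1 := mu) (m2 := nu) _ measurable_newton2 (fun q => newton_ge0 hd _ _).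
rewrite /mutual h; apply: eq_integral => y _.
by apply: eq_integral => x _ /=; rewrite newtonC.
Qed.

Lemma feature_integrable (nu : {finite_measure set B -> \bar R}) (f : T -> R) :
  feature f -> nu.-integrable setT (EFin \o f : B -> \bar R).
Proof.
move=> [mf [M fM]]; apply: measurable_bounded_integrable => //.
  by rewrite fin_num_fun_lty.
exists M; split; first exact: num_real.
by move=> N MN x _; apply: le_trans (fM x) (ltW MN).
Qed.

(** The energy form of a finite-rank kernel is a sum of products of moments;
    on the diagonal these are squares. *)
Lemma integral_finrank (K : T -> T -> R) : finrank K ->
  exists (I : finType) (m : I -> {finite_measure set B -> \bar R} -> R),
  forall mu nu : {finite_measure set B -> \bar R}, \int[mu]_x \int[nu]_y (K x y)%:E = (\sum_i m i mu * m i nu)%:E.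
Proof.
move=> [I [F [fF KE]]].
exists I, (fun i (mu : {finite_measure set B -> \bar R}) => fine (\int[mu]_x (F i x)%:E)) => mu nu.
have fin i (la : {finite_measure set B -> \bar R}) :
    \int[la]_x (F i x)%:E \is a fin_num.
  exact/integrable_fin_num/feature_integrable.
have E x : \int[nu]_y (K x y)%:E =
    \sum_i (fine (\int[nu]_y (F i y)%:E))%:E * (F i x)%:E.
  under eq_integral do rewrite KE -sumEFin.
  rewrite integral_sum//; last first.
    move=> i; under eq_fun do rewrite EFinM.
    by apply: integrableZl => //; exact: feature_integrable.
  apply: eq_bigr => i _.
  under eq_integral do rewrite EFinM.
  by rewrite integralZl//; [rewrite fineK// muleC|exact: feature_integrable].
under eq_integral do rewrite E.
rewrite integral_sum//; last first.
  by move=> i; apply: integrableZl => //; exact: feature_integrable.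
rewrite -sumEFin; apply: eq_bigr => i _.
rewrite integralZl//; last exact: feature_integrable.
by rewrite EFinM !fineK// muleC.
Qed.

Lemma cvg_nappx_mutual (mu nu : {finite_measure set B -> \bar R}) :
  (fun n => \int[mu]_x \int[nu]_y (nappx n x y)%:E) @ \oo --> mutual mu nu.
Proof.
have mn n : measurable_fun [set: B * B]
    ((fun q => (nappx n (q.1 : T) q.2)%:E) : B * B -> \bar R).
  by apply/measurable_EFinP; apply: finrank_measurable; exact: finrank_nappx.
have mn1 n x : measurable_fun [set: B] ((fun y => (nappx n x y)%:E) : B -> \bar R).
  have h := measurableT_comp (mn n) (pair1_measurable (x : B)).
  exact: h.
have E x : potential nu x = limn (fun n => \int[nu]_y (nappx n x y)%:E).
  rewrite -monotone_convergence//.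
  - by apply: eq_integral => y _; apply/esym/cvg_lim => //; exact: cvg_nappx.
  - by move=> n y _; rewrite lee_fin nappx_ge0.
  - by move=> y _ a b ab; rewrite lee_fin nappx_ndec.
rewrite /mutual; under [in X in _ --> X]eq_integral do rewrite E.
apply: cvg_monotone_convergence => //.
- move=> n; apply: (measurable_fun_fubini_tonelli_F (m2 := nu) _ (mn n)) => q.
  by rewrite lee_fin nappx_ge0.
- by move=> n x _; apply: integral_ge0 => y _; rewrite lee_fin nappx_ge0.
- move=> x _ a b ab; apply: ge0_le_integral => //.
  + by move=> y _; rewrite lee_fin nappx_ge0.
  + by move=> y _; rewrite lee_fin nappx_ndec.
Qed.

(** The energy form is positive semidefinite on combinations of measures whose
    mutual energies are finite: this holds for each finite-rank approximant,
    where the form is a sum of squares, and passes to the limit. *)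
Lemma energy_form_ge0 (I : finType) (mu : I -> {finite_measure set B -> \bar R})
    (a : I -> R) :
  (forall i j, mutual (mu i) (mu j) < +oo) ->
  (0 <= \sum_i \sum_j a i * a j * fine (mutual (mu i) (mu j)))%R.
Proof.
move=> fin.
have fin' i j : mutual (mu i) (mu j) \is a fin_num by rewrite ge0_fin_numE ?mutual_ge0.
have cvg1 i j : (fun n => fine (\int[mu i]_x \int[mu j]_y (nappx n x y)%:E))
    @ \oo --> fine (mutual (mu i) (mu j)).
  apply: fine_cvg; rewrite fineK//; exact: cvg_nappx_mutual.
have cvg2 : (fun n => \sum_i \sum_j
      a i * a j * fine (\int[mu i]_x \int[mu j]_y (nappx n x y)%:E))%R @ \oo -->
    (\sum_i \sum_j a i * a j * fine (mutual (mu i) (mu j)))%R.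
  have addc : continuous (fun x : R * R => (x.1 + x.2)%R) by exact: add_continuous.
  apply: (cvg_big addc) => i _; apply: (cvg_big addc) => j _.
  exact: (@cvgMl_tmp R nat \oo _ _ (a i * a j)%R _ (cvg1 i j)).
rewrite -(cvg_lim _ cvg2)//; apply: limr_ge; first by apply/cvg_ex; eexists; exact: cvg2.
near=> n.
have [J [m mE]] := integral_finrank (@finrank_nappx R d n).
under eq_bigr => i _ do under eq_bigr => j _ do rewrite mE /=.
have -> : (\sum_i \sum_j a i * a j * (\sum_k m k (mu i) * m k (mu j)) =
    \sum_k (\sum_i a i * m k (mu i)) ^+ 2)%R.
  under [RHS]eq_bigr do rewrite expr2 big_distrlr /=.
  rewrite [RHS]exchange_big /=; apply: eq_bigr => i _.
  rewrite [RHS]exchange_big /=; apply: eq_bigr => j _.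
  by rewrite mulr_sumr; apply: eq_bigr => k _; rewrite mulrACA.
by apply: sumr_ge0 => k _; exact: sqr_ge0.
Unshelve. all: by end_near. Qed.

End Mutual.

(** * Measures from finitely additive ones *)

(** Ultrafilter limits of discrete averages are of this kind.  The compact
    support keeps mass from escaping when countable additivity is restored. *)
Record content (R : realType) (d : nat) := Content {
  cset :> set 'rV[R]_d -> R ;
  csupp : set 'rV[R]_d ;
  content_ge0 : forall A, 0 <= cset A ;
  content_add : forall A B, A `&` B = set0 -> cset (A `|` B) = cset A + cset B ;
  contentT : cset setT = 1 ;
  csupp_compact : compact csupp ;
  content_supp : cset (~` csupp) = 0 }.

Section Content.
Context {R : realType} {d : nat}.
Local Notation T := 'rV[R]_d.
Variable c : content R d.
Implicit Types (A B C O V : set T).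

Lemma content0 : c set0 = 0.
Proof.
have := @content_add _ _ c set0 set0 (setI0 _).
by rewrite setU0 => /eqP; rewrite -subr_eq subrr eq_sym => /eqP.
Qed.

Lemma content_le A B : A `<=` B -> c A <= c B.
Proof.
move=> AB; rewrite -(setDUK AB) content_add ?lerDl ?content_ge0//.
by rewrite setDE setICA setICr setI0.
Qed.

Lemma contentU A B : c (A `|` B) <= c A + c B.
Proof.
have -> : A `|` B = A `|` (B `\` A).
  by rewrite setDE setUIr setUCr setIT.
rewrite content_add ?lerD2l ?content_le//; last first.
  by rewrite setDE setICA setICr setI0.
Qed.

Lemma content_csupp A : c A = c (A `&` csupp c).
Proof.
apply/eqP; rewrite eq_le [X in _ && X]content_le ?andbT; last by move=> x [].
apply: (@le_trans _ _ (c (A `&` csupp c `|` ~` csupp c))).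
  by apply: content_le => x Ax; have [|] := pselect (csupp c x); [left|right].
by apply: le_trans (contentU _ _) _; rewrite content_supp addr0.
Qed.

Local Open Scope ereal_scope.

(** As in the proof of the Riesz representation theorem, open sets are measured
    from inside by closed ones, since the content of an open set may count mass
    that in the limit sits on its boundary. *)
Definition cinner O : \bar R :=
  ereal_sup [set (c C)%:E | C in [set C | closed C /\ C `<=` O]].

Definition couter A : \bar R :=
  ereal_inf [set cinner O | O in [set O | open O /\ A `<=` O]].

Lemma cinner_ge C O : closed C -> C `<=` O -> (c C)%:E <= cinner O.
Proof. by move=> clC CO; apply: ereal_sup_ubound; exists C. Qed.

Lemma cinner_le O e : (forall C, closed C -> C `<=` O -> (c C)%:E <= e) ->
  cinner O <= e.
Proof. by move=> h; apply: ge_ereal_sup => _ [C [clC CO] <-]; exact: h. Qed.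

Lemma cinner_ge0 O : 0 <= cinner O.
Proof.
by rewrite (le_trans _ (cinner_ge closed0 (@sub0set _ O)))// lee_fin content_ge0.
Qed.

Lemma cinner_le_content O : cinner O <= (c O)%:E.
Proof. by apply: cinner_le => C _ CO; rewrite lee_fin content_le. Qed.

Lemma cinner_fin O : cinner O \is a fin_num.
Proof.
by rewrite ge0_fin_numE ?cinner_ge0// (le_lt_trans (cinner_le_content O))// ltry.
Qed.

Lemma le_cinner O V : O `<=` V -> cinner O <= cinner V.
Proof.
by move=> OV; apply: cinner_le => C clC CO; exact/cinner_ge/(subset_trans CO).
Qed.

Lemma couter_le A O : open O -> A `<=` O -> couter A <= cinner O.
Proof. by move=> oO AO; apply: ereal_inf_lbound; exists O. Qed.

Lemma couter_ge A e : (forall O, open O -> A `<=` O -> e <= cinner O) ->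
  e <= couter A.
Proof. by move=> h; apply: le_ereal_inf_tmp => _ [G [oG AG] <-]; exact: h. Qed.

Lemma couter_ge0 A : 0 <= couter A.
Proof. by apply: couter_ge => O _ _; exact: cinner_ge0. Qed.

Lemma couter_fin A : couter A \is a fin_num.
Proof.
rewrite ge0_fin_numE ?couter_ge0// (le_lt_trans (couter_le openT (@subsetT _ A)))//.
by rewrite -ge0_fin_numE ?cinner_ge0// cinner_fin.
Qed.

Lemma couter_open O : open O -> couter O = cinner O.
Proof.
move=> oO; apply/eqP; rewrite eq_le couter_le//=.
by apply: couter_ge => V _ OV; exact: le_cinner.
Qed.

Lemma le_couter A B : A `<=` B -> couter A <= couter B.
Proof.
by move=> AB; apply: couter_ge => O oO BO; exact/couter_le/(subset_trans AB).
Qed.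

Lemma couter0 : couter set0 = 0.
Proof.
apply/eqP; rewrite eq_le couter_ge0 andbT (le_trans (couter_le open0 (@subset_refl _ _)))//.
by rewrite (le_trans (cinner_le_content _))// content0.
Qed.

(** By normality a closed subset of a union of two open sets is a union of
    closed subsets of each. *)
Lemma cinnerU O V : open O -> open V -> cinner (O `|` V) <= cinner O + cinner V.
Proof.
move=> oO oV; apply: cinner_le => C clC COV.
have [|||U [W [oU oW CU CW UW]]] :=
    (@normal_openP R _).1 (@pseudometric_normal R T) (C `&` ~` O) (C `&` ~` V).
- by apply: closedI => //; exact: open_closedC.
- by apply: closedI => //; exact: open_closedC.
- by rewrite setIACA setIid -setCU -subset0 => x [/COV].
have -> : C = (C `&` ~` U) `|` (C `&` ~` W).
  by rewrite -setIUr -setCI UW setC0 setIT.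
rewrite (le_trans (_ : _ <= (c (C `&` ~` U) + c (C `&` ~` W))%:E))//.
  by rewrite lee_fin contentU.
rewrite EFinD leeD//; apply: cinner_ge.
- by apply: closedI => //; exact: open_closedC.
- by move=> x [Cx nUx]; apply: contrapT => nOx; apply/nUx/CU.
- by apply: closedI => //; exact: open_closedC.
- by move=> x [Cx nUx]; apply: contrapT => nOx; apply/nUx/CW.
Qed.

Lemma cinner_bigcup (O : (set T)^nat) : (forall n, open (O n)) ->
  cinner (\bigcup_n O n) <= \sum_(i <oo) cinner (O i).
Proof.
move=> oO; apply: cinner_le => C clC CO; rewrite content_csupp.
have cK := @csupp_compact _ _ c.
have clK : closed (csupp c) by apply: compact_closed => //; exact: norm_hausdorff.
have : compact (C `&` csupp c).
  by apply: (subclosed_compact _ cK) => [|x []//]; exact: closedI.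
rewrite compact_cover => /(_ nat setT O) [//|x [/CO]//|D _ CD].
have fin n : cinner (\big[setU/set0]_(i < n) O i) <= \sum_(i < n) cinner (O i).
  elim: n => [|n IH].
    by rewrite !big_ord0 (le_trans (cinner_le_content _))// content0.
  rewrite !big_ord_recr /= (le_trans (cinnerU _ _))//; last by rewrite leeD2r.
  by apply: big_ind => [|A B|i _]; [exact: open0|exact: openU|].
pose n := (\max_(i <- finmap.enum_fset D) i).+1.
apply: (@le_trans _ _ (cinner (\big[setU/set0]_(i < n) O i))).
  apply: cinner_ge; first exact: closedI.
  move=> x /CD [i iD Oix]; rewrite -bigcup_mkord; exists i => //=.
  by rewrite ltnS; apply: leq_bigmax_seq.
apply: le_trans (fin n) _; rewrite -(big_mkord xpredT (fun i => cinner (O i))).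
by apply: nneseries_lim_ge => i _ _; exact: cinner_ge0.
Qed.

Lemma couter_sigma_subadditive : sigma_subadditive couter.
Proof.
move=> A; apply/lee_addgt0Pr => e e0.
apply: le_trans (epsilon_trick xpredT _ (ltW e0)); last by move=> n; exact: couter_ge0.
have P n : exists O, [/\ open O, A n `<=` O &
    cinner O <= couter (A n) + (e / (2 ^ n.+1)%:R)%:E].
  have en : (0 < e / (2 ^ n.+1)%:R)%R by rewrite divr_gt0// ltr0n expn_gt0.
  have [_ [G [oG AG] <-] h] := lb_ereal_inf_adherent en (couter_fin (A n)).
  by exists G; split => //; exact: ltW.
have [U /all_and3 [oU AU hU]] := choice P.
apply: (@le_trans _ _ (\sum_(i <oo) cinner (U i))); last first.
  by apply: lee_nneseries => [i _ _|i _]; [exact: cinner_ge0|exact: hU].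
apply: le_trans (cinner_bigcup oU); apply: couter_le.
  exact: bigcup_open.
by move=> x [i _ /AU ?]; exists i.
Qed.

HB.instance Definition _ := isOuterMeasure.Build R T couter
  couter0 couter_ge0 le_couter couter_sigma_subadditive.

(** Disjoint closed sets inside [V `&` O] and inside the rest of [V] have
    additive content, and these exhaust the two parts from inside. *)
Lemma open_caratheodory O : open O -> couter.-caratheodory O.
Proof.
move=> oO; apply: le_caratheodory_measurable => X.
apply: couter_ge => V oV XV.
apply: (@le_trans _ _ (cinner (V `&` O) + couter (X `&` ~` O))).
  by apply: leeD2r; apply: couter_le; [exact: openI|exact: setSI].
rewrite -leeBrDr ?couter_fin//; apply: cinner_le => C clC CVO.
rewrite leeBrDr ?couter_fin// -leeBrDl//.
apply: (@le_trans _ _ (cinner (V `&` ~` C))).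
  apply: couter_le; first by apply: openI => //; exact: closed_openC.
  by move=> x [/XV Vx nOx]; split => // /CVO [].
apply: cinner_le => D clD DVC; rewrite leeBrDl// -EFinD -content_add; last first.
  by rewrite -subset0 => x [Cx /DVC[]].
apply: cinner_ge; first exact: closedU.
by move=> x [/CVO[]|/DVC[]].
Qed.

(** The measure represented by the content.  On open sets it does not exceed the
    content ([cmeasure_le]), which is the semicontinuity expected of a weak
    limit. *)
Definition cmeasure (A : set (borel_rV R d)) : \bar R := couter A.

Let borel_caratheodory (A : set (borel_rV R d)) :
  measurable A -> couter.-caratheodory A.
Proof.
move: A; apply: smallest_sub; last by move=> O oO; exact: open_caratheodory.
split.
- exact: caratheodory_measurable_set0.
- by move=> A mA; rewrite setTD; exact: caratheodory_measurable_setC.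
- by move=> F mF; exact: caratheodory_measurable_bigcup.
Qed.

Let cmeasure0 : cmeasure set0 = 0. Proof. exact: couter0. Qed.

Let cmeasure_ge0 A : 0 <= cmeasure A. Proof. exact: couter_ge0. Qed.

Let cmeasure_sigma_additive : semi_sigma_additive cmeasure.
Proof.
move=> F mF tF mUF.
apply: (@caratheodory_measure_sigma_additive R T couter) => //.
- by move=> i; exact: borel_caratheodory.
- exact: borel_caratheodory.
Qed.

HB.instance Definition _ := isMeasure.Build _ (borel_rV R d) R cmeasure
  cmeasure0 cmeasure_ge0 cmeasure_sigma_additive.

Let cmeasureT : cmeasure setT = 1.
Proof.
rewrite /cmeasure couter_open; last exact: openT.
apply/eqP; rewrite eq_le (le_trans (cinner_le_content _)) ?contentT//=.
rewrite -(contentT c); apply: cinner_ge => //; exact: closedT.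
Qed.

HB.instance Definition _ := Measure_isProbability.Build _ (borel_rV R d) R cmeasure
  cmeasureT.

Lemma cmeasure_le O : open O -> cmeasure O <= (c O)%:E.
Proof. by move=> oO; rewrite /cmeasure couter_open// cinner_le_content. Qed.

End Content.

(** * Limits of averages *)

(** Averages over finitely many points of [G], abstracted. *)
Record mean (R : realType) (T : Type) (G : set T) := Mean {
  mval :> (T -> R) -> R ;
  meanD : forall f g, mval (fun x => f x + g x) = mval f + mval g ;
  meanZ : forall k f, mval (fun x => k * f x) = k * mval f ;
  mean_le : forall f g, (forall x, G x -> f x <= g x) -> mval f <= mval g ;
  mean1 : mval (fun=> 1) = 1 }.

Section Mean.
Context {R : realType} {T : Type} {G : set T}.
Variable m : mean R G.

Lemma mean_cst k : m (fun=> k) = k.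
Proof.
by rewrite -[RHS]mulr1 -(mean1 m) -meanZ; congr (m _); apply/funext => x; rewrite mulr1.
Qed.

Lemma mean_eq f g : (forall x, G x -> f x = g x) -> m f = m g.
Proof.
by move=> fg; apply/eqP; rewrite eq_le; apply/andP; split;
  apply: mean_le => x /fg ->.
Qed.

Lemma mean_sum n (f : 'I_n -> T -> R) :
  m (fun x => \sum_(i < n) f i x) = \sum_(i < n) m (f i).
Proof.
elim: n f => [|n IH] f.
  rewrite big_ord0 -[RHS](mean_cst 0); congr (m _).
  by apply/funext => x; rewrite big_ord0.
rewrite big_ord_recr /= -(IH (fun i => f (widen_ord (leqnSn n) i))) -meanD.
congr (m _).
by apply/funext => x; rewrite big_ord_recr.
Qed.

Lemma mean_ge0 f : (forall x, G x -> 0 <= f x) -> 0 <= m f.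
Proof. by move=> f0; rewrite -(mean_cst 0); exact: mean_le. Qed.

End Mean.

Section Layers.
Context {R : realType}.
Implicit Types (g e : R).

(** Layer-cake sums with mesh [e] bound the integral of a continuous function by
    the measures of its superlevel sets, which are open. *)
Lemma layer_le g e N : 0 <= g -> 0 <= e ->
  \sum_(i < N) e * (i.+1%:R * e < g)%R%:R <= g.
Proof.
move=> g0 e0.
have le n : \sum_(i < n) e * (i.+1%:R * e < g)%R%:R <= n%:R * e.
  apply: (@le_trans _ _ (\sum_(i < n) e)).
    by apply: ler_sum => i _; rewrite -[leRHS]mulr1 ler_wpM2l// lern1 leq_b1.
  by rewrite sumr_const card_ord mulr_natl.
elim: N => [|N IH]; first by rewrite big_ord0.
rewrite big_ord_recr /=; case: ltP => [h|_]; last by rewrite mulr0 addr0.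
apply/ltW/le_lt_trans/h; rewrite mulr1 -natr1 mulrDl mul1r lerD2r; exact: le.
Qed.

Lemma layer_ge g e N : 0 <= e -> g <= N.+1%:R * e ->
  g <= \sum_(i < N) e * (i.+1%:R * e < g)%R%:R + e.
Proof.
move=> e0.
have full n : n%:R * e < g -> \sum_(i < n) e * (i.+1%:R * e < g)%R%:R = n%:R * e.
  elim: n => [|n IH] ng; first by rewrite big_ord0 mul0r.
  rewrite big_ord_recr /= IH ?ng ?mulr1; first by rewrite -natr1 mulrDl mul1r.
  by apply: le_lt_trans ng; rewrite ler_wpM2r// ler_nat.
elim: N => [|N IH] gN; first by rewrite big_ord0 add0r -[e]mul1r.
have [h|h] := ltP (N.+1%:R * e) g.
  by rewrite full//; move: gN; rewrite -[N.+2%:R]natr1 mulrDl mul1r.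
by apply: le_trans (IH h) _; rewrite lerD2r big_ord_recr /= lerDl mulr_ge0.
Qed.

End Layers.

Section LimitMeasure.
Context {R : realType} {d : nat}.
Local Notation T := 'rV[R]_d.
Variables (G K : set T) (a : nat -> mean R G).
Hypotheses (GK : G `<=` K) (cK : compact K).

Lemma ultra_cvg (U : set_system nat) (u : nat -> R) (M : R) : UltraFilter U ->
  (forall n, `|u n| <= M) -> exists l : R, u @ U --> l.
Proof.
move=> UU uM; have PU : ProperFilter U by exact: ultra_proper.
have : U (u @^-1` `[- M, M]%classic).
  apply: (@filterS _ U _ setT) => [n _|]; last exact: filterT.
  by rewrite /= in_itv /= -ler_norml; exact: uM.
move=> uM'; have cM : compact `[- M, M]%classic by exact: segment_compact.
have [l [_ cl]] := cM (u @ U) _ uM'; exists l => V lV.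
have [//|UV] := in_ultra_setVsetC (u @^-1` V) UU.
have [x [/= nVx Vx]] := cl (~` V) V UV lV.
by [].
Qed.

(** Weak compactness of averages over points of a compact set: an ultrafilter
    limit is a content, and the measure it represents is compared with the
    averages on superlevel sets.  The one-sided bound for nonnegative [g] is
    enough, because it also applies to [M - g]. *)
Lemma limit_measure : exists P : probability (borel_rV R d) R,
  P (~` K) = 0%E /\
  forall (g : T -> R) (M l : R), continuous g -> (forall x, 0 <= g x <= M) ->
    (forall e, 0 < e -> \forall n \near \oo, a n g <= l + e) ->
    (\int[P]_x (g x)%:E <= l%:E)%E.
Proof.
have [U [UU oU]] := @ultraFilterLemma nat \oo _.
have PU : ProperFilter U by exact: ultra_proper.
have a1 (A : set T) : exists l : R, (fun n => a n \1_A) @ U --> l.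
  apply: (@ultra_cvg _ _ 1) => // n; rewrite ler_norml; apply/andP; split.
    by apply: (@le_trans _ _ 0); [rewrite oppr_le0|apply: mean_ge0 => x _; rewrite indicE].
  by rewrite -(mean1 (a n)); apply: mean_le => x _; rewrite indicE lern1 leq_b1.
have [c cE] := choice a1.
have cU A l : (fun n => a n \1_A) @ U --> l -> c A = l.
  by move=> h; exact: (cvg_unique _ (cE A) h).
have c0 A : 0 <= c A.
  apply: (cvgr_to_ge (cE A)); apply: filterS filterT => n _.
  by apply: mean_ge0 => x _; rewrite indicE.
have cadd A B : A `&` B = set0 -> c (A `|` B) = c A + c B.
  move=> AB0; apply: cU.
  rewrite (_ : (fun n => _) = fun n => a n \1_A + a n \1_B).
    exact: (cvgD (cE A) (cE B)).
  apply/funext => n; rewrite -meanD; congr (a n _); apply/funext => x.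
  rewrite !indicE in_setU; case: (boolP (x \in A)) => xA; last by rewrite add0r.
  rewrite memNset ?addr0// => Bx; have : (A `&` B) x by split => //; exact: set_mem.
  by rewrite AB0.
have cT : c setT = 1.
  apply: cU; rewrite (_ : (fun n => _) = cst 1); first exact: cvg_cst.
  by apply/funext => n; rewrite indicT mean_cst.
have cKC : c (~` K) = 0.
  apply: cU; rewrite (_ : (fun n => _) = cst 0); first exact: cvg_cst.
  apply/funext => n; rewrite -[RHS](mean_cst (a n)); apply: mean_eq => x /GK Kx.
  by rewrite indicE memNset.
pose C := Content c0 cadd cT cK cKC.
exists (cmeasure C); split.
  apply/eqP; rewrite eq_le measure_ge0 andbT.
  apply: (@le_trans _ _ (c (~` K))%:E); last by rewrite cKC.
  apply: (@cmeasure_le _ _ C); apply: closed_openC.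
  by apply: compact_closed => //; exact: norm_hausdorff.
move=> g M l cg gM hl.
have M0 : 0 <= M by have /andP[] := gM 0; exact: le_trans.
apply/lee_addgt0Pr => e e0.
pose N := (Num.truncn (M / e)).+1.
have NM : M <= N.+1%:R * e.
  rewrite -ler_pdivrMr//; apply/ltW/(lt_le_trans (truncnS_gt _)).
  by rewrite ler_nat.
pose A (i : nat) := [set x | i.+1%:R * e < g x].
have oA i : open (A i).
  apply: (@open_comp _ _ g [set r | i.+1%:R * e < r]); first by move=> *; exact: cg.
  exact: open_gt.
pose h x := \sum_(i < N) e * \1_(A i) x.
have hE x : h x = \sum_(i < N) e * (i.+1%:R * e < g x)%R%:R.
  apply: eq_bigr => i _; rewrite indicE; congr (_ * _%:R).
  by congr nat_of_bool; apply/idP/idP; rewrite inE.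
have mA i : measurable (A i : set (borel_rV R d)) by exact: open_measurable_rV.
apply: (@le_trans _ _ (\int[cmeasure C]_x (h x + e)%:E)%E).
  apply: ge0_le_integral => //.
  - by move=> x _; rewrite lee_fin; have /andP[] := gM x.
  - by apply/measurable_EFinP; exact: continuous_measurable_rV.
  - apply/measurable_EFinP; apply: measurable_funD; last exact: measurable_cst.
    apply: measurable_sum => i; apply: measurable_funM; first exact: measurable_cst.
    exact: measurable_indic.
  - move=> x _; rewrite lee_fin hE; apply: layer_ge (ltW e0) _.
    by have /andP[_ /le_trans] := gM x; exact.
have t0 (i : 'I_N) x : (0 <= (e * \1_(A i) x)%:E)%E.
  by rewrite lee_fin mulr_ge0 ?(ltW e0)// indicE.
have tm (i : 'I_N) : measurable_fun [set: borel_rV R d]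
    ((fun x => (e * \1_(A i) x)%:E) : borel_rV R d -> \bar R).
  by apply/measurable_EFinP; apply: measurable_funM;
    [exact: measurable_cst|exact: measurable_indic].
have -> : (\int[cmeasure C]_x (h x + e)%:E =
    \sum_(i < N) e%:E * cmeasure C (A i) + e%:E)%E.
  under eq_integral do rewrite EFinD -sumEFin.
  rewrite (@ge0_integralD _ _ _ (cmeasure C) setT measurableT
    (fun x => \sum_(i < N) (e * \1_(A i) x)%:E)%E (cst e%:E))//; first last.
  - by move=> x _; rewrite lee_fin (ltW e0).
  - exact: emeasurable_sum.
  - by move=> x _; exact: sume_ge0.
  have P1 : cmeasure C setT = 1%E by exact: probability_setT.
  rewrite integral_cst//. rewrite [X in (_ * X)%E]P1 mule1; congr (_ + _)%E.
  rewrite ge0_integral_sum//.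
  apply: eq_bigr => i _; under eq_integral do rewrite EFinM.
  rewrite ge0_integralZl//; first by rewrite integral_indic// setIT.
  - by apply/measurable_EFinP; exact: measurable_indic.
  - by rewrite lee_fin (ltW e0).
rewrite leeD2r//; apply: (@le_trans _ _ (\sum_(i < N) e * c (A i))%:E).
  rewrite -sumEFin; apply: lee_sum => i _; rewrite EFinM.
  by rewrite lee_wpmul2l ?lee_fin ?(ltW e0)//; exact: (@cmeasure_le _ _ C).
rewrite lee_fin.
have addc : continuous (fun x : R * R => x.1 + x.2) by exact: add_continuous.
have hU : (fun n => a n h) @ U --> \sum_(i < N) e * c (A i).
  rewrite (_ : (fun n => _) = fun n => \sum_(i < N) e * a n \1_(A i)); last first.
    by apply/funext => n; rewrite mean_sum; apply: eq_bigr => i _; rewrite meanZ.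
  apply: (cvg_big addc) => i _; exact: (cvgMl_tmp (cE (A i))).
apply/ler_addgt0Pr => e' e'0; apply: (cvgr_to_le hU).
have := hl _ e'0; rewrite nearE => /oU; apply: filterS => n; apply: le_trans.
apply: mean_le => x _; rewrite hE; apply: layer_le; last exact: ltW.
by have /andP[] := gM x.
Qed.

End LimitMeasure.

(** * Discrete harmonic measure *)

Section Taylor.
Context {R : realType}.
Implicit Types (t : R) (m : nat).

(** The second Taylor polynomial of [(1 + t)^(-m/2)] at [0]. *)
Definition ipow2 m t : R := 1 - m%:R / 2 * t + m%:R * (m%:R + 2) / 8 * t ^+ 2.

Lemma inv_sqrt_taylor t : `|t| <= 2^-1 ->
  `|(Num.sqrt (1 + t))^-1 - ipow2 1 t| <= 2 * `|t| ^+ 3.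
Proof.
move=> t2; have := t2; rewrite ler_norml => /andP[tl tu].
pose w := Num.sqrt (1 + t).
have w2 : w ^+ 2 = 1 + t by rewrite sqr_sqrtr//; lra.
have w0 : 0 < w by rewrite sqrtr_gt0; lra.
have wh : 2^-1 <= w.
  by rewrite -(@ler_pXn2r _ 2)// ?nnegrE ?invr_ge0// ?(ltW w0)// w2; lra.
pose q := ipow2 1 t.
have qE : q = 1 - t / 2 + 3 / 8 * t ^+ 2 by rewrite /q /ipow2; field.
have q0 : 0 < q by rewrite qE; nra.
have t0 : 0 <= `|t| by [].
have qw : `|q * w - 1| <= `|t| ^+ 3.
  apply: (@le_trans _ _ (`|q * w - 1| * `|q * w + 1|)).
    have qw0 : 0 <= q * w by rewrite mulr_ge0// ltW.
    by rewrite ler_peMr// ger0_norm; lra.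
  rewrite -normrM.
  have -> : (q * w - 1) * (q * w + 1) = t ^+ 3 * (5 / 8 - 15 / 64 * t + 9 / 64 * t ^+ 2).
    rewrite (_ : _ * _ = q ^+ 2 * w ^+ 2 - 1); last by ring.
    by rewrite w2 qE; field.
  rewrite normrM normrX ler_piMr ?exprn_ge0// ler_norml.
  by apply/andP; split; nra.
rewrite -/w -/q distrC.
have -> : q - w^-1 = (q * w - 1) / w by field; rewrite gt_eqF.
rewrite normrM mulrC ler_pM// normfV gtr0_norm// invf_ple ?posrE//.
Qed.

Lemma inv_sqrt_exp_taylor m : exists2 C : R, 0 < C & forall t, `|t| <= 2^-1 ->
  `|(Num.sqrt (1 + t))^-1 ^+ m - ipow2 m t| <= C * `|t| ^+ 3.
Proof.
elim: m => [|m [C C0 IH]].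
  exists 1 => // t _; rewrite expr0 /ipow2 !mul0r subr0 addr0 subrr normr0.
  by rewrite mulr_ge0// exprn_ge0.
pose a : R := m%:R / 2; pose b : R := m%:R * (m%:R + 2) / 8.
have a0 : 0 <= a by rewrite divr_ge0.
have b0 : 0 <= b by rewrite divr_ge0// mulr_ge0// addr_ge0.
exists (2 * C + 2 * (1 + a + b) + (a + b)); first by lra.
move=> t t2; have := t2; rewrite ler_norml => /andP[tl tu].
pose s := (Num.sqrt (1 + t))^-1; rewrite -/s.
have t0 : 0 <= `|t| by [].
have c0 : 0 <= `|t| ^+ 3 by rewrite exprn_ge0.
have s0 : 0 <= s by rewrite invr_ge0 sqrtr_ge0.
have s2 : s <= 2.
  rewrite -[2]invrK lef_pV2 ?posrE ?invr_gt0//; last by rewrite sqrtr_gt0; lra.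
  rewrite -(@ler_pXn2r _ 2)// ?nnegrE ?invr_ge0// ?sqrtr_ge0// sqr_sqrtr; lra.
have h1 := IH t t2; have h2 := inv_sqrt_taylor t2; rewrite -/s in h1 h2.
have PE : ipow2 m t = 1 - a * t + b * t ^+ 2 by [].
have P1 : ipow2 1 t = 1 - t / 2 + 3 / 8 * t ^+ 2 by rewrite /ipow2; field.
have PS : ipow2 m.+1 t = 1 - (a + 1 / 2) * t + (b + a / 2 + 3 / 8) * t ^+ 2.
  by rewrite /ipow2 /a /b -natr1; field.
have t21 : t ^+ 2 <= 1 by nra.
have /andP[at1 at2] : - a <= a * t <= a by apply/andP; split; nra.
have /andP[bt1 bt2] : - b <= b * t <= b by apply/andP; split; nra.
have bt3 : b * t ^+ 2 <= b by rewrite ler_piMr.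
have bt4 : 0 <= b * t ^+ 2 by rewrite mulr_ge0// sqr_ge0.
have -> : s ^+ m.+1 - ipow2 m.+1 t = s * (s ^+ m - ipow2 m t) +
    ipow2 m t * (s - ipow2 1 t) + t ^+ 3 * (- 3 / 8 * a - b / 2 + 3 / 8 * b * t).
  by rewrite exprS PS P1 PE; field.
apply: le_trans (ler_normD _ _) _; rewrite [leRHS]mulrDl lerD//.
  apply: le_trans (ler_normD _ _) _; rewrite [leRHS]mulrDl lerD//.
    by rewrite normrM -mulrA ler_pM// ger0_norm.
  rewrite normrM [2 * _]mulrC -mulrA ler_pM// PE ler_norml.
  by apply/andP; split; lra.
rewrite normrM normrX mulrC ler_wpM2r// ler_norml.
have -> : 3 / 8 * b * t = 3 / 8 * (b * t) by ring.
by apply/andP; split; lra.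
Qed.

End Taylor.

Section LatticeMean.
Context {R : realType} {d : nat}.
Local Notation T := 'rV[R]_d.
Implicit Types (x y z p w : T) (f g : T -> R) (r h : R).

Definition evec (i : 'I_d) : T := delta_mx ord0 i.

Lemma edot_evec w i : edot w (evec i) = w ord0 i.
Proof.
rewrite /edot (bigD1 i)//= mxE !eqxx mulr1 big1 ?addr0// => j ji.
by rewrite mxE eqxx /= (negbTE ji) mulr0.
Qed.

Lemma enorm_evec i : enorm (evec i) = 1.
Proof. by rewrite enormE edot_evec mxE !eqxx sqrtr1. Qed.

Definition lattice_mean r f x : R :=
  (2 * d%:R)^-1 * \sum_(i < d) (f (x + r *: evec i) + f (x - r *: evec i)).

Hypothesis d0 : (0 < d)%N.

Let d20 : 2 * d%:R != 0 :> R.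
Proof. by rewrite mulf_neq0// pnatr_eq0 -lt0n. Qed.

Let d20' : 0 <= (2 * d%:R)^-1 :> R.
Proof. by rewrite invr_ge0 mulr_ge0. Qed.

Lemma lattice_meanD r f g x :
  lattice_mean r (fun x => f x + g x) x = lattice_mean r f x + lattice_mean r g x.
Proof.
rewrite /lattice_mean -mulrDr -big_split /=.
by under eq_bigr do rewrite addrACA; reflexivity.
Qed.

Lemma lattice_meanZ r k f x :
  lattice_mean r (fun x => k * f x) x = k * lattice_mean r f x.
Proof.
rewrite /lattice_mean mulrCA; under eq_bigr do rewrite -mulrDr.
by rewrite -mulr_sumr.
Qed.

Lemma lattice_mean_cst r k x : lattice_mean r (fun=> k) x = k.
Proof.
rewrite /lattice_mean sumr_const card_ord -[k + k]mulr2n -mulrnA.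
by rewrite -[k *+ _]mulr_natl natrM mulrA mulVf ?mul1r.
Qed.

Lemma lattice_mean_le r f g x :
  (forall y, enorm (y - x) <= `|r| -> f y <= g y) ->
  lattice_mean r f x <= lattice_mean r g x.
Proof.
move=> fg; rewrite ler_wpM2l//; apply: ler_sum => i _; apply: lerD; apply: fg.
  by rewrite addrAC subrr add0r enormZ enorm_evec mulr1.
by rewrite addrAC subrr add0r enormN enormZ enorm_evec mulr1.
Qed.

Lemma lattice_mean_sqr r x :
  lattice_mean r (fun y => enorm y ^+ 2) x = enorm x ^+ 2 + r ^+ 2.
Proof.
rewrite /lattice_mean (eq_bigr (fun=> 2 * (enorm x ^+ 2 + r ^+ 2))); last first.
  move=> i _; rewrite sqr_enormD sqr_enormB enormZ enorm_evec mulr1.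
  by rewrite real_normK ?num_real//; ring.
rewrite sumr_const card_ord -mulrnAl -[2 *+ d]mulr_natr mulrA mulVf ?mul1r//.
Qed.

(** The lattice mean reproduces the Newtonian kernel up to third order: the
    second-order terms of the expansion add up to a multiple of its Laplacian,
    which vanishes. *)
Lemma lattice_mean_nker : (2 <= d)%N -> exists2 C : R, 0 < C &
  forall r h x p, x != p -> 0 < h -> h <= 6^-1 -> 0 <= r <= h * enorm (x - p) ->
  `|lattice_mean r (nker^~ p) x - nker x p| <= C * h ^+ 3 * nker x p.
Proof.
move=> d2; have [C C0 hC] := @inv_sqrt_exp_taylor R (d - 2).
pose m : R := (d - 2)%:R.
have dm : d%:R = m + 2 by rewrite /m natrB// subrK.
have m0 : 0 <= m by [].
pose b := m * (m + 2) / 8.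
have b0 : 0 <= b by rewrite divr_ge0// mulr_ge0// addr_ge0.
exists (27 * C + b); first by lra.
move=> r h x p xp h0 h6 /andP[r0 rh].
pose w := x - p; have w0 : 0 < enorm w by rewrite enorm_gt0 subr_eq0.
pose Q := enorm w ^+ 2; have Q0 : 0 < Q by rewrite exprn_gt0.
have rQ : r ^+ 2 <= h ^+ 2 * Q.
  by rewrite /Q -exprMn ler_pXn2r ?nnegrE// mulr_ge0 ?ltW.
pose t (e : R) i := (2 * e * r * w ord0 i + r ^+ 2) / Q.
have tle e i : `|e| = 1 -> `|t e i| <= 3 * h.
  move=> e1; rewrite normrM normfV (gtr0_norm Q0) ler_pdivrMr//.
  apply: le_trans (ler_normD _ _) _.
  have -> : 3 * h * Q = 2 * h * Q + h * Q by ring.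
  apply: lerD.
    rewrite !normrM e1 (ger0_norm r0) normr_nat mulr1 -!mulrA ler_wpM2l//.
    rewrite /Q expr2 mulrA ler_pM//; exact: coord_le_enorm.
  rewrite ger0_norm ?sqr_ge0//; apply: le_trans rQ _.
  by rewrite ler_wpM2r ?ltW// expr2; nra.
have nk e i : `|e| = 1 ->
    nker (x + (e * r) *: evec i) p = nker x p * (Num.sqrt (1 + t e i))^-1 ^+ (d - 2).
  move=> e1; rewrite /nker -exprMn -invfM; congr (_^-1 ^+ _).
  have -> : x + (e * r) *: evec i - p = w + (e * r) *: evec i by rewrite addrAC.
  rewrite -[LHS]ger0_norm ?enorm_ge0// -sqrtr_sqr -[enorm (x - p)]ger0_norm ?enorm_ge0//.
  rewrite -[X in _ = X * _]sqrtr_sqr -sqrtrM ?sqr_ge0//; congr Num.sqrt.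
  rewrite sqr_enormD edotZr edot_evec enormZ enorm_evec mulr1 real_normK ?num_real//.
  rewrite -/w -/Q exprMn -[e ^+ 2]real_normK ?num_real// e1 expr1n mul1r /t.
  by field; rewrite gt_eqF.
have e1 : `|1 : R| = 1 by rewrite normr1.
have eN1 : `|- 1 : R| = 1 by rewrite normrN1.
pose S : R := \sum_(i < d) (ipow2 (d - 2) (t 1 i) + ipow2 (d - 2) (t (- 1) i)).
have SE : S = 2 * d%:R * (1 + b * (r ^+ 2 / Q) ^+ 2).
  have E i : ipow2 (d - 2) (t 1 i) + ipow2 (d - 2) (t (- 1) i) =
      2 * (1 - m / 2 * (r ^+ 2 / Q) + b * (r ^+ 2 / Q) ^+ 2) +
      8 * b * (r ^+ 2 / Q ^+ 2) * (w ord0 i * w ord0 i).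
    by rewrite /ipow2 -/m /t /b; field; rewrite gt_eqF.
  rewrite /S (eq_bigr _ (fun i _ => E i)) big_split /= -mulr_sumr.
  rewrite -[X in _ + X]mulr_sumr sumr_const card_ord -/(edot w w) -sqr_enorm -/Q.
  rewrite -[(1 - _ + _) *+ d]mulr_natr dm /b.
  by field; rewrite gt_eqF.
have key : `|lattice_mean r (fun y => nker y p / nker x p) x - 1| <= (27 * C + b) * h ^+ 3.
  have nx : nker x p != 0 by rewrite gt_eqF// exprn_gt0// invr_gt0.
  have -> : lattice_mean r (fun y => nker y p / nker x p) x - 1 =
    (2 * d%:R)^-1 * (\sum_(i < d) (
      ((Num.sqrt (1 + t 1 i))^-1 ^+ (d - 2) - ipow2 (d - 2) (t 1 i)) +
      ((Num.sqrt (1 + t (- 1) i))^-1 ^+ (d - 2) - ipow2 (d - 2) (t (- 1) i)))) +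
    b * (r ^+ 2 / Q) ^+ 2.
    have -> : \sum_(i < d) (
      ((Num.sqrt (1 + t 1 i))^-1 ^+ (d - 2) - ipow2 (d - 2) (t 1 i)) +
      ((Num.sqrt (1 + t (- 1) i))^-1 ^+ (d - 2) - ipow2 (d - 2) (t (- 1) i))) =
      \sum_(i < d) (nker (x + r *: evec i) p / nker x p +
        nker (x - r *: evec i) p / nker x p) - S.
      rewrite /S -sumrB; apply: eq_bigr => i _.
      have := nk 1 i e1; have := nk (- 1) i eN1.
      rewrite mulN1r scaleNr mul1r => -> ->.
      rewrite ![nker x p * _]mulrC !mulfK//; ring.
    rewrite mulrBr -/(lattice_mean r (fun y => nker y p / nker x p) x) SE.
    by rewrite mulrA mulVf// mul1r; ring.
  apply: le_trans (ler_normD _ _) _; rewrite [leRHS]mulrDl; apply: lerD.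
    rewrite normrM (ger0_norm d20') mulrC ler_pdivrMr; last first.
      by rewrite mulr_gt0// ltr0n.
    apply: le_trans (ler_norm_sum _ _ _) _.
    have -> : 27 * C * h ^+ 3 * (2 * d%:R) = \sum_(i < d) (2 * (27 * C * h ^+ 3)).
      by rewrite sumr_const card_ord -[RHS]mulr_natr; ring.
    apply: ler_sum => i _; apply: le_trans (ler_normD _ _) _.
    have tay e : `|e| = 1 -> `|(Num.sqrt (1 + t e i))^-1 ^+ (d - 2) -
        ipow2 (d - 2) (t e i)| <= 27 * C * h ^+ 3.
      move=> ee; have th := tle e i ee.
      have t2 : `|t e i| <= 2^-1 by lra.
      apply: le_trans (hC _ t2) _.
      rewrite (_ : 27 * C * h ^+ 3 = C * (3 * h) ^+ 3); last by ring.
      by rewrite ler_pM2l// ler_pXn2r ?nnegrE// mulr_ge0// ltW.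
    by have := tay _ e1; have := tay _ eN1; lra.
  have u0 : 0 <= r ^+ 2 / Q by rewrite divr_ge0 ?sqr_ge0 ?ltW.
  have uh : r ^+ 2 / Q <= h ^+ 2 by rewrite ler_pdivrMr.
  rewrite ger0_norm; last by rewrite mulr_ge0 ?sqr_ge0.
  apply: ler_wpM2l => //.
  have : (r ^+ 2 / Q) ^+ 2 <= (h ^+ 2) ^+ 2 by rewrite ler_pXn2r ?nnegrE ?sqr_ge0.
  have : h ^+ 4 <= h ^+ 3 by rewrite exprS ler_piMl ?exprn_ge0 ?ltW//; lra.
  by rewrite -exprM => ? ?; lra.
have nx0 : 0 < nker x p by rewrite exprn_gt0// invr_gt0.
have -> : lattice_mean r (nker^~ p) x - nker x p =
    nker x p * (lattice_mean r (fun y => nker y p / nker x p) x - 1).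
  rewrite mulrBr mulr1 -lattice_meanZ; congr (lattice_mean _ _ _ - _).
  by apply/funext => y; rewrite mulrC divfK// gt_eqF.
by rewrite normrM (gtr0_norm nx0) mulrC ler_wpM2r// ltW.
Qed.

End LatticeMean.

Section PotentialLimit.
Context {R : realType} {d : nat}.
Local Notation T := 'rV[R]_d.
Local Notation B := (borel_rV R d).
Hypothesis hd : (3 <= d)%N.
Local Open Scope ereal_scope.

Lemma measurable_tker' e y : (0 < e)%R ->
  measurable_fun [set: B] ((fun x => (tker e y x)%:E) : B -> \bar R).
Proof.
move=> e0; rewrite (_ : (fun x => _) = fun x : B => (tker e x y)%:E).
  by apply/measurable_EFinP; exact: measurable_tker.
by apply/funext => x; rewrite tkerC.
Qed.

Lemma tker_continuous' e y : (0 < e)%R -> continuous (tker e y : T -> R).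
Proof.
move=> e0; rewrite (_ : tker e y = fun z => tker e z y).
  exact: tker_continuous.
by apply/funext => z; rewrite tkerC.
Qed.

Lemma integral_eq0_null (mu : {measure set B -> \bar R}) (f : T -> R) :
  measurable_fun setT (f : B -> R) -> (forall x, 0 <= f x)%R ->
  \int[mu]_x (f x)%:E = 0 -> mu [set x | f x != 0%R] = 0.
Proof.
move=> mf f0 If.
have : \int[mu]_(x in setT) `|(f x)%:E| = 0.
  by rewrite -[RHS]If; apply: eq_integral => x _; rewrite gee0_abs ?lee_fin.
move=> /(ae_eq_integral_abs mu measurableT ((measurable_EFinP _ _).2 mf)).1.
move=> [N [mN N0 fN]]; apply/eqP; rewrite eq_le measure_ge0 andbT -N0.
apply: le_measure; rewrite ?inE//.
  rewrite (_ : [set x | _] = setT `&` f @^-1` (~` [set 0%R])).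
    by apply: mf => //; exact: measurableC.
  by rewrite setTI; apply/seteqP; split => x /= /eqP.
by apply: subset_trans fN => x /= /eqP fx h; apply: fx; case: (h I).
Qed.

Lemma cvg_integral_tker (mu : {measure set B -> \bar R}) (D : set B) (x : T) :
  measurable D ->
  (fun k => \int[mu]_(y in D) (tker (k.+1%:R^-1) x y)%:E) @ \oo -->
  \int[mu]_(y in D) newton x y.
Proof.
move=> mD; rewrite (eq_integral (fun y : B => limn (fun k => (tker k.+1%:R^-1 x y)%:E)));
  last by move=> y _; apply/esym/cvg_lim => //; exact: cvg_tker.
apply: cvg_monotone_convergence => //.
- by move=> n; apply: measurable_funTS; apply: measurable_tker'; rewrite invr_gt0.
- by move=> n y _; rewrite lee_fin tker_ge0.
- move=> y _ a b ab; rewrite lee_fin tker_anti ?invr_gt0//.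
  by rewrite lef_pV2 ?posrE// ler_nat.
Qed.

Lemma integral_newton_le (mu : {measure set B -> \bar R}) (D : set B) (x : T) c :
  measurable D ->
  (forall e, (0 < e)%R -> \int[mu]_(y in D) (tker e x y)%:E <= c) ->
  \int[mu]_(y in D) newton x y <= c.
Proof.
move=> mD h; rewrite -(cvg_lim _ (@cvg_integral_tker mu D x mD))//.
apply: lime_le; first by apply/cvg_ex; eexists; exact: cvg_integral_tker.
by apply: nearW => k; apply: h; rewrite invr_gt0.
Qed.

Lemma integral_tker_le (mu : {measure set B -> \bar R}) (D : set B) (x : T) e :
  measurable D -> (0 < e)%R ->
  \int[mu]_(y in D) (tker e x y)%:E <= \int[mu]_(y in D) newton x y.
Proof.
move=> mD e0; apply: ge0_le_integral => //.
- by move=> y _; rewrite lee_fin tker_ge0.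
- by apply: measurable_funTS; exact: measurable_tker'.
- by apply: measurable_funTS; exact: measurable_newton'.
- by move=> y _; exact: tker_le_newton.
Qed.

End PotentialLimit.

Section Walk.
Context {R : realType} {d : nat}.
Local Notation T := 'rV[R]_d.
Local Notation B := (borel_rV R d).
Hypothesis hd : (3 <= d)%N.
Variables (E G K : set T) (x0 : T).
Hypotheses (E0 : E !=set0) (clE : closed E) (GK : G `<=` K) (cK : compact K).
Hypotheses (Gx0 : G x0) (GE : forall x, G x -> ~ E x).
Hypothesis (Ginv : forall x y, G x -> enorm (y - x) < euclid_dist E x -> G y).
Implicit Types (f g : T -> R) (h : R).

Let D := euclid_dist E.
Let d0 : (0 < d)%N. Proof. exact: leq_trans hd. Qed.

(** One step of a walk that moves by [h] times the distance to [E].  For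
    [h < 1] it never meets [E], and at each step the kernel of a pole in [E]
    changes by a relative error of order [h^3], however close to [E] the walk
    is. *)
Definition wstep h f x := lattice_mean (h * D x) f x.

Let D_gt0 x : G x -> 0 < D x.
Proof. by move=> /GE; exact: euclid_dist_gt0. Qed.

Lemma wstep_le h f g : 0 < h < 1 -> (forall x, G x -> f x <= g x) ->
  forall x, G x -> wstep h f x <= wstep h g x.
Proof.
move=> /andP[h0 h1] fg x Gx; apply: lattice_mean_le => // y yx; apply/fg/(Ginv Gx).
apply: le_lt_trans yx _; have Dx := D_gt0 Gx.
by rewrite gtr0_norm ?mulr_gt0// -[ltRHS]mul1r ltr_pM2r.
Qed.

Lemma iter_wstep_le h f g j : 0 < h < 1 -> (forall x, G x -> f x <= g x) ->
  forall x, G x -> iter j (wstep h) f x <= iter j (wstep h) g x.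
Proof. by move=> h01 fg; elim: j => //= j IH; exact: wstep_le. Qed.

Lemma iter_wstepD h f g j : iter j (wstep h) (fun x => f x + g x) =
  (fun x => iter j (wstep h) f x + iter j (wstep h) g x).
Proof.
elim: j => //= j ->; apply/funext => x; exact: lattice_meanD.
Qed.

Lemma iter_wstepZ h k f j : iter j (wstep h) (fun x => k * f x) =
  (fun x => k * iter j (wstep h) f x).
Proof. by elim: j => //= j ->; apply/funext => x; exact: lattice_meanZ. Qed.

Lemma iter_wstep_cst h k j : iter j (wstep h) (fun=> k) = (fun=> k).
Proof. by elim: j => //= j ->; apply/funext => x; exact: lattice_mean_cst. Qed.

(** The mean over the first [J] positions of the walk from [x0].  Averaging over
    time spares a stopping time: most of the time is spent near [E]. *)
Definition walk_avg h (J : nat) f : R :=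
  J%:R^-1 * \sum_(j < J) iter j (wstep h) f x0.

Program Definition walk_mean h J (h01 : 0 < h < 1) (J0 : (0 < J)%N) : mean R G :=
  @Mean R T G (walk_avg h J) _ _ _ _.
Next Obligation.
move=> h J h01 J0 f g; rewrite /walk_avg -mulrDr -big_split /=.
by under eq_bigr do rewrite iter_wstepD.
Qed.
Next Obligation.
move=> h J h01 J0 k f; rewrite /walk_avg mulrCA; under eq_bigr do rewrite iter_wstepZ.
by rewrite -mulr_sumr.
Qed.
Next Obligation.
move=> h J h01 J0 f g fg; rewrite /walk_avg ler_wpM2l ?invr_ge0//.
by apply: ler_sum => j _; exact: iter_wstep_le.
Qed.
Next Obligation.
move=> h J h01 J0; rewrite /walk_avg; under eq_bigr do rewrite iter_wstep_cst.
by rewrite sumr_const card_ord mulVf// pnatr_eq0 -lt0n.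
Qed.

(** Each step adds [h^2 D^2] to the second moment, which stays bounded, so
    that the time averages of [D^2] are small. *)
Lemma walk_avg_dist h J M : 0 < h < 1 -> (0 < J)%N ->
  (forall x, G x -> enorm x ^+ 2 <= M) ->
  walk_avg h J (fun x => D x ^+ 2) <= M / (h ^+ 2 * J%:R).
Proof.
move=> h01 J0 GM; have /andP[h0 h1] := h01.
pose q (x : T) := enorm x ^+ 2.
have stepq : wstep h q = fun x => q x + h ^+ 2 * D x ^+ 2.
  by apply/funext => x; rewrite /wstep lattice_mean_sqr// exprMn.
have tel j : h ^+ 2 * \sum_(i < j) iter i (wstep h) (fun x => D x ^+ 2) x0 =
    iter j (wstep h) q x0 - q x0.
  elim: j => [|j IH]; first by rewrite big_ord0 mulr0 subrr.
  rewrite big_ord_recr mulrDr IH iterSr stepq iter_wstepD iter_wstepZ /=; ring.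
have Jr : 0 < J%:R :> R by rewrite ltr0n.
rewrite /walk_avg ler_pdivlMr ?mulr_gt0 ?exprn_gt0//.
set S := (X in _ * X * _).
have -> : J%:R^-1 * S * (h ^+ 2 * J%:R) = h ^+ 2 * S by field; rewrite gt_eqF.
rewrite /S tel lerBlDr.
have := @iter_wstep_le h q (fun=> M) J h01 GM x0 Gx0.
by rewrite iter_wstep_cst => /le_trans; apply; rewrite lerDl sqr_ge0.
Qed.

(** In [J] steps the relative errors accumulate to at most
    [(1 + C h^3)^J - 1], which is of the order of [h^3 J]. *)
Lemma walk_avg_nker : exists2 C : R, 0 < C & forall h J p, E p -> 0 < h ->
  h <= 6^-1 -> (0 < J)%N -> C * h ^+ 3 * J%:R <= 2^-1 ->
  `|walk_avg h J (nker^~ p) - nker x0 p| <= 2 * (C * h ^+ 3 * J%:R) * nker x0 p.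
Proof.
have [C C0 hC] := @lattice_mean_nker R d d0 (ltnW hd).
exists C => // h J p Ep h0 h6 J0.
have h01 : 0 < h < 1 by rewrite h0 /=; lra.
set c := C * h ^+ 3; have c0 : 0 < c by rewrite mulr_gt0 ?exprn_gt0.
move=> cJ; have J1 : 1 <= J%:R :> R by rewrite ler1n.
have c2 : c <= 2^-1 by apply: le_trans cJ; rewrite ler_peMr// ltW.
pose N := nker^~ p.
have N0 x : 0 <= N x by exact: nker_ge0.
have stepN x : G x -> `|wstep h N x - N x| <= c * N x.
  move=> Gx; apply: (hC (h * D x) h x p) => //.
    by apply/eqP => xp; apply: (GE Gx); rewrite xp.
  rewrite mulr_ge0 ?(ltW h0) ?(ltW (D_gt0 Gx))//= ler_pM2l//.
  exact: euclid_dist_le.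
have lo j : forall x, G x -> (1 - c) ^+ j * N x <= iter j (wstep h) N x.
  elim: j => [x _|j IH x Gx]; first by rewrite expr0 mul1r.
  have := wstep_le h01 IH Gx; apply: le_trans.
  rewrite /wstep lattice_meanZ// -/(wstep h N x) exprSr -mulrA.
  rewrite ler_wpM2l ?exprn_ge0//; first by lra.
  by have := stepN _ Gx; rewrite ler_norml => /andP[+ _]; lra.
have up j : forall x, G x -> iter j (wstep h) N x <= (1 + c) ^+ j * N x.
  elim: j => [x _|j IH x Gx]; first by rewrite expr0 mul1r.
  have := wstep_le h01 IH Gx; move/le_trans; apply.
  rewrite /wstep lattice_meanZ// -/(wstep h N x) exprSr -mulrA.
  rewrite ler_wpM2l ?exprn_ge0//; first by lra.
  by have := stepN _ Gx; rewrite ler_norml => /andP[_ +]; lra.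
have bern j : 1 - j%:R * c <= (1 - c) ^+ j.
  elim: j => [|j IH]; first by rewrite mul0r subr0.
  rewrite exprSr -natr1; have : 0 <= j%:R :> R by [].
  have : 0 <= (1 - c) ^+ j by rewrite exprn_ge0//; lra.
  have [hj|hj] := leP 0 (1 - j%:R * c); first by nra.
  by move=> ? ?; nra.
have bern' j : (j <= J)%N -> (1 + c) ^+ j <= 1 + 2 * (c * J%:R).
  move=> jJ; apply: (@le_trans _ _ ((1 + c) ^+ J)).
    by rewrite ler_weXn2l//; lra.
  have y0 : 0 <= (1 + c) ^+ J by rewrite exprn_ge0//; lra.
  have : (1 + c) ^+ J * (1 - c) ^+ J <= 1.
    by rewrite -exprMn exprn_ile1//; nra.
  have bJ := bern J; rewrite [J%:R * c]mulrC in bJ.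
  move=> /(le_trans (ler_wpM2l y0 bJ)) le1.
  rewrite -(@ler_pM2r _ (1 - c * J%:R)); last by lra.
  apply: le_trans le1 _; have : 0 < c * J%:R by rewrite mulr_gt0// ltr0n.
  by nra.
have Jr : 0 < J%:R :> R by rewrite ltr0n.
have sumc (k : R) : J%:R^-1 * \sum_(j < J) k = k.
  by rewrite sumr_const card_ord -[k *+ J]mulr_natl mulKf// gt_eqF.
rewrite ler_norml lerBlDr lerBrDr; apply/andP; split.
  apply: (@le_trans _ _ (J%:R^-1 * \sum_(j < J) (1 - J%:R * c) * nker x0 p)).
    have : 0 <= c * J%:R * nker x0 p by rewrite mulr_ge0 ?nker_ge0// mulr_ge0// ltW.
    by rewrite sumc; lra.
  rewrite ler_wpM2l ?invr_ge0//; apply: ler_sum => j _.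
  apply: le_trans (lo j x0 Gx0); rewrite ler_wpM2r ?nker_ge0//.
  apply: le_trans (bern j); rewrite lerD2l lerN2 ler_wpM2r ?(ltW c0)//.
  by rewrite ler_nat ltnW.
apply: (@le_trans _ _ (J%:R^-1 * \sum_(j < J) (1 + 2 * (c * J%:R)) * nker x0 p)).
  rewrite ler_wpM2l ?invr_ge0//; apply: ler_sum => j _.
  apply: le_trans (up j x0 Gx0) _; rewrite ler_wpM2r ?nker_ge0//.
  by apply: bern'; exact: ltnW.
by rewrite sumc; lra.
Qed.

(** Discrete harmonic measure: the laws of fine lattice walks from [x0] inside
    [G], with steps proportional to the distance to [E], subconverge to a
    measure on [E] that sweeps the unit mass at [x0]. *)
Lemma harmonic_measure : exists P : probability B R,
  [/\ P (~` K) = 0%E, P (~` E) = 0%E,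
      forall p, E p -> (potential P p <= (nker x0 p)%:E)%E &
      forall p e, E p -> 0 < e -> (forall z, G z -> e <= enorm (p - z)) ->
        potential P p = (nker x0 p)%:E].
Proof.
have [C C0 hC] := walk_avg_nker.
have [M0 [_ KM]] : bounded_set K by exact: compact_bounded.
pose M := (d%:R * (`|M0| + 1)) ^+ 2.
have GM x : G x -> enorm x ^+ 2 <= M.
  move=> /GK Kx; rewrite /M ler_pXn2r ?nnegrE ?enorm_ge0 ?mulr_ge0 ?addr_ge0//.
  apply: le_trans (enorm_le_mx_norm x) _; rewrite ler_wpM2l//; apply: KM => //.
  by rewrite (le_lt_trans (ler_norm _))// ltrDl.
pose t (n : nat) : R := n.+3%:R^-1.
have t0 n : 0 < t n by rewrite invr_gt0 ltr0n.
have t3 n : t n <= 3^-1 by rewrite lef_pV2 ?posrE// ler_nat.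
(* The walk has to reach [E], that is [h^2 J] must tend to infinity, while the
   accumulated error [h^3 J] tends to [0]; here they are [1 / t] and [t]. *)
pose h n := t n ^+ 2; pose J (n : nat) := (n.+3 ^ 5)%N.
have h0 n : 0 < h n by rewrite exprn_gt0.
have h6 n : h n <= 6^-1 by rewrite /h; have := t3 n; have := t0 n; nra.
have h01 n : 0 < h n < 1 by rewrite h0 /=; have := h6 n; lra.
have J0 n : (0 < J n)%N by rewrite expn_gt0.
have hJ3 n : h n ^+ 3 * (J n)%:R = t n.
  have v0 : n.+3%:R != 0 :> R by rewrite pnatr_eq0.
  by rewrite /h /J natrX -exprM /t; move: n.+3%:R v0 => v v0; field.
have hJ2 n : h n ^+ 2 * (J n)%:R = n.+3%:R.
  have v0 : n.+3%:R != 0 :> R by rewrite pnatr_eq0.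
  by rewrite /h /J natrX -exprM /t; move: n.+3%:R v0 => v v0; field.
have tnear e : 0 < e -> \forall n \near \oo, t n <= e.
  move=> e0; near=> n; apply: (@le_trans _ _ n.+1%:R^-1).
    by rewrite /t lef_pV2 ?posrE ?ltr0n// ler_nat !ltnS -addn2 leq_addr.
  by apply/ltW; near: n; exact: (near_infty_natSinv_lt (PosNum e0)).
have [P [PK hP]] := limit_measure (fun n => walk_mean (h01 n) (J0 n)) GK cK.
have near_nker p e : E p -> 0 < e -> \forall n \near \oo,
    `|walk_avg (h n) (J n) (nker^~ p) - nker x0 p| <= e.
  move=> Ep e0; near=> n.
  have tn1 : t n <= (2 * C)^-1.
    by near: n; apply: tnear; rewrite invr_gt0 mulr_gt0.
  have tn2 : t n <= e / (2 * C * (nker x0 p + 1)).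
    near: n; apply: tnear.
    by rewrite divr_gt0// mulr_gt0// ?mulr_gt0// ltr_wpDl// nker_ge0.
  have CJ : C * h n ^+ 3 * (J n)%:R = C * t n by rewrite -mulrA hJ3.
  have h2 : C * h n ^+ 3 * (J n)%:R <= 2^-1.
    rewrite CJ; move: tn1; rewrite invfM -ler_pdivlMl//.
    by rewrite mulrC.
  apply: le_trans (hC _ _ _ Ep (h0 n) (h6 n) (J0 n) h2) _; rewrite CJ.
  have N0 : 0 <= nker x0 p by exact: nker_ge0.
  have N1 : 0 < 2 * C * (nker x0 p + 1) by rewrite !mulr_gt0// ltr_wpDl.
  move: tn2; rewrite ler_pdivlMr// => tn2; have := t0 n; nra.
have cD : continuous D by exact: euclid_dist_continuous.
have GpE p z : E p -> G z -> p != z.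
  by move=> Ep Gz; apply/eqP => pz; apply: (GE Gz); rewrite -pz.
have tker_lim p e : E p -> 0 < e -> (\int[P]_z (tker e p z)%:E <= (nker x0 p)%:E)%E.
  move=> Ep e0; apply: (hP _ (e^-1 ^+ (d - 2))).
  - exact: tker_continuous'.
  - by move=> z; rewrite tker_ge0 tker_le.
  - move=> e' e'0; near=> n; apply: (@le_trans _ _ (walk_avg (h n) (J n) (nker^~ p))).
      apply: (mean_le (walk_mean (h01 n) (J0 n))) => z Gz.
      rewrite -lee_fin nkerC -newton_neq//; last exact: GpE.
      exact: tker_le_newton.
    have : `|walk_avg (h n) (J n) (nker^~ p) - nker x0 p| <= e'.
      by near: n; exact: near_nker.
    by rewrite ler_norml => /andP[_ +]; lra.
exists P; split => //.
- pose g x := Num.min (D x ^+ 2) 1.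
  have g01 x : 0 <= g x <= 1 by rewrite le_min ge_min lexx orbT ler01 sqr_ge0.
  have cg : continuous g.
    move=> x; apply: (@continuous_min _ _ (fun x => D x ^+ 2) (cst 1)).
      apply: (@continuous_comp _ _ _ D (fun r : R => r ^+ 2)); first exact: cD.
      exact: exprn_continuous.
    exact: cst_continuous.
  have Ig : (\int[P]_x (g x)%:E = 0)%E.
    apply/eqP; rewrite eq_le integral_ge0 ?andbT; last first.
      by move=> x _; rewrite lee_fin; have /andP[] := g01 x.
    apply: (hP _ 1) => // e e0; near=> n; rewrite add0r.
    apply: (@le_trans _ _ (walk_avg (h n) (J n) (fun x => D x ^+ 2))).
      apply: (mean_le (walk_mean (h01 n) (J0 n))) => z Gz.
      by rewrite ge_min lexx.
    apply: le_trans (walk_avg_dist (h01 n) (J0 n) GM) _; rewrite hJ2.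
    have Mp : 0 < `|M| + 1 by rewrite ltr_wpDl.
    have : t n <= e / (`|M| + 1) by near: n; apply: tnear; rewrite divr_gt0.
    rewrite ler_pdivlMr//; apply: le_trans.
    rewrite mulrC ler_wpM2l ?(ltW (t0 n))//.
    by rewrite (le_trans (ler_norm _))// lerDl.
  rewrite -(integral_eq0_null (continuous_measurable_rV cg) _ Ig); last first.
    by move=> x; have /andP[] := g01 x.
  congr (P _); apply/seteqP; split => x /=.
    move=> nEx; rewrite gt_eqF// lt_min ltr01 andbT exprn_gt0//.
    exact: euclid_dist_gt0.
  move=> /eqP gx Ex; apply: gx; rewrite /g /D euclid_dist_in// expr0n /=.
  by rewrite min_l// ler01.
- by move=> p Ep; apply: integral_newton_le => // e e0; exact: tker_lim.
- move=> p e Ep e0 pG.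
  have tkE z : G z -> tker e p z = nker z p.
    by move=> /pG h'; rewrite tkerE// nkerC.
  pose L := e^-1 ^+ (d - 2).
  have gL z : 0 <= L - tker e p z <= L.
    by rewrite subr_ge0 tker_le//= lerBlDr lerDl tker_ge0.
  have ctk : continuous (tker e p) by exact: tker_continuous'.
  have hg : (\int[P]_z (L - tker e p z)%:E <= (L - nker x0 p)%:E)%E.
    apply: (hP _ L) => //.
      by move=> z; exact: (cvgB (cvg_cst _) (ctk z)).
    move=> e' e'0; near=> n.
    rewrite (mean_eq (walk_mean (h01 n) (J0 n)) (g := fun z => L + (-1) * nker z p)).
      rewrite meanD meanZ mean_cst /=.
      have : `|walk_avg (h n) (J n) (nker^~ p) - nker x0 p| <= e'.
        by near: n; exact: near_nker.
      by rewrite ler_norml => /andP[+ _]; lra.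
    by move=> z Gz; rewrite tkE// mulN1r.
  apply/eqP; rewrite eq_le integral_newton_le//=; last by move=> *; exact: tker_lim.
  apply: le_trans (integral_tker_le hd P p measurableT e0).
  have intL : (\int[P]_z (L - tker e p z)%:E + \int[P]_z (tker e p z)%:E = L%:E)%E.
    rewrite -ge0_integralD//.
    - under eq_integral do rewrite -EFinD subrK.
      by rewrite integral_cst// [X in (_ * X)%E]probability_setT mule1.
    - by move=> z _; rewrite lee_fin; have /andP[] := gL z.
    - apply/measurable_EFinP; apply: measurable_funB; first exact: measurable_cst.
      by apply/measurable_EFinP; exact: measurable_tker'.
    - by move=> z _; rewrite lee_fin tker_ge0.
    - exact: measurable_tker'.
  have tfin : (\int[P]_z (tker e p z)%:E \is a fin_num)%E.
    rewrite ge0_fin_numE; last by apply: integral_ge0 => z _; rewrite lee_fin tker_ge0.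
    by apply: le_lt_trans (tker_lim p e Ep e0) _; exact: ltry.
  have hfin : (\int[P]_z (L - tker e p z)%:E \is a fin_num)%E.
    rewrite ge0_fin_numE; last first.
      by apply: integral_ge0 => z _; rewrite lee_fin; have /andP[] := gL z.
    by apply: le_lt_trans hg _; exact: ltry.
  move: hg intL; rewrite -(fineK tfin) -(fineK hfin) -EFinD !lee_fin => hg [].
  by lra.
Unshelve. all: by end_near. Qed.

End Walk.

(** * Spherical measures *)

Section Sphere.
Context {R : realType} {d : nat}.
Local Notation T := 'rV[R]_d.
Local Notation B := (borel_rV R d).
Hypothesis hd : (3 <= d)%N.

Lemma integral_full (mu : {measure set B -> \bar R}) (A : set B) (f : B -> \bar R) :
  measurable A -> mu (~` A) = 0%E -> measurable_fun setT f ->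
  (forall x, 0 <= f x)%E -> (\int[mu]_x f x = \int[mu]_(x in A) f x)%E.
Proof.
move=> mA A0 mf f0; rewrite (ge0_negligible_integral (N := ~` A))//.
  by rewrite setDE setTI setCK.
exact: measurableC.
Qed.

(** Inversion in the sphere [|z - y| = r] multiplies the distances to the points
    of that sphere by [r / |p - y|], so that the potentials at [p] and at its
    image of a measure on the sphere are proportional. *)
Definition inversion (y : T) (r : R) (p : T) : T :=
  y + (r ^+ 2 / enorm (p - y) ^+ 2) *: (p - y).

Lemma enorm_inversion y r p z : p != y -> 0 < r -> enorm (z - y) = r ->
  enorm (inversion y r p - z) = r / enorm (p - y) * enorm (p - z).
Proof.
move=> py r0 zr; have u0 : 0 < enorm (p - y) by rewrite enorm_gt0 subr_eq0.
apply/eqP; rewrite -(@eqrXn2 _ 2)// ?enorm_ge0//; last first.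
  by rewrite mulr_ge0 ?enorm_ge0// divr_ge0 ?enorm_ge0// ltW.
have -> : inversion y r p - z = (r ^+ 2 / enorm (p - y) ^+ 2) *: (p - y) - (z - y).
  by rewrite /inversion [y + _]addrC opprB addrA.
have -> : p - z = (p - y) - (z - y) by rewrite opprB addrA subrK.
move: (p - y) (z - y) zr u0 => u v zr u0.
rewrite exprMn !sqr_enormB zr enormZ edotZl ger0_norm ?divr_ge0 ?sqr_ge0//.
by apply/eqP; field; rewrite gt_eqF.
Qed.

Lemma enorm_inversion_center y r p : p != y -> 0 < r ->
  enorm (inversion y r p - y) = r ^+ 2 / enorm (p - y).
Proof.
move=> py r0; have u0 : 0 < enorm (p - y) by rewrite enorm_gt0 subr_eq0.
rewrite /inversion addrAC subrr add0r enormZ ger0_norm ?divr_ge0 ?sqr_ge0//.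
by field; rewrite gt_eqF.
Qed.

(** The uniform measure of a sphere, characterized by its potential.  It is
    the harmonic measure of the ball from the centre, which gives the potential
    outside; inside, inversion in the sphere exchanges the two regions. *)
Lemma sphere_measure (y : T) (r : R) : 0 < r -> exists P : probability B R,
  [/\ P (~` [set z | enorm (z - y) = r]) = 0%E,
      forall p, (potential P p <= (tker r p y)%:E)%E &
      forall p, r < enorm (p - y) -> potential P p = newton p y].
Proof.
move=> r0; pose E := [set z : T | r <= enorm (z - y)].
pose G := [set z : T | enorm (z - y) < r]; pose K := [set z : T | enorm (z - y) <= r].
have d0 : (0 < d)%N by exact: leq_trans hd.
have E0 : E !=set0.
  exists (y + r *: evec (Ordinal d0)); rewrite /E /= addrAC subrr add0r.
  by rewrite enormZ enorm_evec mulr1 ger0_norm// ltW.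
have GK : G `<=` K by move=> z /ltW.
have Gy : G y by rewrite /G /= subrr enorm0.
have GE z : G z -> ~ E z by rewrite /G /E /= leNgt => ->.
have Ginv x z : G x -> enorm (z - x) < euclid_dist E x -> G z.
  move=> _ zx; rewrite /G /= ltNge; apply/negP => zE.
  by have := euclid_dist_le x (zE : E z); rewrite enormB leNgt zx.
have [P [PK PE Ple Peq]] := harmonic_measure hd E0 (@closed_eball_compl R d y r) GK
  (@compact_eball R d y r) Gy GE Ginv.
have mS := measurable_sphere y r.
have PS : P (~` [set z | enorm (z - y) = r]) = 0%E.
  apply/eqP; rewrite eq_le measure_ge0 andbT.
  apply: (@le_trans _ _ (P (~` K `|` ~` E))).
    apply: le_measure; rewrite ?inE; first exact: measurableC.
      by apply: measurableU; apply: measurableC; apply: closed_measurable_rV;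
        [exact: closed_eball|exact: closed_eball_compl].
    move=> z /= zr; apply: contrapT => /not_orP[/contrapT h1 /contrapT h2].
    by apply: zr; apply/eqP; rewrite eq_le h1.
  rewrite (le_trans (measureU2 _ _ _))//.
  + by apply: measurableC; apply: closed_measurable_rV; exact: closed_eball.
  + by apply: measurableC; apply: closed_measurable_rV; exact: closed_eball_compl.
  + have PK' : (P (~` K) <= 0)%E by rewrite PK.
    have PE' : (P (~` E) <= 0)%E by rewrite PE.
    by rewrite -[leRHS]adde0; exact: leeD.
have out p : r < enorm (p - y) -> potential P p = newton p y.
  move=> rp; have py : p != y.
    by rewrite -subr_eq0 -enorm_gt0; apply: lt_trans rp.
  rewrite newton_neq// nkerC; apply: (Peq _ (enorm (p - y) - r)); first exact: ltW.
    by rewrite subr_gt0.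
  move=> z zG; rewrite lerBlDr; apply: le_trans (ler_enorm_dist p z y) _.
  by rewrite lerD2l ltW.
exists P; split => // p.
have [rp|pr] := leP r (enorm (p - y)).
  by rewrite tkerE// nkerC; exact: Ple.
rewrite tker_eq ?(ltW pr)//.
have [->|py] := eqVneq p y.
  rewrite /potential (integral_full mS PS)//; last 2 first.
  - exact: measurable_newton'.
  - by move=> z; exact: newton_ge0.
  rewrite (eq_integral (fun=> (r^-1 ^+ (d - 2))%:E)); last first.
    move=> z; rewrite inE /= => zr.
    have yz : enorm ((y : T) - z) = r by rewrite enormB.
    have rz : r <= enorm ((y : T) - z) by rewrite yz.
    by rewrite (newtonE hd r0 rz) tker_eq// yz.
  rewrite integral_cst//; apply: (@le_trans _ _ ((r^-1 ^+ (d - 2))%:E * 1)%E).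
    apply: lee_wpmul2l; first by rewrite lee_fin exprn_ge0// invr_ge0 ltW.
    exact: probability_le1.
  by rewrite mule1.
have u0 : 0 < enorm (p - y) by rewrite enorm_gt0 subr_eq0.
pose q := inversion y r p.
have qy : enorm (q - y) = r ^+ 2 / enorm (p - y) by exact: enorm_inversion_center.
have rq : r < enorm (q - y).
  by rewrite qy ltr_pdivlMr// expr2 ltr_pM2l.
pose c := (r / enorm (p - y)) ^+ (d - 2).
have c0 : 0 <= c by rewrite exprn_ge0// divr_ge0 ?ltW.
have pot : potential P p = (c%:E * potential P q)%E.
  rewrite /potential (integral_full mS PS); first last.
  - by move=> z; exact: newton_ge0.
  - exact: measurable_newton'.
  rewrite [X in (_ * X)%E](integral_full mS PS); first last.
  - by move=> z; exact: newton_ge0.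
  - exact: measurable_newton'.
  rewrite -ge0_integralZl//; first last.
  - by move=> z _; exact: newton_ge0.
  - by apply: measurable_funTS; exact: measurable_newton'.
  apply: eq_integral => z; rewrite inE /= => zr.
  have pz : p != z.
    by apply/eqP => pz; move: pr; rewrite pz zr ltxx.
  have pz0 : 0 < enorm (p - z) by rewrite enorm_gt0 subr_eq0.
  have qz : q != z.
    rewrite -subr_eq0 -enorm_eq0 enorm_inversion// gt_eqF// mulr_gt0// divr_gt0//.
  rewrite !newton_neq// -EFinM /nker enorm_inversion// /c -exprMn; congr (_ ^+ _)%:E.
  by field; rewrite !gt_eqF.
rewrite pot (out _ rq) (newton_neq hd); last first.
  by rewrite -subr_eq0 -enorm_gt0; apply: lt_trans rq.
rewrite -EFinM lee_fin /nker qy /c -exprMn le_eqVlt; apply/orP; left; apply/eqP.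
by congr (_ ^+ _); field; rewrite !gt_eqF.
Qed.

End Sphere.

(** * The equilibrium measure *)

Section UnitMass.
Context {R : realType} {disp : measure_display} {B : measurableType disp}.
Variable P : {measure set B -> \bar R}.

(** Carries the probability structure of a measure known to have mass one, so
    that convex combinations may compete in the definition of [robin]. *)
Definition unit_mass (_ : P setT = 1%E) (A : set B) : \bar R := P A.

Variable PT : P setT = 1%E.

HB.instance Definition _ := Measure.on (unit_mass PT).

HB.instance Definition _ :=
  Measure_isProbability.Build _ _ _ (unit_mass PT) PT.

End UnitMass.

Section Variation.
Context {R : realType} {d : nat}.
Local Notation T := 'rV[R]_d.
Local Notation B := (borel_rV R d).
Hypothesis hd : (3 <= d)%N.
Local Open Scope ereal_scope.

Lemma integral_mix (a b : {nonneg R}) (mu nu : {measure set B -> \bar R})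
    (f : B -> \bar R) : measurable_fun setT f -> (forall x, 0 <= f x) ->
  \int[measure_add (mscale a mu) (mscale b nu)]_x f x =
  a%:num%:E * \int[mu]_x f x + b%:num%:E * \int[nu]_x f x.
Proof.
by move=> mf f0; rewrite ge0_integral_measure_add// !ge0_integral_mscale.
Qed.

Lemma mutual_fin (mu nu : {measure set B -> \bar R}) : mutual mu nu < +oo ->
  mutual mu nu \is a fin_num.
Proof. by rewrite ge0_fin_numE// mutual_ge0. Qed.

Lemma energy_mix (a b : {nonneg R}) (mu nu : {finite_measure set B -> \bar R}) :
  mutual mu mu < +oo -> mutual nu mu < +oo -> mutual nu nu < +oo ->
  energy (measure_add (mscale a mu) (mscale b nu)) =
  (a%:num ^+ 2 * fine (mutual mu mu) + 2 * (a%:num * b%:num * fine (mutual nu mu)) +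
   b%:num ^+ 2 * fine (mutual nu nu))%:E.
Proof.
move=> f1 f2 f3; have f2' : mutual mu nu < +oo by rewrite mutualC.
have mp (la : {finite_measure set B -> \bar R}) := measurable_potential hd la.
have p0 (la : {measure set B -> \bar R}) x : 0 <= potential la x by exact: potential_ge0.
have -> : energy (measure_add (mscale a mu) (mscale b nu)) =
    \int[measure_add (mscale a mu) (mscale b nu)]_x
      (a%:num%:E * potential mu x + b%:num%:E * potential nu x).
  apply: eq_integral => x _; apply: integral_mix; first exact: measurable_newton'.
  by move=> y; exact: newton_ge0.
have mix (la : {finite_measure set B -> \bar R}) :
    \int[la]_x (a%:num%:E * potential mu x + b%:num%:E * potential nu x) =
    a%:num%:E * mutual la mu + b%:num%:E * mutual la nu.
  rewrite ge0_integralD//; last 4 first.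
  - by move=> x _; rewrite mule_ge0// lee_fin.
  - by apply: measurable_funeM; exact: mp.
  - by move=> x _; rewrite mule_ge0// lee_fin.
  - by apply: measurable_funeM; exact: mp.
  by rewrite !ge0_integralZl//; exact: mp.
rewrite integral_mix; last 2 first.
- by apply: emeasurable_funD; apply: measurable_funeM; exact: mp.
- by move=> x; rewrite adde_ge0// mule_ge0// lee_fin.
rewrite !mix (mutualC hd mu nu).
have := mutual_fin f1; have := mutual_fin f2; have := mutual_fin f3.
case: (mutual nu nu) => // r3 _; case: (mutual nu mu) => // r2 _.
case: (mutual mu mu) => // r1 _ /=.
by congr EFin; ring.
Qed.

(** The minimality of the equilibrium measure, tested on the competitors
    [(1 - t m) mu + t eta] for small [t]. *)
Lemma variation (E : set T) (mu : probability B R)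
    (eta : {finite_measure set B -> \bar R}) :
  robin E < +oo -> equilibrium E mu -> eta (~` E) = 0 -> eta setT <= 1 ->
  mutual eta eta < +oo -> robin E * eta setT <= mutual eta mu.
Proof.
move=> W1 [muE Wmu] etaE m1 bfin.
have W0 : 0 <= robin E by rewrite -Wmu; exact: mutual_ge0.
have [afin|] := boolP (mutual eta mu < +oo); last first.
  by rewrite -leNgt leye_eq => /eqP ->; exact: leey.
pose m := fine (eta setT).
have etaT : eta setT = m%:E by rewrite fineK// fin_num_measure.
have m0 : (0 <= m)%R by rewrite fine_ge0.
have {}m1 : (m <= 1)%R by rewrite -lee_fin -etaT.
pose W := fine (robin E).
have WE : robin E = W%:E by rewrite fineK// ge0_fin_numE.
have mumu : mutual mu mu = W%:E by rewrite -WE -Wmu.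
pose a := fine (mutual eta mu); pose b := fine (mutual eta eta).
have key t : (0 < t <= 1)%R ->
    (0 <= 2 * (a - m * W) + t * (m ^+ 2 * W - 2 * m * a + b))%R.
  move=> /andP[t0 t1].
  have c0 : (0 <= 1 - t * m)%R by rewrite subr_ge0 -[leRHS]mulr1 ler_pM// ltW.
  have t0' := ltW t0.
  pose P0 := measure_add (mscale (NngNum c0) mu) (mscale (NngNum t0') eta).
  have P0E A : P0 A = (1 - t * m)%:E * mu A + t%:E * eta A by exact: measure_addE.
  have P0T : P0 setT = 1.
    by rewrite P0E probability_setT mule1 etaT -EFinM -EFinD subrK.
  pose P : probability B R := unit_mass P0T.
  have PE : prob_on E P 
    by have := P0E (~` E); rewrite muE etaE !mule0 adde0.
  have : robin E <= energy P0 by apply: ereal_inf_lbound; exists P.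
  rewrite energy_mix// ?mumu ?ltry// /= WE lee_fin -/a -/b => h.
  have : (0 <= t * (2 * (a - m * W) + t * (m ^+ 2 * W - 2 * m * a + b)))%R by lra.
  by rewrite pmulr_rge0.
rewrite WE etaT -(fineK (mutual_fin afin)) -EFinM lee_fin -/a.
rewrite -subr_ge0 -(@pmulr_rge0 _ 2)// [(W * m)%R]mulrC.
set c := (m ^+ 2 * W - 2 * m * a + b)%R in key.
apply/ler_addgt0Pr => e e0.
pose t := Num.min 1%R (e / (`|c| + 1))%R.
have c1 : (0 < `|c| + 1)%R by rewrite ltr_wpDl.
have t0 : (0 < t)%R by rewrite lt_min ltr01 divr_gt0.
have t1 : (t <= 1)%R by rewrite ge_min lexx.
have tc : (t * c <= e)%R.
  have : (t <= e / (`|c| + 1))%R by rewrite ge_min lexx orbT.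
  rewrite ler_pdivlMr//; apply: le_trans; rewrite ler_wpM2l ?(ltW t0)//.
  by rewrite (le_trans (ler_norm _))// lerDl.
have := key t; rewrite t0 t1 => /(_ isT); lra.
Qed.

End Variation.

Section InnerComponents.
Context {R : realType} {d : nat}.
Local Notation T := 'rV[R]_d.
Local Notation B := (borel_rV R d).
Local Notation opc := (one_point_compactification T).

Lemma Omega_path (E : set T) (x z : T) (I : set R) (p : R -> T) a b :
  is_interval I -> continuous p -> I a -> I b -> p a = x -> p b = z ->
  (forall t, I t -> ~ E (p t)) -> Omega E (Some x) -> Omega E (Some z).
Proof.
move=> itvI cp Ia Ib pa pb pE Ox; apply: connected_component_trans Ox _.
apply: (@connected_component_max opc _ [set Some (p t) | t in I]).
- by exists a => //; rewrite pa.
- by move=> _ [t It <-] [w Ew [wp]]; apply: (pE _ It); rewrite -wp.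
- apply: (@connected_continuous_connected R opc I (fun t => Some (p t))).
    exact/connected_intervalP.
  apply: continuous_subspaceT => t; apply: continuous_comp; first exact: cp.
  exact: one_point_compactification_some_continuous.
- by exists b => //; rewrite pb.
Qed.

Lemma line_continuous (x v : T) : continuous (fun t : R => x + t *: v).
Proof.
move=> t; apply: (cvgD (cvg_cst _)).
by apply: (cvgZr_tmp (a := v)); exact: cvg_id.
Qed.

Lemma Omega_ball (E : set T) (x z : T) : enorm (z - x) < euclid_dist E x ->
  Omega E (Some z) -> Omega E (Some x).
Proof.
move=> zx; apply: (@Omega_path E z x `[0, 1]%classic (fun t => z + t *: (x - z)) 0 1).
- exact: interval_is_interval.
- exact: line_continuous.
- by rewrite /= in_itv /= lexx ler01.
- by rewrite /= in_itv /= lexx ler01.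
- by rewrite scale0r addr0.
- by rewrite scale1r addrCA subrr addr0.
- move=> t /=; rewrite in_itv /= => /andP[t0 t1] Et.
  have := euclid_dist_le x Et; rewrite leNgt => /negP; apply.
  apply: le_lt_trans zx; rewrite opprD addrA -[X in X - _]scale1r -scalerBl.
  rewrite enormZ ger0_norm ?subr_ge0// [leRHS]enormB ler_piMl ?enorm_ge0//.
  by rewrite gerBl.
Qed.

(** The ray from [x] away from the origin avoids [E], and its closure in the
    one-point compactification contains infinity. *)
Lemma Omega_far (E : set T) (r : R) (x : T) : 0 <= r ->
  (forall z, E z -> enorm z <= r) -> r < enorm x -> Omega E (Some x).
Proof.
move=> r0 Er rx; have x0 : 0 < enorm x by apply: le_lt_trans rx.
pose ray : set opc := [set Some (t *: x) | t in `[1, +oo[%classic].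
have conray : connected ray.
  apply: (@connected_continuous_connected R opc _ (fun t => Some (t *: x))).
    by apply/connected_intervalP; exact: interval_is_interval.
  apply: continuous_subspaceT => t; apply: continuous_comp.
    by apply: (cvgZr_tmp (a := x)); exact: cvg_id.
  exact: one_point_compactification_some_continuous.
apply: connected_component_sym.
apply: (@connected_component_max opc _ (closure ray)).
- by apply: subset_closure; exists 1; rewrite ?scale1r//= in_itv /= lexx.
- have oB : @open opc (Some @` [set z : T | enorm z < enorm x]).
    apply: one_point_compactification_open_some.
    rewrite (_ : [set z | _] = ~` [set z : T | enorm x <= enorm (z - 0)]).
      by apply: closed_openC; exact: closed_eball_compl.
    by apply/seteqP; split => z /=; rewrite subr0 ltNge => /negP.
  move=> w clw [e Ee ew]; have : nbhs w (Some @` [set z : T | enorm z < enorm x]).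
    apply: open_nbhs_nbhs; split => //; exists e => //=.
    by apply: le_lt_trans (Er _ Ee) rx.
  move=> /clw[_ [[t /=] + <-]] [z zx [ztx]].
  rewrite in_itv /= andbT => t1; move: zx; rewrite ztx /= enormZ.
  rewrite ltNge ger0_norm ?(le_trans ler01)// => /negP; apply.
  by rewrite ler_peMl// enorm_ge0.
- exact: connected_closure.
- move=> W [C [cptC clC] CW].
  have [M [_ CM]] : bounded_set C by exact: compact_bounded.
  pose t := 1 + (d%:R * (`|M| + 1)) / enorm x.
  have t1 : 1 <= t by rewrite lerDl divr_ge0 ?enorm_ge0// mulr_ge0// addr_ge0.
  exists (Some (t *: x)); split; first by exists t => //=; rewrite in_itv /= t1.
  apply: CW; left; exists (t *: x) => // Ctx.
  have : enorm (t *: x) <= d%:R * (`|M| + 1).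
    apply: le_trans (enorm_le_mx_norm _) _; rewrite ler_wpM2l//; apply: CM => //.
    by rewrite (le_lt_trans (ler_norm _))// ltrDl.
  rewrite enormZ ger0_norm ?(le_trans ler01)// mulrDl mul1r divfK ?gt_eqF//.
  by rewrite leNgt => /negP; apply; rewrite ltrDr.
Qed.

End InnerComponents.

Section LowerBound.
Context {R : realType} {d : nat}.
Local Notation T := 'rV[R]_d.
Local Notation B := (borel_rV R d).
Hypothesis hd : (3 <= d)%N.
Local Open Scope ereal_scope.

Lemma integral_le_on (mu : {measure set B -> \bar R}) (A : set B)
    (f g : B -> \bar R) : measurable A -> mu (~` A) = 0 ->
  measurable_fun setT f -> measurable_fun setT g ->
  (forall x, 0 <= f x) -> (forall x, 0 <= g x) -> (forall x, A x -> f x <= g x) ->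
  \int[mu]_x f x <= \int[mu]_x g x.
Proof.
move=> mA A0 mf mg f0 g0 fg; rewrite !(integral_full mA A0)//.
by apply: ge0_le_integral => //; exact: measurable_funTS.
Qed.

Lemma integral_mrestr (mu : {measure set B -> \bar R}) (D : set B)
    (mD : measurable D) (f : B -> \bar R) :
  measurable_fun setT f -> (forall x, 0 <= f x) ->
  \int[mrestr mu mD]_x f x = \int[mu]_(x in D) f x.
Proof.
move=> mf f0; rewrite (@integral_full _ _ (mrestr mu mD) D)//; last first.
  by rewrite /= /mrestr setICl measure0.
apply: eq_measure_integral => A mA AD.
by rewrite /= /mrestr setIidl.
Qed.

Variables (E : set T) (mu : probability B R).
Hypotheses (cE : compact E) (Wfin : robin E < +oo) (muE : equilibrium E mu).

Lemma robin_ge0 : 0 <= robin E.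
Proof. by have [_ <-] := muE; exact: mutual_ge0. Qed.

Lemma robin_fin : robin E \is a fin_num.
Proof. by rewrite ge0_fin_numE// robin_ge0. Qed.

Lemma compact_set_closed : closed E.
Proof. by apply: compact_closed => //; exact: norm_hausdorff. Qed.

Lemma measurable_compact_set : measurable (E : set B).
Proof. by apply: closed_measurable_rV; exact: compact_set_closed. Qed.

Lemma equilibrium_nonempty : E !=set0.
Proof.
apply: contrapT => /nonemptyPn E0; have [+ _] := muE.
rewrite /prob_on /= E0 setC0 => h.
have := probability_setT mu; rewrite h => /eqP.
by rewrite eq_sym onee_eq0.
Qed.

Lemma compact_eball_bound : exists r : R, (0 <= r)%R /\ forall z, E z -> (enorm z <= r)%R.
Proof.
have [M [_ KM]] : bounded_set E by exact: compact_bounded.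
exists (d%:R * (`|M| + 1))%R; split; first by rewrite mulr_ge0// addr_ge0.
move=> z Ez; apply: le_trans (enorm_le_mx_norm z) _; rewrite ler_wpM2l//.
by apply: KM => //; rewrite (le_lt_trans (ler_norm _))// ltrDl.
Qed.

(** Sweeping the unit mass at a point of a bounded component of the complement
    onto [E] gives a competitor for the equilibrium measure. *)
Lemma potential_inner x : ~ E x -> ~ Omega E (Some x) -> robin E <= potential mu x.
Proof.
move=> nEx nOx; have E0 := equilibrium_nonempty; have clE := compact_set_closed.
have [r [r0 Er]] := compact_eball_bound.
pose G := [set z : T | ~ E z /\ ~ Omega E (Some z)].
pose K := [set z : T | (enorm (z - 0) <= r)%R].
have GK : G `<=` K.
  move=> z [_ nO]; rewrite /K /= subr0 leNgt; apply/negP => rz.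
  by apply: nO; exact: (Omega_far r0 Er).
have Gx : G x by [].
have GE z : G z -> ~ E z by case.
have Ginv y z : G y -> (enorm (z - y) < euclid_dist E y)%R -> G z.
  move=> [nEy nOy] zy; split.
    move=> Ez; have := euclid_dist_le y Ez; rewrite leNgt enormB => /negP; exact.
  by move=> Oz; apply: nOy; exact: Omega_ball zy Oz.
have [P [_ PE Ple _]] := harmonic_measure hd E0 clE GK (@compact_eball R d 0 r) Gx GE Ginv.
have mE := measurable_compact_set.
pose c := ((euclid_dist E x)^-1 ^+ (d - 2))%R.
have D0 : (0 < euclid_dist E x)%R by exact: euclid_dist_gt0.
have mp (la : {finite_measure set B -> \bar R}) := measurable_potential hd la.
have p0 (la : {measure set B -> \bar R}) y : 0 <= potential la y by exact: potential_ge0.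
have xE p : E p -> x != p by move=> Ep; apply/eqP => xp; apply: nEx; rewrite xp.
have Pc p : E p -> potential P p <= c%:E.
  move=> Ep; apply: le_trans (Ple p Ep) _; rewrite -newton_neq ?xE//.
  by apply: newton_le => //; exact: euclid_dist_le.
have Pfin : mutual P P < +oo.
  apply: (@le_lt_trans _ _ c%:E); last exact: ltry.
  apply: (@le_trans _ _ (\int[P]_x (cst c%:E) x)).
    apply: (integral_le_on mE PE) => //; first exact: mp.
    by move=> ?; rewrite lee_fin exprn_ge0// invr_ge0 ltW.
  by rewrite integral_cst// [X in _ * X]probability_setT mule1.
have := variation hd Wfin muE PE (probability_le1 P measurableT) Pfin.
rewrite [X in _ * X]probability_setT mule1 => /le_trans; apply.
rewrite mutualC//; have [mE0 _] := muE.
apply: (integral_le_on mE mE0) => //.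
- exact: measurable_newton'.
- by move=> y; exact: newton_ge0.
- by move=> p Ep; rewrite newton_neq ?xE//; exact: Ple.
Qed.

Variables (A s : R).
Hypotheses (A0 : (0 < A)%R) (s0 : (0 < s)%R).
Hypothesis greenE : forall x, Omega E (Some x) ->
  green E mu x <= (A * euclid_dist E x `^ s)%:E.

(** In the unbounded component this is the assumption on the Green function;
    in the others there is no loss. *)
Lemma potential_lower x : ~ E x ->
  robin E - (A * euclid_dist E x `^ s)%:E <= potential mu x.
Proof.
move=> nEx; have a0 : (0 <= A * euclid_dist E x `^ s)%R.
  by rewrite mulr_ge0 ?powR_ge0 ?ltW.
have [Ox|nOx] := pselect (Omega E (Some x)); last first.
  apply: le_trans (potential_inner nEx nOx).
  by rewrite leeBlDr// leeDl// lee_fin.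
have := greenE Ox; rewrite /green -(fineK robin_fin).
have := potential_ge0 hd mu x; case: (potential mu x) => [p _| |]// => [|_ _]; last by rewrite leey.
by rewrite -!EFinB !lee_fin; lra.
Qed.

(** Off [E] the previous bound applies; on [E], quasi-everywhere, there is no
    loss at all, which is what [variation] says for the restriction of [b] to
    [E].  The bounded potential of [b] makes that restriction of finite energy. *)
Lemma mutual_lower (b : probability B R) (c r : R) :
  (forall x, potential b x <= c%:E) -> (0 <= r)%R ->
  b (~` [set z | (euclid_dist E z <= r)%R]) = 0 ->
  robin E - (A * r `^ s)%:E <= mutual b mu.
Proof.
move=> bc r0 bD; have E0 := equilibrium_nonempty; have mE := measurable_compact_set.
pose D := [set z : T | (euclid_dist E z <= r)%R].
have mD : measurable (D : set B).
  apply: closed_measurable_rV.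
  have := closed_comp (fun x _ => @euclid_dist_continuous R d E E0 x) (@closed_le R r).
  exact.
have mp (la : {finite_measure set B -> \bar R}) := measurable_potential hd la.
have p0 (la : {measure set B -> \bar R}) y : 0 <= potential la y by exact: potential_ge0.
pose k := (fine (robin E) - A * r `^ s)%R.
have kE : robin E - (A * r `^ s)%:E = k%:E by rewrite -(fineK robin_fin) -EFinB.
rewrite kE; have [k0|k0] := leP 0%R k; last first.
  by apply: le_trans (mutual_ge0 hd b mu); rewrite lee_fin ltW.
have kW : k%:E <= robin E.
  rewrite -kE leeBlDr// leeDl// lee_fin mulr_ge0 ?powR_ge0//; exact: ltW.
pose eta := mrestr b mE.
have etaT : eta setT = b E by rewrite /eta /= /mrestr setTI.
have potE : mutual eta eta < +oo.
  apply: (@le_lt_trans _ _ c%:E); last exact: ltry.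
  have pe x : potential eta x <= c%:E.
    apply: le_trans (bc x); rewrite /potential integral_mrestr//; first last.
    - by move=> y; exact: newton_ge0.
    - exact: measurable_newton'.
    apply: ge0_subset_integral => //; first exact: measurable_newton'.
    by move=> y _; exact: newton_ge0.
  have c0 : (0 <= c)%R by rewrite -lee_fin; apply: le_trans (bc 0%R).
  apply: (@le_trans _ _ (\int[eta]_x (cst c%:E) x)).
    by apply: ge0_le_integral => //; exact: (mp eta).
  rewrite integral_cst// [X in _ * X]etaT.
  rewrite -[leRHS]mule1 lee_wpmul2l ?lee_fin//; exact: probability_le1.
have onE : robin E * b E <= \int[b]_(x in E) potential mu x.
  rewrite -(integral_mrestr b mE (mp mu))// -etaT.
  apply: (variation hd Wfin muE _ _ potE).
    by rewrite /eta /= /mrestr setICl measure0.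
  by rewrite [X in X <= _]etaT; exact: probability_le1.
have mEC : measurable (~` E : set B) by exact: measurableC.
have offE : k%:E * b (~` E) <= \int[b]_(x in ~` E) potential mu x.
  have -> : k%:E * b (~` E) = \int[b]_(x in ~` E `&` D) (cst k%:E) x.
    rewrite integral_cst//; last exact: measurableI.
    congr (_ * _); rewrite [LHS](measureDI b mEC mD) //.
    rewrite [X in X + _](_ : _ = 0) ?add0e//.
    apply/eqP; rewrite eq_le measure_ge0 andbT -bD; apply: le_measure.
    - by rewrite inE; exact: measurableD.
    - by rewrite inE; exact: measurableC.
    - by move=> x [].
  apply: (@le_trans _ _ (\int[b]_(x in ~` E `&` D) potential mu x)).
    apply: ge0_le_integral => //.
    - exact: measurableI.
    - by apply: measurable_funTS; exact: (mp mu).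
    - move=> x [nEx Dx]; apply: le_trans (potential_lower nEx).
      rewrite -kE leeB// lee_fin ler_pM2l//.
      apply: ge0_ler_powR; rewrite ?nnegrE ?euclid_dist_ge0 ?(ltW s0)//.
  apply: ge0_subset_integral => //; first exact: measurableI.
  by apply: measurable_funTS; exact: (mp mu).
rewrite /mutual -(setUv E) ge0_integral_setU//; last 2 first.
- by apply: measurable_funTS; exact: (mp mu).
- by rewrite /disj_set setICr eqxx.
apply: (@le_trans _ _ (k%:E * b E + k%:E * b (~` E))); last first.
  by apply: leeD => //; apply: le_trans onE; rewrite lee_wpmul2r.
rewrite -ge0_muleDr// -measureU//; last by rewrite setICr.
by rewrite setUv [X in _ * X]probability_setT mule1.
Qed.

End LowerBound.

(** * The maximum principle *)

Section TruncatedPotential.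
Context {R : realType} {d : nat}.
Local Notation T := 'rV[R]_d.
Local Notation B := (borel_rV R d).
Hypothesis hd : (3 <= d)%N.

Lemma expr_lip (c : R) n : 0 <= c -> exists2 L : R, 0 <= L &
  forall a b, 0 <= a <= c -> 0 <= b <= c -> `|a ^+ n - b ^+ n| <= L * `|a - b|.
Proof.
move=> c0; elim: n => [|n [L L0 IH]].
  by exists 0 => // a b _ _; rewrite !expr0 subrr normr0 mul0r.
exists (c * L + c ^+ n); first by rewrite addr_ge0 ?mulr_ge0 ?exprn_ge0.
move=> a b ac bc; have /andP[a0 a1] := ac; have /andP[b0 b1] := bc.
rewrite (_ : _ - _ = a * (a ^+ n - b ^+ n) + (a - b) * b ^+ n); last first.
  by rewrite !exprS; ring.
apply: le_trans (ler_normD _ _) _; rewrite [leRHS]mulrDl lerD//.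
  by rewrite normrM (ger0_norm a0) -mulrA ler_pM// IH.
rewrite normrM mulrC ler_wpM2r// ger0_norm ?exprn_ge0//.
by rewrite lerXn2r// nnegrE.
Qed.

Lemma max_lip (e s t : R) : `|Num.max e s - Num.max e t| <= `|s - t|.
Proof.
have [?|?] := leP e s; have [?|?] := leP e t => //.
- by rewrite ger0_norm ?subr_ge0// (le_trans _ (ler_norm _))//; lra.
- rewrite distrC ger0_norm ?subr_ge0// distrC.
  by rewrite (le_trans _ (ler_norm _))//; lra.
- by rewrite subrr normr0.
Qed.

(** The truncated kernel is a power of [1 / max e r], which is Lipschitz and
    bounded. *)
Lemma tker_lip (e : R) : 0 < e -> exists2 L : R, 0 <= L &
  forall x y z : T, `|tker e x z - tker e y z| <= L * enorm (x - y).
Proof.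
move=> e0; have ei0 : 0 <= e^-1 by rewrite invr_ge0 ltW.
have [L L0 hL] := expr_lip (d - 2) ei0.
exists (L * (e^-1 * e^-1)); first by rewrite mulr_ge0// mulr_ge0// invr_ge0 ltW.
move=> x y z; pose a := Num.max e (enorm (x - z)); pose b := Num.max e (enorm (y - z)).
have ea : e <= a by rewrite le_max lexx.
have eb : e <= b by rewrite le_max lexx.
have a0 : 0 < a by apply: lt_le_trans ea.
have b0 : 0 < b by apply: lt_le_trans eb.
have ai : a^-1 <= e^-1 by rewrite lef_pV2.
have bi : b^-1 <= e^-1 by rewrite lef_pV2.
apply: le_trans (hL a^-1 b^-1 _ _) _.
- by rewrite invr_ge0 ltW.
- by rewrite invr_ge0 ltW.
rewrite -mulrA ler_wpM2l//.
have -> : a^-1 - b^-1 = a^-1 * b^-1 * (b - a) by field; rewrite !gt_eqF.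
have ab0 : 0 <= a^-1 * b^-1 by rewrite mulr_ge0// invr_ge0 ltW.
rewrite normrM (ger0_norm ab0); apply: ler_pM => //.
  by apply: ler_pM => //; rewrite invr_ge0 ltW.
apply: le_trans (max_lip _ _ _) _; rewrite ler_norml.
have := ler_enorm_dist x y z; have := ler_enorm_dist y x z.
by rewrite (enormB y x) => ? ?; lra.
Qed.

Variable nu : {finite_measure set B -> \bar R}.

(** Continuous approximations from below of the potential of [nu]. *)
Definition tpot (e : R) (y : T) : R := fine (\int[nu]_z (tker e y z)%:E)%E.

Let M := fine (nu setT).

Let nuE : nu setT = M%:E. Proof. by rewrite fineK// fin_num_measure. Qed.

Let M0 : 0 <= M. Proof. by rewrite fine_ge0. Qed.

Lemma tpot_bound e y c : 0 < e -> (forall z, tker e y z <= c) ->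
  (\int[nu]_z (tker e y z)%:E <= (c * M)%:E)%E.
Proof.
move=> e0 hc; rewrite EFinM -nuE -integral_cst//.
apply: ge0_le_integral => //.
- by move=> z _; rewrite lee_fin tker_ge0.
- exact: measurable_tker'.
- by move=> z _; rewrite lee_fin.
Qed.

Lemma tpotE e y : 0 < e -> (\int[nu]_z (tker e y z)%:E = (tpot e y)%:E)%E.
Proof.
move=> e0; rewrite fineK// ge0_fin_numE; last first.
  by apply: integral_ge0 => z _; rewrite lee_fin tker_ge0.
apply: le_lt_trans (tpot_bound e0 (c := e^-1 ^+ (d - 2)) _) _; last exact: ltry.
by move=> z; exact: tker_le.
Qed.

Lemma tpot_ge0 e y : 0 <= tpot e y.
Proof. by apply/fine_ge0/integral_ge0 => z _; rewrite lee_fin tker_ge0. Qed.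

Lemma cvg_tpot y : potential nu y \is a fin_num ->
  (fun n => tpot n.+1%:R^-1 y) @ \oo --> fine (potential nu y).
Proof.
move=> py; apply: fine_cvg; rewrite fineK//.
have h := @cvg_integral_tker R d hd nu setT y measurableT; exact: h.
Qed.

Lemma tpot_lip e : 0 < e -> exists2 L : R, 0 <= L &
  forall x y, `|tpot e x - tpot e y| <= L * enorm (x - y).
Proof.
move=> e0; have [L L0 hL] := tker_lip e0.
exists (L * M); first by rewrite mulr_ge0.
have le x y : tpot e x <= tpot e y + L * M * enorm (x - y).
  rewrite -lee_fin EFinD -!tpotE// mulrAC EFinM -nuE -integral_cst//.
  rewrite -ge0_integralD//; first last.
  - by move=> z _; rewrite lee_fin mulr_ge0// enorm_ge0.
  - exact: measurable_tker'.
  - by move=> z _; rewrite lee_fin tker_ge0.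
  apply: ge0_le_integral => //.
  - by move=> z _; rewrite lee_fin tker_ge0.
  - exact: measurable_tker'.
  - by apply: emeasurable_funD => //; exact: measurable_tker'.
  - move=> z _; rewrite -EFinD lee_fin.
    by have := hL x y z; rewrite ler_norml => /andP[_]; lra.
move=> x y; rewrite ler_norml; have := le x y; have := le y x.
rewrite (enormB y x); move: (tpot e x) (tpot e y) (L * M * _) => a b c.
by lra.
Qed.

Lemma tpot_continuous e : 0 < e -> continuous (tpot e).
Proof. by move=> /tpot_lip[L _ hL]; exact: (elip_continuous hL). Qed.

End TruncatedPotential.

#[global] Opaque tpot.

Section MaximumPrinciple.
Context {R : realType} {d : nat}.
Local Notation T := 'rV[R]_d.
Local Notation B := (borel_rV R d).
Hypothesis hd : (3 <= d)%N.
Variable nu : {finite_measure set B -> \bar R}.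
Variable F : set T.
Hypotheses (mF : measurable (F : set B)) (nuF : nu (~` F) = 0%E).
Local Notation v := (tpot nu).

Let m0 : (0 < d - 2)%N. Proof. by rewrite subn_gt0. Qed.

(** Far from [F] the potential is unchanged by truncation and by averaging over
    a sphere that stays away from [F]. *)
Lemma tpotF (e : R) y : 0 < e -> (forall w, F w -> e <= enorm (y - w)) ->
  potential nu y = (v e y)%:E.
Proof.
move=> e0 yF; rewrite -tpotE// /potential.
rewrite (integral_full mF nuF); first last.
- by move=> z; exact: newton_ge0.
- exact: measurable_newton'.
rewrite [RHS](integral_full mF nuF); first last.
- by move=> z; rewrite lee_fin tker_ge0.
- exact: measurable_tker'.
by apply: eq_integral => w; rewrite inE => Fw; rewrite (newtonE hd e0)// yF.
Qed.

Lemma tpot_sphere (e r : R) y (b : probability B R) : 0 < e ->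
  (forall w, F w -> e + r <= enorm (y - w)) ->
  b (~` [set z | enorm (z - y) = r]) = 0%E ->
  (forall p, r < enorm (p - y) -> potential b p = newton p y) ->
  (\int[b]_z (v e z)%:E = (v e y)%:E)%E.
Proof.
move=> e0 yF bS bout.
have S0 : [set z : T | enorm (z - y) = r] !=set0.
  apply: contrapT => /nonemptyPn S0; move: bS; rewrite S0 setC0 probability_setT.
  by move=> /eqP; rewrite onee_eq0.
have r0 : 0 <= r by have [z <-] := S0; exact: enorm_ge0.
have mS := measurable_sphere y r.
have v0 z : 0 <= v e z by exact: tpot_ge0.
have mv : measurable_fun setT ((fun z => (v e z)%:E) : B -> \bar R).
  by apply/measurable_EFinP; apply: continuous_measurable_rV; exact: tpot_continuous.
transitivity (mutual b nu).
  rewrite /mutual (integral_full mS bS)//.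
  rewrite [RHS](integral_full mS bS)//; first last.
  - by move=> z; exact: potential_ge0.
  - exact: measurable_potential.
  apply: eq_integral => z; rewrite inE /= => zr; rewrite (tpotF e0)// => w Fw.
  have := yF _ Fw; have := ler_enorm_dist y z w; rewrite (enormB y z) zr; lra.
rewrite mutualC// -(tpotF e0); last first.
  by move=> w Fw; apply: le_trans (yF _ Fw); rewrite lerDl.
rewrite /mutual /potential (integral_full mF nuF); first last.
- by move=> z; exact: potential_ge0.
- exact: measurable_potential.
rewrite [RHS](integral_full mF nuF); first last.
- by move=> z; exact: newton_ge0.
- exact: measurable_newton'.
apply: eq_integral => w; rewrite inE => Fw.
rewrite -/(potential b w).
rewrite bout; first exact: newtonC.
by rewrite enormB; apply: lt_le_trans (yF _ Fw); rewrite ltrDr.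
Qed.

(** For [t] nearly closest to [y] among the points [z] in question,
    [|t - z| <= 3 |y - z|]; hence what the kernel at [y] gains when its
    truncation is lowered is at most [3^(d-2)] times the tail of the kernel
    at [t]. *)
Lemma tker_tail (l k : R) (y t z : T) : 0 < l -> l <= k ->
  enorm (y - t) <= 2 * enorm (y - z) -> t != z ->
  tker l y z + 3 ^+ (d - 2) * tker (3 * k) t z <=
  tker k y z + 3 ^+ (d - 2) * nker t z.
Proof.
move=> l0 lk yt tz; have k0 : 0 < k by apply: lt_le_trans lk.
have t3 : enorm (t - z) <= 3 * enorm (y - z).
  by have := ler_enorm_dist t y z; rewrite (enormB t y); lra.
have tz0 : 0 < enorm (t - z) by rewrite enorm_gt0 subr_eq0.
have yz0 : 0 < enorm (y - z) by lra.
have le3 : tker (3 * k) t z <= nker t z.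
  by rewrite -lee_fin -newton_neq// tker_le_newton// mulr_gt0.
have [h|h] := leP k (enorm (y - z)).
  rewrite (tkerE h) (tkerE (le_trans lk h)).
  by rewrite lerD2l ler_wpM2l// exprn_ge0.
rewrite (tker_eq (ltW h)) (tker_eq (e := 3 * k)); last first.
  by apply: le_trans t3 _; rewrite ler_pM2l// ltW.
rewrite -exprMn invfM mulrA mulfV ?mul1r// [leLHS]addrC lerD2l.
apply: (@le_trans _ _ (nker y z)).
  rewrite -lee_fin -newton_neq ?tker_le_newton//.
  by rewrite -subr_eq0 -enorm_gt0.
rewrite /nker -exprMn lerXn2r ?nnegrE ?mulr_ge0 ?invr_ge0 ?enorm_ge0//.
by rewrite ler_pdivlMr// mulrC ler_pdivrMr// mulrC.
Qed.

Variables (W rF : R).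
Hypotheses (W0 : 0 <= W) (FrF : forall w, F w -> enorm w <= rF).
Hypothesis potF : forall t, F t -> (potential nu t <= W%:E)%E.
Hypothesis tailF : forall eta : R, 0 < eta -> exists2 e : R, 0 < e &
  forall t, F t -> (potential nu t <= (v e t + eta)%:E)%E.

Lemma tpot_le e t : 0 < e -> ((v e t)%:E <= potential nu t)%E.
Proof. by move=> e0; rewrite -tpotE//; apply: integral_tker_le. Qed.

Lemma tpot_tail (e k : R) (y t : T) : 0 < e -> e <= k ->
  (forall z, F z -> enorm (y - t) <= 2 * enorm (y - z)) ->
  ((v e y + 3 ^+ (d - 2) * v (3 * k) t)%:E <=
   (v k y)%:E + (3 ^+ (d - 2))%:E * potential nu t)%E.
Proof.
move=> e0 ek tz; have k0 : 0 < k by apply: lt_le_trans ek.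
have k30 : 0 < 3 * k by rewrite mulr_gt0.
have c0 : 0 < 3 ^+ (d - 2) :> R by rewrite exprn_gt0.
move: (3 ^+ (d - 2)) c0 (@tker_tail e k y t) => c c0 tail.
have mt (a : R) x : 0 < a -> measurable_fun setT ((fun z => (tker a x z)%:E) : B -> \bar R).
  by move=> a0; exact: measurable_tker'.
have t0 (a : R) (x z : T) : (0 <= (tker a x z)%:E)%E by rewrite lee_fin tker_ge0.
have c0' : (0 <= c%:E)%E by rewrite lee_fin ltW.
have ct0 (a : R) (x z : T) : (0 <= c%:E * (tker a x z)%:E)%E by exact: mule_ge0.
have cn0 z : (0 <= c%:E * newton t z)%E by apply: mule_ge0 => //; exact: newton_ge0.
have mct (a : R) x : 0 < a ->
    measurable_fun setT ((fun z => c%:E * (tker a x z)%:E)%E : B -> \bar R).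
  by move=> a0; apply: measurable_funeM; exact: mt.
have mcn : measurable_fun setT ((fun z => c%:E * newton t z)%E : B -> \bar R).
  by apply: measurable_funeM; exact: measurable_newton'.
rewrite EFinD EFinM -!tpotE// /potential.
rewrite -(ge0_integralZl nu measurableT (mt _ t k30) (fun z _ => t0 _ _ z) c0').
rewrite -(ge0_integralZl nu measurableT (measurable_newton' hd t)
  (fun z _ => newton_ge0 hd t z) c0').
rewrite -(ge0_integralD nu measurableT (fun z _ => t0 e y z) (mt _ y e0)
  (fun z _ => ct0 _ t z) (mct _ t k30)).
rewrite -(ge0_integralD nu measurableT (fun z _ => t0 k y z) (mt _ y k0)
  (fun z _ => cn0 z) mcn).
apply: (integral_le_on mF nuF).
- by apply: emeasurable_funD; [exact: mt|exact: mct].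
- by apply: emeasurable_funD; [exact: mt|exact: mcn].
- by move=> z; exact: adde_ge0.
- by move=> z; exact: adde_ge0.
- move=> z Fz; have [->|tnz] := eqVneq t z.
    by rewrite newton_diag gt0_muley ?lte_fin// addey// leey.
  rewrite newton_neq// -!EFinM -!EFinD lee_fin.
  by apply: tail => //; exact: tz.
Qed.

(** Small tails at the points of [F] entail small tails near [F] by [tker_tail];
    a single truncated potential, which is continuous, then carries the bound
    [W] from [F] to its neighbourhood. *)
Lemma tpot_near (eta : R) : 0 < eta -> F !=set0 -> exists2 e0 : R, 0 < e0 &
  forall (e : R) y, 0 < e -> e <= e0 -> euclid_dist F y <= e -> v e y <= W + eta.
Proof.
move=> eta0 F0; pose c : R := 3 ^+ (d - 2).
have c0 : 0 < c by rewrite exprn_gt0.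
have eta1 : 0 < eta / (2 * c) by rewrite divr_gt0// mulr_gt0.
have [e1 e10 he1] := tailF eta1.
have k0 : 0 < e1 / 3 by rewrite divr_gt0.
have k3 : 3 * (e1 / 3) = e1 by rewrite mulrC divfK.
move: (e1 / 3) k0 k3 => k k0 k3.
have [L L0 hL] := tpot_lip nu k0.
have L1 : 0 < L + 1 by rewrite ltr_wpDl.
have e00 : 0 < Num.min k (eta / (4 * (L + 1))).
  by rewrite lt_min k0 divr_gt0// mulr_gt0.
exists (Num.min k (eta / (4 * (L + 1)))) => // e y ep.
rewrite le_min => /andP[ek]; rewrite ler_pdivlMr ?mulr_gt0// => eL ye.
have vF a t : 0 < a -> F t -> v a t <= W.
  by move=> a0 Ft; rewrite -lee_fin; apply: le_trans (tpot_le t a0) (potF Ft).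
have [y0|y0] := leP (euclid_dist F y) 0.
  have [M M0 hM] := tpot_lip nu ep.
  have M1 : 0 < M + 1 by rewrite ltr_wpDl.
  have s0 : 0 < eta / (M + 1) by rewrite divr_gt0.
  have [t Ft yt] := euclid_dist_approx y F0 s0.
  have {}yt : enorm (y - t) * (M + 1) < eta.
    by rewrite -ltr_pdivlMr//; apply: lt_le_trans yt _; rewrite gerDr.
  have := hM y t; rewrite ler_norml => /andP[_ vyt].
  have := vF e t ep Ft; have := enorm_ge0 (y - t).
  move: (v e y) (v e t) (enorm (y - t)) vyt yt => a b l; lra.
have [t Ft yt] := euclid_dist_approx y F0 y0.
have tz z : F z -> enorm (y - t) <= 2 * enorm (y - z).
  by move=> /(euclid_dist_le y); lra.
have potfin : potential nu t \is a fin_num.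
  by rewrite ge0_fin_numE ?potential_ge0// (le_lt_trans (potF Ft))// ltry.
have := tpot_tail ep ek tz; have := potF Ft; have := he1 t Ft; rewrite k3.
rewrite -(fineK potfin) -EFinM -EFinD !lee_fin -/c.
have := vF k t k0 Ft; have := hL y t; rewrite ler_norml => /andP[_].
have {}yt : enorm (y - t) <= 2 * e.
  by apply: le_trans (ltW yt) _; rewrite [leRHS]mulr_natl mulr2n lerD.
have Le : L * enorm (y - t) <= eta / 2.
  apply: (@le_trans _ _ ((L + 1) * (2 * e))).
    by apply: ler_pM => //; [exact: enorm_ge0|rewrite lerDl].
  by move: eL; lra.
move: (v e y) (v k y) (v k t) (v e1 t) (fine _) (L * enorm _) Le => a b b' t1 q l Le.
move=> ab b'W qt qW key.
have cq : c * (q - t1) <= eta / 2.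
  apply: (@le_trans _ _ (c * (eta / (2 * c)))).
    by rewrite ler_pM2l// lerBlDl.
  by rewrite le_eqVlt; apply/orP; left; apply/eqP; field; rewrite gt_eqF.
by move: ab b'W qW key cq Le; lra.
Qed.

(** At distance [s] from [F] the truncated potential is at most a multiple of
    [1 / s], so that its maximum points form a compact set; among them one is
    farthest from [p]. *)
Lemma tpot_farthest_max (e : R) (y p : T) : 0 < e -> 0 < v e y ->
  exists q, [/\ v e y <= v e q, forall z, v e z <= v e q &
    forall z, v e q <= v e z -> enorm (z - p) <= enorm (q - p)].
Proof.
move=> e0 vy; pose N := fine (nu setT).
have NE : nu setT = N%:E by rewrite fineK// fin_num_measure.
have N0 : 0 <= N by rewrite fine_ge0.
have cv : continuous (v e) by exact: tpot_continuous.
pose s := Num.max 1 ((N + 1) / v e y).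
have s1 : 1 <= s by rewrite le_max lexx.
have s0 : 0 < s by apply: lt_le_trans s1.
have sN : N < s * v e y.
  rewrite -ltr_pdivrMr//; apply: lt_le_trans (_ : (N + 1) / v e y <= _).
    by rewrite ltr_pM2r ?invr_gt0// ltrDl.
  by rewrite le_max lexx orbT.
move: s s1 s0 sN => s s1 s0 sN.
have far z : rF + s < enorm z -> v e z < v e y.
  move=> sz; have zF w : F w -> s <= enorm (z - w).
    move=> /FrF wr; have := ler_enormD (z - w) w; rewrite subrK.
    by move: sz wr; lra.
  rewrite -(@ltr_pM2l _ s)//; apply: le_lt_trans sN.
  rewrite mulrC -ler_pdivlMr// -lee_fin -tpotE//.
  rewrite mulrC EFinM -NE -integral_cst//.
  apply: (integral_le_on mF nuF) => //.
  - exact: measurable_tker'.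
  - by move=> ?; rewrite lee_fin tker_ge0.
  - by move=> ?; rewrite lee_fin invr_ge0 ltW.
  move=> w Fw; rewrite lee_fin; apply: (@le_trans _ _ (s^-1 ^+ (d - 2))).
    by apply: exprV_anti => //; rewrite le_max zF// orbT.
  rewrite -[leRHS]expr1 ler_wiXn2l// ?invr_ge0 ?(ltW s0)//.
  by rewrite invf_le1.
pose K := [set z : T | enorm (z - 0) <= rF + s].
have cK : compact K by exact: compact_eball.
have Ky : K y by rewrite /K /= subr0 leNgt; apply/negP => /far; rewrite ltxx.
have [c] := compact_EVT_max (ex_intro _ y Ky) cK (continuous_subspaceT cv).
rewrite inE => Kc cmax.
have cM z : v e z <= v e c.
  have [Kz|Kz] := pselect (K z); first by apply: cmax; rewrite inE.
  apply: le_trans (cmax y _); last by rewrite inE.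
  by apply/ltW/far; rewrite ltNge -[z in enorm z]subr0; apply/negP.
pose S := K `&` [set z | v e c <= v e z].
have cS : compact S.
  apply: (subclosed_compact _ cK) => [|z []//].
  apply: closedI; first exact: closed_eball.
  by have := closed_comp (fun x _ => cv x) (@closed_ge R (v e c)); exact.
have cp : {within S, continuous (fun z => enorm (z - p))}.
  by apply: continuous_subspaceT; exact: enorm_dist_continuous.
have [q qS qmax] := compact_EVT_max (ex_intro _ c (conj Kc (lexx _)) : S !=set0) cS cp.
move: qS; rewrite inE => -[Kq cq].
have cqE : v e q = v e c by apply/le_anti; rewrite cM.
exists q; split; first by rewrite cqE; exact: cM.
  by move=> z; rewrite cqE; exact: cM.
move=> z qz; apply: qmax; rewrite inE; split; last by rewrite /= -cqE.
rewrite /K /= leNgt subr0; apply/negP => /far; apply/negP.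
by rewrite -leNgt; apply: le_trans qz; rewrite cqE; exact: cM.
Qed.

(** The mean over the sphere is the value at [q], hence the maximum, and so the
    function equals its maximum almost everywhere there. *)
Lemma tpot_max_sphere (e r : R) (q : T) (b : probability B R) : 0 < e ->
  (forall w, F w -> e + r <= enorm (q - w)) ->
  b (~` [set z | enorm (z - q) = r]) = 0%E ->
  (forall p, r < enorm (p - q) -> potential b p = newton p q) ->
  (forall z, v e z <= v e q) -> b (~` [set z | v e q <= v e z]) = 0%E.
Proof.
move=> e0 qF bS bout qM; have bv := tpot_sphere e0 qF bS bout.
have cv : continuous (v e) by exact: tpot_continuous.
have v0 z : 0 <= v e z by exact: tpot_ge0.
move: (v e) qM bv cv v0 => f qM bv cv v0.
have cg : continuous (fun z => f q - f z).
  by move=> z; exact: (cvgB (cvg_cst _) (cv z)).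
have g0 z : 0 <= f q - f z by rewrite subr_ge0.
rewrite (_ : ~` _ = [set z | f q - f z != 0]); last first.
  apply/seteqP; split => z /=; rewrite subr_eq0.
    by move=> h; apply/eqP => qz; apply: h; rewrite qz.
  by move=> /eqP h1 h2; apply: h1; apply/le_anti; rewrite h2 qM.
apply: integral_eq0_null => //; first exact: continuous_measurable_rV.
have mg : measurable_fun setT ((fun z => (f q - f z)%:E) : B -> \bar R).
  by apply/measurable_EFinP; exact: continuous_measurable_rV.
have mf : measurable_fun setT ((fun z => (f z)%:E) : B -> \bar R).
  by apply/measurable_EFinP; exact: continuous_measurable_rV.
have g0' (z : B) : [set: B] z -> (0 <= (f q - f z)%:E)%E by rewrite lee_fin.
have f0' (z : B) : [set: B] z -> (0 <= (f z)%:E)%E by rewrite lee_fin.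
have : (\int[b]_z (f q - f z)%:E + \int[b]_z (f z)%:E = (f q)%:E)%E.
  rewrite -(ge0_integralD b measurableT g0' mg f0' mf).
  under eq_integral do rewrite -EFinD subrK.
  by rewrite integral_cst// [X in (_ * X)%E]probability_setT mule1.
rewrite bv; case: (\int[b]_z _)%E => [x| |]//= [].
by move=> h; congr EFin; move: h; lra.
Qed.

(** By the parallelogram law the points of the sphere that are no farther from
    [p] than [q] are farther than [|q - p|] from the reflection [2 q - p] of
    [p], whereas the potential there is that of a unit mass at distance
    [|q - p|]. *)
Lemma sphere_not_in_ball (r : R) (p q : T) (b : probability B R) (Z : set T) :
  0 < r -> r < enorm (q - p) ->
  (forall p, r < enorm (p - q) -> potential b p = newton p q) ->
  measurable (Z : set B) -> b (~` Z) = 0%E ->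
  (forall z, Z z -> enorm (z - q) = r /\ enorm (z - p) <= enorm (q - p)) -> False.
Proof.
move=> r0 ra bout mZ bZ hZ; have a0 : 0 < enorm (q - p) by apply: lt_trans ra.
pose x := q + (q - p).
have xq : enorm (x - q) = enorm (q - p) by rewrite /x addrAC subrr add0r.
have [rho rho0 rho2] : exists2 rho, 0 <= rho & rho ^+ 2 = enorm (q - p) ^+ 2 + 2 * r ^+ 2.
  exists (Num.sqrt (enorm (q - p) ^+ 2 + 2 * r ^+ 2)); first exact: sqrtr_ge0.
  by rewrite [LHS]sqr_sqrtr// addr_ge0 ?sqr_ge0// mulr_ge0 ?sqr_ge0.
have ar : enorm (q - p) < rho.
  rewrite -(ltr_pXn2r (n := 2))// ?nnegrE ?(ltW a0)// rho2.
  by rewrite ltrDl mulr_gt0// exprn_gt0.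
have xZ z : Z z -> rho <= enorm (x - z).
  move=> /hZ[zr zp]; rewrite -(ler_pXn2r (n := 2))// ?nnegrE ?enorm_ge0// rho2.
  have -> : x - z = (q - p) - (z - q).
    by apply/rowP => i; rewrite !mxE; ring.
  have zpE : z - p = (q - p) + (z - q).
    by apply/rowP => i; rewrite !mxE; ring.
  have : enorm (z - p) ^+ 2 <= enorm (q - p) ^+ 2.
    by rewrite ler_pXn2r ?nnegrE ?enorm_ge0.
  have h1 := sqr_enormB (q - p) (z - q); have h2 := sqr_enormD (q - p) (z - q).
  rewrite zr in h1 h2; rewrite zpE h1 h2.
  by move: (enorm (q - p)) (edot _ _); move=> a e *; lra.
have {}rho0 : 0 < rho by apply: lt_trans ar.
have c0 : (0 <= (rho^-1 ^+ (d - 2))%:E)%E by rewrite lee_fin exprn_ge0// invr_ge0 ltW.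
have : (potential b x <= (rho^-1 ^+ (d - 2))%:E)%E.
  apply: (@le_trans _ _ (\int[b]_z (cst (rho^-1 ^+ (d - 2))%:E) z)%E).
    apply: (integral_le_on mZ bZ).
    - exact: measurable_newton'.
    - exact: measurable_cst.
    - by move=> z; exact: newton_ge0.
    - by move=> z; exact: c0.
    - by move=> z Zz; apply: newton_le => //; exact: xZ.
  by rewrite integral_cst// [X in (_ * X)%E]probability_setT mule1.
rewrite bout ?xq// newton_neq//; last by rewrite -subr_eq0 -enorm_gt0 xq.
rewrite lee_fin /nker xq leNgt => /negP; apply.
by rewrite ltr_pXn2r ?nnegrE ?invr_ge0 ?(ltW a0) ?(ltW rho0)// ltf_pV2.
Qed.

(** A maximum point of the truncated potential at distance more than [e] from
    [F] is impossible: among all of them take the one, [q], farthest from a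
    point [p] of [F].  By the mean value property a sphere about [q] consists
    of maximum points almost everywhere, so it lies in the ball of centre [p]
    and radius [|q - p|], which [sphere_not_in_ball] excludes. *)
Lemma tpot_max (e : R) (y : T) : 0 < e -> F !=set0 -> 0 < v e y ->
  exists2 z, v e y <= v e z & euclid_dist F z <= e.
Proof.
move=> e0 [p Fp] vy; have [q [yq qM qfar]] := tpot_farthest_max p e0 vy.
exists q => //; rewrite leNgt; apply/negP => eq.
have [r r0 eE] : exists2 r, 0 < r & e + 2 * r = euclid_dist F q.
  exists ((euclid_dist F q - e) / 2); first by rewrite divr_gt0// subr_gt0.
  by rewrite mulrC divfK// addrC subrK.
have qF w : F w -> e + r <= enorm (q - w).
  move=> /(euclid_dist_le q); rewrite -eE; apply: le_trans.
  by rewrite lerD2l ler_peMl ?ler1n// ltW.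
have [b [bS _ bout]] := sphere_measure hd q r0.
have bM := tpot_max_sphere e0 qF bS bout qM.
have ra : r < enorm (q - p) by apply: lt_le_trans (qF _ Fp); rewrite ltrDr.
have mM : measurable ([set z | v e q <= v e z] : set B).
  apply: closed_measurable_rV.
  have cv : continuous (v e) by exact: tpot_continuous.
  by have := closed_comp (fun x _ => cv x) (@closed_ge R (v e q)); exact.
have mS := measurable_sphere q r.
apply: (sphere_not_in_ball r0 ra bout (measurableI _ _ mS mM)); last first.
  by move=> z [zr zM]; split => //; exact: qfar.
apply/eqP; rewrite eq_le measure_ge0 andbT setCI.
apply: le_trans (measureU2 _ _ _) _; [exact: measurableC|exact: measurableC|].
have h1 : (b (~` [set z | enorm (z - q) = r]) <= 0)%E by rewrite bS.
have h2 : (b (~` [set z | (v e q <= v e z)%R]) <= 0)%E by rewrite bM.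
by rewrite -[leRHS]adde0; exact: leeD.
Qed.

(** Maria's maximum principle.  The assumption that the potential has uniformly
    small tails on the carrier [F] replaces continuity of the potential. *)
Lemma max_principle y : (potential nu y <= W%:E)%E.
Proof.
have [F0|nF] := pselect (F !=set0); last first.
  rewrite /potential (integral_full mF nuF); first last.
  - by move=> z; exact: newton_ge0.
  - exact: measurable_newton'.
  have -> : F = set0 by apply/eqP/negP => /negP/set0P.
  by rewrite integral_set0 lee_fin.
apply/lee_addgt0Pr => eta eta0.
have [e0 e00 hnear] := tpot_near eta0 F0.
apply: integral_newton_le => // e ep.
pose e' := Num.min e e0; have e'0 : 0 < e' by rewrite lt_min ep.
have ee' : e' <= e by rewrite ge_min lexx.
apply: (@le_trans _ _ (v e' y)%:E).
  rewrite -tpotE//; apply: ge0_le_integral => //.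
  - by move=> z _; rewrite lee_fin tker_ge0.
  - exact: measurable_tker'.
  - exact: measurable_tker'.
  - by move=> z _; rewrite lee_fin tker_anti.
rewrite -EFinD lee_fin; have [vy|vy] := leP (v e' y) 0.
  by apply: le_trans vy _; rewrite addr_ge0// ltW.
have [z yz zF] := tpot_max e'0 F0 vy.
by apply: le_trans yz _; apply: hnear zF => //; rewrite ge_min lexx orbT.
Qed.

End MaximumPrinciple.

(** * The equilibrium potential is at most the Robin constant *)

Section FrostmanUpper.
Context {R : realType} {d : nat}.
Local Notation T := 'rV[R]_d.
Local Notation B := (borel_rV R d).
Hypothesis hd : (3 <= d)%N.
Local Open Scope ereal_scope.
Variables (E : set T) (mu : probability B R).
Hypotheses (cE : compact E) (Wfin : robin E < +oo) (muE : equilibrium E mu).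

Let W := fine (robin E).

Let WE : robin E = W%:E.
Proof. by rewrite fineK//; exact: (robin_fin hd Wfin muE). Qed.

Let mp := measurable_potential hd mu.

Let p0 y : 0 <= potential mu y. Proof. exact: potential_ge0. Qed.

Let mLow : measurable ([set x | potential mu x <= robin E] : set B).
Proof.
rewrite -[X in measurable X]setTI; exact: (emeasurable_fun_infty_c _ mp).
Qed.

(** By [variation] the mean of the potential over the part of [mu] where it is
    at most the Robin constant is not below that constant, while the mean over
    all of [mu] equals it. *)
Lemma potential_ae_le : mu (~` [set x | potential mu x <= robin E]) = 0.
Proof.
pose L := [set x : T | potential mu x <= robin E].
have mLC : measurable (~` L : set B) by exact: measurableC.
pose eta := mrestr mu mLow.
have etaT : eta setT = mu L by rewrite /eta /= /mrestr setTI.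
have [muE0 Wmu] := muE.
have etaE : eta (~` E) = 0.
  apply/eqP; rewrite eq_le measure_ge0 andbT -muE0 /eta /= /mrestr.
  have mE : measurable (~` E : set B) by apply: measurableC; exact: measurable_compact_set.
  by apply: le_measure; rewrite ?inE//; apply: measurableI; [exact: mE|exact: mLow].
have pe x : potential eta x <= potential mu x.
  rewrite /potential integral_mrestr//; first last.
  - by move=> y; exact: newton_ge0.
  - exact: measurable_newton'.
  apply: ge0_subset_integral => //; first exact: measurable_newton'.
  by move=> y _; exact: newton_ge0.
have fin : mutual eta eta < +oo.
  apply: (@le_lt_trans _ _ (energy mu)); last by rewrite Wmu.
  rewrite /mutual integral_mrestr//; first last.
  - by move=> y; exact: potential_ge0.
  - exact: (measurable_potential hd eta).
  apply: (@le_trans _ _ (\int[mu]_(x in L) potential mu x)).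
    apply: ge0_le_integral => //.
    - by move=> y _; exact: potential_ge0.
    - by apply: measurable_funTS; exact: (measurable_potential hd eta).
    - by apply: measurable_funTS; exact: mp.
  exact: ge0_subset_integral.
have low : robin E * mu L <= \int[mu]_(x in L) potential mu x.
  rewrite -(integral_mrestr mu mLow mp)// -etaT.
  apply: (variation hd Wfin muE etaE _ fin).
  by rewrite [X in X <= _]etaT; exact: probability_le1.
have tot : \int[mu]_(x in L) potential mu x +
    \int[mu]_(x in ~` L) potential mu x = W%:E.
  rewrite -ge0_integral_setU//; last 2 first.
  - by rewrite setUv; exact: mp.
  - by rewrite /disj_set setICr eqxx.
  by rewrite setUv -WE -Wmu.
have muL : mu L + mu (~` L) = 1.
  rewrite -(@measureU _ _ _ mu)//; last by rewrite setICr.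
  by rewrite setUv; exact: (@probability_setT _ _ _ mu).
have split_high : \int[mu]_(x in ~` L) potential mu x =
    \int[mu]_(x in ~` L) (potential mu x - W%:E) + W%:E * mu (~` L).
  rewrite -(integral_cst mu mLC) -ge0_integralD//.
  - by apply: eq_integral => x _; rewrite subeK.
  - move=> x; rewrite /L /= WE => /negP; rewrite -ltNge => h.
    by rewrite EFinN sube_ge0 ?ltW.
  - apply: emeasurable_funB; last exact: measurable_cst.
    by apply: measurable_funTS; exact: mp.
  - by move=> x _; rewrite lee_fin -lee_fin -WE; exact: (robin_ge0 hd muE).
pose X := \int[mu]_(x in ~` L) (potential mu x - W%:E).
have X0 : X = 0.
  have Xge : 0 <= X.
    apply: integral_ge0 => x; rewrite /L /= WE => /negP; rewrite -ltNge => h.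
    by rewrite EFinN sube_ge0 ?ltW.
  move: tot low muL; rewrite split_high -/X WE.
  have : mu L \is a fin_num by rewrite fin_num_measure.
  have : mu (~` L) \is a fin_num by rewrite fin_num_measure.
  case: (mu L) => // l _; case: (mu (~` L)) => // l' _.
  case: (\int[mu]_(x in L) _) => [i| |]//; case: X Xge => [x| |]//.
  rewrite -!EFinM -!EFinD lee_fin => x0 [tot] + [ll].
  rewrite lee_fin => low; congr EFin; nra.
have : \int[mu]_(x in ~` L) `|potential mu x - W%:E| = 0.
  rewrite -[RHS]X0; apply: eq_integral => x; rewrite inE /L /= WE => /negP.
  by rewrite -ltNge => h; rewrite gee0_abs// ?EFinN sube_ge0 ?ltW.
move=> /(ae_eq_integral_abs mu mLC _).1 [].
  by apply: emeasurable_funB; [apply: measurable_funTS; exact: mp|exact: measurable_cst].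
move=> N [mN N0 LN]; apply/eqP; rewrite eq_le measure_ge0 andbT -N0.
apply: le_measure; rewrite ?inE//; apply: subset_trans LN => x Lx /= h.
have := h Lx; move: Lx; rewrite /L /= WE.
case: (potential mu x) => [q| |]//= /negP; rewrite lee_fin -ltNge => qW [].
lra.
Qed.

(** Egorov's theorem gives carriers of nearly full measure on which the tails of
    the potential are uniformly small, so that the maximum principle applies to
    the parts of [mu] that they carry. *)
Lemma potential_le_robin y : potential mu y <= robin E.
Proof.
have mE := measurable_compact_set cE.
pose F0 := E `&` [set x : T | potential mu x <= robin E].
have mF0 : measurable (F0 : set B) by exact: measurableI.
have muF0 : mu (~` F0) = 0.
  apply/eqP; rewrite eq_le measure_ge0 andbT /F0 setCI.
  apply: le_trans (measureU2 _ _ _) _; [exact: measurableC|exact: measurableC|].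
  have [muE0 _] := muE.
  have h1 : mu (~` E) <= 0 by rewrite muE0.
  have h2 : mu (~` [set x | potential mu x <= robin E]) <= 0 by rewrite potential_ae_le.
  by rewrite -[leRHS]adde0; exact: leeD.
have [rF [_ FrF]] := compact_eball_bound cE.
pose f (n : nat) (x : T) := tpot mu n.+1%:R^-1 x.
pose g (x : T) := fine (potential mu x).
have e0 n : (0 < n.+1%:R^-1 :> R)%R by rewrite invr_gt0.
have fin x : potential mu x <= robin E -> potential mu x \is a fin_num.
  by move=> h; rewrite ge0_fin_numE// (le_lt_trans h).
have fg x : F0 x -> (f^~ x @ \oo --> g x)%classic.
  by move=> [_ /fin px]; exact: cvg_tpot.
have mf n : measurable_fun (F0 : set B) (f n : B -> R).
  by apply: measurable_funTS; apply: continuous_measurable_rV; exact: tpot_continuous.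
apply: integral_newton_le => // e ep; apply/lee_addgt0Pr => eta eta0.
pose k := (e^-1 ^+ (d - 2))%R.
have k0 : (0 < k)%R by rewrite exprn_gt0// invr_gt0.
have ek0 : (0 < eta / k)%R by rewrite divr_gt0.
have muF0fin : mu F0 < +oo by rewrite (le_lt_trans (probability_le1 mu mF0))// ltry.
have [Bad [mBad Badk unif]] := pointwise_almost_uniform mf mF0 muF0fin fg ek0.
(* On [F] the truncated potentials of [mu] converge uniformly; the part of [mu]
   off [F] contributes at most [eta] to the truncated potential at [y]. *)
pose F := F0 `\` Bad.
have mF : measurable (F : set B) by exact: measurableD.
pose nu := mrestr mu mF.
have nuF : nu (~` F) = 0 by rewrite /nu /= /mrestr setICl measure0.
have pnu t : potential nu t = \int[mu]_(z in F) newton t z.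
  rewrite /potential integral_mrestr//; first exact: measurable_newton'.
  by move=> z; exact: newton_ge0.
have potF t : F t -> potential nu t <= W%:E.
  move=> [[_ tW] _]; rewrite pnu -WE; apply: le_trans tW.
  apply: ge0_subset_integral => //; first exact: measurable_newton'.
  by move=> z _; exact: newton_ge0.
have mt (a : R) x : (0 < a)%R ->
    measurable_fun setT ((fun z => (tker a x z)%:E) : B -> \bar R).
  by move=> a0; exact: measurable_tker'.
have tnu a t : (0 < a)%R -> (tpot nu a t)%:E = \int[mu]_(z in F) (tker a t z)%:E.
  move=> a0; rewrite -tpotE// integral_mrestr//; first exact: mt.
  by move=> z; rewrite lee_fin tker_ge0.
have splitF (h : B -> \bar R) : measurable_fun setT h -> (forall z, 0 <= h z) ->
    \int[mu]_z h z = \int[mu]_(z in F) h z + \int[mu]_(z in ~` F) h z.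
  move=> mh h0; rewrite -ge0_integral_setU//; first by rewrite setUv.
  - exact: measurableC.
  - by rewrite setUv.
  - by rewrite /disj_set setICr eqxx.
have tailF (eta' : R) : (0 < eta')%R -> exists2 a : R, (0 < a)%R &
    forall t, F t -> potential nu t <= (tpot nu a t + eta')%:E.
  move=> eta'0.
  have : \forall n \near \oo, forall t, F t -> (`|f n t - g t| < eta')%R.
    apply: (unif [set h : T -> R | forall t, F t -> (`|h t - g t| < eta')%R]).
    apply/uniform_nbhs; exists [set xy : R * R | ball xy.1 eta' xy.2].
    split; first exact: (entourage_ball _ (PosNum eta'0)).
    by move=> h hE t /hE; rewrite /ball/= distrC.
  move=> [N _ /(_ N (leqnn N)) hN]; exists (N.+1%:R^-1)%R => // t Ft.
  have [[_ tW] _] := Ft.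
  have := hN t Ft; rewrite ltr_norml => /andP[hN' _].
  have U1 : potential mu t = potential nu t + \int[mu]_(z in ~` F) newton t z.
    rewrite pnu -splitF//; first exact: measurable_newton'.
    by move=> z; exact: newton_ge0.
  have U2 : (f N t)%:E = (tpot nu N.+1%:R^-1 t)%:E +
      \int[mu]_(z in ~` F) (tker N.+1%:R^-1 t z)%:E.
    rewrite /f tnu// -splitF//; first by rewrite tpotE.
    - exact: mt.
    - by move=> z; rewrite lee_fin tker_ge0.
  have U3 : \int[mu]_(z in ~` F) (tker N.+1%:R^-1 t z)%:E <=
      \int[mu]_(z in ~` F) newton t z.
    by apply: integral_tker_le => //; exact: measurableC.
  have c0 : 0 <= \int[mu]_(z in ~` F) (tker N.+1%:R^-1 t z)%:E.
    by apply: integral_ge0 => z _; rewrite lee_fin tker_ge0.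
  have n0 : 0 <= potential nu t by exact: potential_ge0.
  move: hN' (fin t tW) U2 U3 c0 n0; rewrite /g U1.
  case: (potential nu t) => [a| |]//; case: (\int[mu]_(z in ~` F) newton t z) => [b| |]//.
  case: (\int[mu]_(z in ~` F) _) => [c| |]//= hN' _ [U2].
  rewrite !lee_fin => *; lra.
have W0 : (0 <= W)%R by rewrite fine_ge0//; exact: (robin_ge0 hd muE).
have := max_principle hd mF nuF W0 (fun w Fw => FrF w Fw.1.1) potF tailF y.
move=> nuy; rewrite splitF//; last 2 first.
- exact: mt.
- by move=> z; rewrite lee_fin tker_ge0.
apply: leeD.
  rewrite WE; apply: le_trans nuy; rewrite pnu.
  by apply: integral_tker_le.
have mFC : measurable (~` F : set B) by exact: measurableC.
apply: (@le_trans _ _ (k%:E * mu (~` F))).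
  rewrite -integral_cst//; apply: ge0_le_integral => //.
  - by move=> z _; rewrite lee_fin tker_ge0.
  - by apply: measurable_funTS; exact: mt.
  - by move=> z _; rewrite lee_fin tker_le.
have muFC : mu (~` F) <= (eta / k)%:E.
  apply: (@le_trans _ _ (mu (~` F0) + mu Bad)); last by rewrite muF0 add0e ltW.
  rewrite (_ : ~` F = ~` F0 `|` Bad); last by rewrite /F setDE setCI setCK.
  by apply: measureU2 => //; exact: measurableC.
apply: (@le_trans _ _ (k%:E * (eta / k)%:E)).
  by apply: lee_wpmul2l => //; rewrite lee_fin ltW.
by rewrite -EFinM mulrCA mulfV ?mulr1// gt_eqF.
Qed.

End FrostmanUpper.

(** * Comparison of the equilibrium potential with point potentials *)

Section Comparison.
Context {R : realType} {d : nat}.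
Local Notation T := 'rV[R]_d.
Local Notation B := (borel_rV R d).
Hypothesis hd : (3 <= d)%N.
Local Open Scope ereal_scope.

(** The properties of the uniform measure of a sphere that matter below: a point
    mass is replaced by such a measure, which has finite energy; this does not
    change the potential outside the sphere and lowers it inside. *)
Definition sphere_mass (y : T) (r : R) (P : probability B R) : Prop :=
  [/\ P (~` [set z | enorm (z - y) = r]%R) = 0,
      forall p, potential P p <= (tker r p y)%:E &
      forall p, (r < enorm (p - y))%R -> potential P p = newton p y].

Lemma mutual_mass_le (nu P : probability B R) (y : T) (r : R) : (0 < r)%R ->
  sphere_mass y r P -> mutual nu P <= (r^-1 ^+ (d - 2))%:E.
Proof.
move=> r0 [_ h _].
apply: (@le_trans _ _ (\int[nu]_x (cst (r^-1 ^+ (d - 2))%:E x))).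
  apply: ge0_le_integral => //.
  - by move=> x _; exact: potential_ge0.
  - exact: (measurable_potential hd P).
  - by move=> x _; apply: le_trans (h x) _; rewrite lee_fin tker_le.
by rewrite integral_cst// [X in _ * X]probability_setT mule1.
Qed.

Lemma mutual_mass_le_potential (nu P : probability B R) (y : T) (r : R) :
  (0 < r)%R -> sphere_mass y r P -> mutual nu P <= potential nu y.
Proof.
move=> r0 [_ h _]; apply: ge0_le_integral => //.
- by move=> x _; exact: potential_ge0.
- exact: (measurable_potential hd P).
- exact: measurable_newton'.
- by move=> x _; apply: le_trans (h x) _; rewrite tkerC; exact: tker_le_newton.
Qed.

Lemma mutual_mass_eq (nu P : probability B R) (F : set T) (y : T) (r : R) :
  measurable (F : set B) -> nu (~` F) = 0 -> sphere_mass y r P ->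
  (forall z, F z -> (r < enorm (z - y))%R) -> mutual nu P = potential nu y.
Proof.
move=> mF F0 [_ _ h] far; rewrite /mutual /potential.
rewrite (integral_full mF)//; last 2 first.
- exact: (measurable_potential hd P).
- by move=> x; exact: potential_ge0.
rewrite [RHS](integral_full mF)//; last 2 first.
- exact: measurable_newton'.
- by move=> x; exact: newton_ge0.
by apply: eq_integral => z /set_mem Fz; rewrite newtonC; exact: h (far z Fz).
Qed.

Lemma mutual_masses_le (P Q : probability B R) (x y : T) (r r' : R) :
  (0 < r)%R -> (0 < r')%R -> sphere_mass x r P -> sphere_mass y r' Q ->
  mutual P Q <= newton x y.
Proof.
move=> r0 r'0 hP hQ; apply: le_trans (mutual_mass_le_potential P r'0 hQ) _.
have [_ h _] := hP; apply: le_trans (h y) _.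
by rewrite tkerC; exact: tker_le_newton.
Qed.

Lemma mutual_masses_eq (P Q : probability B R) (x y : T) (r r' : R) :
  sphere_mass x r P -> sphere_mass y r' Q -> (0 < r)%R -> (0 < r')%R ->
  (r + r' < enorm (x - y))%R -> mutual P Q = newton x y.
Proof.
move=> hP hQ r0 r'0 far; have [P0 _ hP'] := hP.
rewrite (mutual_mass_eq (measurable_sphere x r) P0 hQ).
  by rewrite newtonC; apply: hP'; rewrite enormB; lra.
move=> z /= zx; have := ler_enorm_dist x z y; rewrite (enormB x z) zx; lra.
Qed.

Lemma potential_tau n (X : 'I_n -> T) (y : T) :
  potential (tau X) y = (n%:R^-1)%:E * \sum_(k < n) newton y (X k).
Proof.
have n0 : (0 <= n%:R^-1 :> R)%R by rewrite invr_ge0.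
pose m_ k := \d_(oapp X point (insub k) : B) : {measure set B -> \bar R}.
pose m := mscale (NngNum n0) (msum m_ n).
have my : measurable_fun setT (newton y : B -> \bar R) by exact: measurable_newton'.
rewrite /potential (eq_measure_integral (m : {measure set B -> \bar R})); last first.
  move=> A _ _; rewrite /m /mscale /= /msum /tau; congr (_ * _).
  by apply: eq_bigr => k _; rewrite /m_ valK.
rewrite ge0_integral_mscale//; last by move=> x _; exact: newton_ge0.
rewrite ge0_integral_measure_sum//; last by move=> x _; exact: newton_ge0.
congr (_ * _); apply: eq_bigr => k _.
by rewrite /m_ integral_dirac// valK diracT mul1e.
Qed.

(** The energy form evaluated on [mu - n^-1 \sum_k b k + t c]. *)
Lemma energy_quadratic n (mu c : probability B R) (b : 'I_n -> probability B R) :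
  mutual mu mu < +oo -> mutual mu c < +oo -> mutual c c < +oo ->
  (forall k, mutual mu (b k) < +oo) -> (forall k, mutual (b k) c < +oo) ->
  (forall j k, mutual (b j) (b k) < +oo) -> forall t : R,
  (0 <= fine (mutual mu mu) - 2 * n%:R^-1 * (\sum_k fine (mutual mu (b k))) +
        n%:R^-1 ^+ 2 * (\sum_j \sum_k fine (mutual (b j) (b k))) +
        2 * t * (fine (mutual mu c) - n%:R^-1 * \sum_k fine (mutual (b k) c)) +
        t ^+ 2 * fine (mutual c c))%R.
Proof.
move=> fmm fmc fcc fmb fbc fbb t.
pose M (i : bool + 'I_n) : {finite_measure set B -> \bar R} :=
  match i with inl true => mu | inl false => c | inr k => b k end.
pose a (i : bool + 'I_n) : R :=
  match i with inl true => 1 | inl false => t | inr k => - n%:R^-1 end%R.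
have sym i j : mutual (M i) (M j) = mutual (M j) (M i) by exact: mutualC.
have fin i j : mutual (M i) (M j) < +oo.
  case: i j => [[]|i] [[]|j].
  - exact: fmm.
  - exact: fmc.
  - exact: fmb.
  - by rewrite sym; exact: fmc.
  - exact: fcc.
  - by rewrite sym; exact: (fbc j).
  - by rewrite sym; exact: (fmb i).
  - exact: fbc.
  - exact: fbb.
have := energy_form_ge0 hd a fin.
pose m i j := fine (mutual (M i) (M j)).
have outer (S : bool + 'I_n -> R) :
    (\sum_i a i * S i = S (inl true) + t * S (inl false) - n%:R^-1 * \sum_k S (inr k))%R.
  by rewrite big_sumType big_bool /= -mulr_sumr mul1r mulNr.
under eq_bigr => i _ do (under eq_bigr => j _ do rewrite -mulrA; rewrite -mulr_sumr outer).
rewrite outer !big_split /= sumrN -!mulr_sumr.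
have mE (f g : 'I_n -> R) : (forall k, f k = g k) -> (\sum_k f k = \sum_k g k)%R.
  by move=> fg; exact: eq_bigr.
rewrite (mE (fun k => fine (mutual (M (inr k)) (M (inl true))))
  (fun k => fine (mutual mu (b k)))); last by move=> k; rewrite sym.
rewrite (mE (fun k => fine (mutual (M (inl false)) (M (inr k))))
  (fun k => fine (mutual (b k) c))); last by move=> k; rewrite sym.
rewrite (sym (inl false) (inl true)).
move=> h; apply: (le_trans h); rewrite le_eqVlt; apply/orP; left; apply/eqP.
rewrite /=; ring.
Qed.

End Comparison.

Lemma double_sum_le (R : realType) n (m N : 'I_n -> 'I_n -> R) (K : R) :
  (forall j k, j != k -> m j k <= N j k) -> (forall j k, N j k = N k j) ->
  (forall j, m j j <= K) ->
  \sum_j \sum_k m j k <= 2 * (\sum_(j < n) \sum_(k < n | (j < k)%N) N j k) + n%:R * K.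
Proof.
move=> mN symN mK.
apply: (@le_trans _ _ (\sum_(j < n) \sum_(k < n) ((if (j < k)%N then N j k else 0) +
   (if (k < j)%N then N k j else 0) + (if k == j then K else 0)) : R)).
  apply: ler_sum => j _; apply: ler_sum => k _.
  case: (eqVneq k j) => [->|kj]; first by rewrite ltnn !add0r.
  have jk : j != k by rewrite eq_sym.
  have := mN j k jk; rewrite addr0; case: (ltngtP j k) => [_|_|/val_inj e].
  - by rewrite addr0.
  - by rewrite add0r symN.
  - by rewrite e eqxx in jk.
rewrite (eq_bigr (fun j : 'I_n => \sum_(k < n) (if (j < k)%N then N j k else 0) +
  \sum_(k < n) (if (k < j)%N then N k j else 0) +
  \sum_(k < n) (if k == j then K else 0))); last first.
  by move=> j _; rewrite !big_split.
rewrite !big_split /= [X in _ + X + _]exchange_big /=.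
rewrite [X in _ + X <= _](eq_bigr (fun=> K)); last first.
  by move=> j _; rewrite -big_mkcond big_pred1_eq.
rewrite sumr_const card_ord -[K *+ n]mulr_natl.
rewrite (eq_bigr (fun j : 'I_n => \sum_(k < n | (j < k)%N) N j k)); last first.
  by move=> j _; rewrite [RHS]big_mkcond.
by rewrite lerD2r mulr_natl mulr2n.
Qed.

(** The Cauchy-Schwarz inequality from a nonnegative quadratic polynomial; the
    value [- L / P'] of [t] minimizes the majorant. *)
Lemma sqr_le_quadratic_ge0 (R : realType) (D D' L P P' : R) : 0 < P' -> D <= D' -> P <= P' ->
  (forall t, 0 <= D + 2 * t * L + t ^+ 2 * P) -> L ^+ 2 <= D' * P'.
Proof.
move=> P0 DD PP /(_ (- L / P')) h.
have h1 : 0 <= D' + 2 * (- L / P') * L + (- L / P') ^+ 2 * P'.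
  apply: le_trans h _; apply: lerD; first by rewrite lerD2r.
  by rewrite ler_wpM2l// sqr_ge0.
have e : D' + 2 * (- L / P') * L + (- L / P') ^+ 2 * P' = (D' * P' - L ^+ 2) / P'.
  by field; rewrite gt_eqF.
by move: h1; rewrite e pmulr_lge0 ?invr_gt0// subr_ge0.
Qed.

Section Deviation.
Context {R : realType} {d : nat}.
Local Notation T := 'rV[R]_d.
Local Notation B := (borel_rV R d).
Hypothesis hd : (3 <= d)%N.
Local Open Scope ereal_scope.
Variables (E : set T) (mu : probability B R) (A s : R).
Hypotheses (cE : compact E) (Wfin : robin E < +oo) (muE : equilibrium E mu).
Hypotheses (A0 : (0 < A)%R) (s0 : (0 < s)%R).
Hypothesis greenE : forall x, Omega E (Some x) ->
  green E mu x <= (A * euclid_dist E x `^ s)%:E.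

(** A sphere of radius [r] about [x] stays within distance [r'] of [E]. *)
Lemma mutual_mass_ge (b : probability B R) (x : T) (r r' : R) :
  (0 < r)%R -> sphere_mass x r b -> (euclid_dist E x + r <= r')%R ->
  robin E - (A * r' `^ s)%:E <= mutual mu b.
Proof.
move=> r0 hb rr'; have E0 := equilibrium_nonempty muE.
have r'0 : (0 <= r')%R by have := euclid_dist_ge0 x E0; lra.
rewrite mutualC//; have [b0 bp _] := hb.
apply: (mutual_lower hd cE Wfin muE A0 s0 greenE (c := (r^-1 ^+ (d - 2))%R)) => //.
  by move=> z; apply: le_trans (bp z) _; rewrite lee_fin tker_le.
apply/eqP; rewrite eq_le measure_ge0 andbT -b0; apply: le_measure.
- rewrite inE; apply: measurableC; apply: closed_measurable_rV.
  rewrite (_ : [set _ | _] = euclid_dist E @^-1` [set a | a <= r']%R)//.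
  apply: (@closed_comp _ _ (euclid_dist E)); last exact: closed_le.
  by move=> z _; exact: euclid_dist_continuous.
- by rewrite inE; apply: measurableC; exact: measurable_sphere.
- move=> z /= h zx; apply: h; have := euclid_dist_lip z x E0; rewrite zx; lra.
Qed.

Lemma discrete_energyE n (X : 'I_n -> T) : injective X -> discrete_energy X =
  (2 / (n%:R * (n%:R - 1)) * \sum_(j < n) \sum_(k < n | (j < k)%N) nker (X j) (X k))%:E.
Proof.
move=> Xinj; rewrite /discrete_energy [RHS]EFinM -sumEFin; congr (_ * _).
apply: eq_bigr => j _; rewrite -sumEFin; apply: eq_bigr => k jk.
apply: (newton_neq hd); apply/eqP => /Xinj e.
by rewrite e ltnn in jk.
Qed.

(** The Cauchy-Schwarz inequality for the energy form, applied to [c] and to the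
    difference of [mu] and the mean of the measures [b k].  The energy of that
    difference is small: the mutual energies of the [b k] do not exceed those of
    the points, the self-energies are at most [r^(2-d)], and the mutual energies
    with [mu] are almost as large as the Robin constant. *)
Lemma deviation n (X : 'I_n -> T) (eps r rho : R) (b : 'I_n -> probability B R)
    (c : probability B R) (y : T) :
  (2 <= n)%N -> injective X -> (forall k, E (X k)) ->
  discrete_energy X - robin E <= eps%:E -> (0 < r)%R -> (0 < rho)%R ->
  (forall k, sphere_mass (X k) r (b k)) -> sphere_mass y rho c ->
  ((fine (mutual mu c) - n%:R^-1 * \sum_k fine (mutual (b k) c)) ^+ 2 <=
   (eps + 2 * (A * r `^ s) + n%:R^-1 * r^-1 ^+ (d - 2)) * rho^-1 ^+ (d - 2))%R.
Proof.
move=> n2 Xinj XE hX r0 rho0 hb hc.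
have fmm : mutual mu mu < +oo by case: muE => _ Wmu; rewrite -[mutual mu mu]/(energy mu) Wmu.
have lt (nu P : probability B R) x a (a0 : (0 < a)%R) (h : sphere_mass x a P) : mutual nu P < +oo.
  by rewrite (le_lt_trans (mutual_mass_le hd nu a0 h))// ltry.
have fmass (nu P : probability B R) x a (a0 : (0 < a)%R) (h : sphere_mass x a P) :
    mutual nu P \is a fin_num := mutual_fin hd (lt nu P x a a0 h).
have WE : robin E = (fine (robin E))%:E by rewrite fineK//; exact: (robin_fin hd Wfin muE).
set W := fine (robin E) in WE.
have n0 : (0 < n%:R :> R)%R by rewrite ltr0n (leq_trans _ n2).
have n1 : (1 < n%:R :> R)%R by rewrite ltr1n.
have quad := energy_quadratic hd fmm (lt mu c y rho rho0 hc) (lt c c y rho rho0 hc)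
  (fun k => lt mu (b k) (X k) r r0 (hb k)) (fun k => lt (b k) c y rho rho0 hc)
  (fun j k => lt (b j) (b k) (X k) r r0 (hb k)).
apply: sqr_le_quadratic_ge0 quad.
- by rewrite exprn_gt0// invr_gt0.
- have -> : fine (mutual mu mu) = W by case: muE => _ Wmu; rewrite -[mutual mu mu]/(energy mu) Wmu.
  set S := (\sum_(j < n) \sum_(k < n | (j < k)%N) nker (X j) (X k))%R.
  have S0 : (0 <= S)%R by apply: sumr_ge0 => j _; apply: sumr_ge0 => k _; exact: nker_ge0.
  have hS : (2 / (n%:R * (n%:R - 1)) * S - W <= eps)%R.
    by move: hX; rewrite (discrete_energyE Xinj) WE -EFinB lee_fin.
  have h1 : (n%:R * (W - A * r `^ s) <= \sum_k fine (mutual mu (b k)))%R.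
    rewrite mulr_natl -[X in (_ *+ X <= _)%R](card_ord n) -sumr_const.
    apply: ler_sum => k _; rewrite -lee_fin (fineK (fmass mu (b k) _ _ r0 (hb k))) EFinB -WE.
    apply: (mutual_mass_ge r0 (hb k)).
    by rewrite euclid_dist_in// add0r.
  have h2 : (\sum_j \sum_k fine (mutual (b j) (b k)) <= 2 * S + n%:R * r^-1 ^+ (d - 2))%R.
    apply: double_sum_le.
    - move=> j k jk; rewrite -lee_fin (fineK (fmass (b j) (b k) _ _ r0 (hb k))).
      rewrite -(newton_neq hd); first exact: (mutual_masses_le hd r0 r0 (hb j) (hb k)).
      by apply/eqP => /Xinj /eqP; apply/negP.
    - by move=> j k; exact: nkerC.
    - move=> j; rewrite -lee_fin (fineK (fmass (b j) (b j) _ _ r0 (hb j))).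
      exact: (mutual_mass_le hd (b j) r0 (hb j)).
  set V := (\sum_j \sum_k fine (mutual (b j) (b k)))%R in h2 *.
  set U := (\sum_k fine (mutual mu (b k)))%R in h1 *.
  set K := (r^-1 ^+ (d - 2))%R in h2 *; set q := (A * r `^ s)%R in h1 *.
  have i0 : (0 < n%:R^-1 :> R)%R by rewrite invr_gt0.
  have g1 : (W - q <= n%:R^-1 * U)%R.
    by rewrite -(ler_pM2l n0) [leRHS]mulrA mulfV ?mul1r ?gt_eqF.
  have g2 : (n%:R^-1 ^+ 2 * V <= 2 * S * n%:R^-1 ^+ 2 + n%:R^-1 * K)%R.
    apply: (le_trans (ler_wpM2l (sqr_ge0 _) h2)); rewrite mulrDr lerD//.
      by rewrite mulrC.
    by rewrite mulrA expr2 -!mulrA [(n%:R^-1 * (n%:R * _))%R]mulrA mulVf ?mul1r// gt_eqF.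
  have g3 : (2 * S * n%:R^-1 ^+ 2 <= 2 / (n%:R * (n%:R - 1)) * S)%R.
    rewrite [leRHS]mulrAC; apply: ler_wpM2l; first by rewrite mulr_ge0.
    rewrite exprVn expr2 lef_pV2 ?posrE ?mulr_gt0 ?subr_gt0//.
    by rewrite ler_pM2l// gerBl.
  rewrite -[(2 * _ * U)%R]mulrA.
  move: (n%:R^-1 * U)%R (n%:R^-1 ^+ 2 * V)%R (n%:R^-1 * K)%R g1 g2 g3 hS => u v k.
  move: (2 * S * n%:R^-1 ^+ 2)%R (2 / (n%:R * (n%:R - 1)) * S)%R => a a'.
  lra.
- by rewrite -lee_fin (fineK (fmass c c _ _ rho0 hc)); exact: (mutual_mass_le hd c rho0 hc).
Qed.

End Deviation.

Section Estimates.
Context {R : realType} {d : nat}.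
Local Notation T := 'rV[R]_d.
Local Notation B := (borel_rV R d).
Hypothesis hd : (3 <= d)%N.
Local Open Scope ereal_scope.
Variables (E : set T) (mu : probability B R) (A s : R).
Hypotheses (cE : compact E) (Wfin : robin E < +oo) (muE : equilibrium E mu).
Hypotheses (A0 : (0 < A)%R) (s0 : (0 < s)%R).
Hypothesis greenE : forall x, Omega E (Some x) ->
  green E mu x <= (A * euclid_dist E x `^ s)%:E.
Variables (n : nat) (X : 'I_n -> T) (eps r D : R).
Hypotheses (n2 : (2 <= n)%N) (Xinj : injective X) (XE : forall k, E (X k)).
Hypotheses (hX : discrete_energy X - robin E <= eps%:E) (r0 : (0 < r)%R).
Hypothesis hD : (eps + 2 * (A * r `^ s) + n%:R^-1 * r^-1 ^+ (d - 2) <= D)%R.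

Let n0 : (0 < n%:R^-1 :> R)%R.
Proof. by rewrite invr_gt0 ltr0n (leq_trans _ n2). Qed.

Let exists_masses : exists b : 'I_n -> probability B R, forall k, sphere_mass (X k) r (b k).
Proof.
have h k : exists P : probability B R, sphere_mass (X k) r P by exact: sphere_measure.
by have [b hb] := choice h; exists b.
Qed.

Let mass_fin (nu P : probability B R) x a : (0 < a)%R -> sphere_mass x a P ->
  mutual nu P \is a fin_num.
Proof.
move=> a0 h; apply: (mutual_fin hd).
by rewrite (le_lt_trans (mutual_mass_le hd nu a0 h))// ltry.
Qed.

Let mean_le (f g : 'I_n -> \bar R) : (forall k, f k \is a fin_num) ->
  (forall k, f k <= g k) ->
  (n%:R^-1 * \sum_k fine (f k))%:E <= (n%:R^-1)%:E * \sum_(k < n) g k.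
Proof.
move=> ff fg; rewrite EFinM -sumEFin; apply: lee_wpmul2l; first by rewrite lee_fin ltW.
by apply: lee_sum => k _; rewrite fineK.
Qed.

(** Spreading the points over spheres and [y] over the sphere of radius [rho]
    only lowers the potential of the points, while that of [mu] drops by at most
    [A (2 rho)^s]: not at all if [y] is farther than [rho] from [E], and otherwise
    because the potential nowhere exceeds the Robin constant. *)
Lemma upper_estimate (y : T) (rho : R) : (0 < rho)%R ->
  potential mu y - potential (tau X) y <=
  (Num.sqrt (D * rho^-1 ^+ (d - 2)) + A * (2 * rho) `^ s)%:E.
Proof.
move=> rho0; have [b hb] := exists_masses.
have [c hc] : exists P : probability B R, sphere_mass y rho P by exact: sphere_measure.
have dev := deviation hd cE Wfin muE A0 s0 greenE n2 Xinj XE hX r0 rho0 hb hc.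
have E0 := equilibrium_nonempty muE.
have tauy : (n%:R^-1 * \sum_k fine (mutual (b k) c))%:E <= potential (tau X) y.
  rewrite (potential_tau hd); apply: mean_le => k; first exact: mass_fin hc.
  by rewrite newtonC; exact: (mutual_masses_le hd r0 rho0 (hb k) hc).
have muy : potential mu y - (A * (2 * rho) `^ s)%:E <= mutual mu c.
  have [far|near] := ltP rho (euclid_dist E y).
    have [muE0 _] := muE.
    rewrite (mutual_mass_eq hd (measurable_compact_set cE) muE0 hc).
      rewrite leeBlDr// -[leLHS]adde0; apply: leeD => //.
      by rewrite lee_fin mulr_ge0 ?powR_ge0// ltW.
    by move=> z /(euclid_dist_le y); rewrite enormB; exact: lt_le_trans.
  apply: (@le_trans _ _ (robin E - (A * (2 * rho) `^ s)%:E)).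
    by apply: leeB => //; exact: (potential_le_robin hd cE Wfin muE).
  apply: (mutual_mass_ge hd cE Wfin muE A0 s0 greenE rho0 hc); lra.
have pfin : potential mu y \is a fin_num.
  rewrite ge0_fin_numE; last exact: potential_ge0.
  by apply: le_lt_trans Wfin; exact: (potential_le_robin hd cE Wfin muE).
move: muy tauy dev; rewrite -(fineK (mass_fin mu rho0 hc)) -(fineK pfin).
move: (fine (mutual mu c)) (fine (potential mu y)) (n%:R^-1 * _)%R => m u t.
case: (potential (tau X) y) => [v| |]; last 2 first.
- by rewrite addeNy leNye.
- by rewrite leeNy_eq.
rewrite !lee_fin => muy tauy dev.
have : (m - t <= Num.sqrt (D * rho^-1 ^+ (d - 2)))%R.
  apply: le_trans (ler_norm _) _; rewrite -sqrtr_sqr; apply: ler_wsqrtr.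
  apply: (le_trans dev); apply: ler_wpM2r => //.
  by rewrite exprn_ge0// invr_ge0 ltW.
lra.
Qed.

(** If the spheres about [y], of radius half its distance to [E], and about the
    points are disjoint, spreading the masses changes no mutual energy.
    Otherwise the distance is at most [2 r], and each potential is at most its
    power of exponent [2 - d]. *)
Lemma outer_estimate (y : T) : ~ E y ->
  `|potential mu y - potential (tau X) y| <=
  (Num.sqrt (D * (euclid_dist E y / 2)^-1 ^+ (d - 2)) +
   2 * r * (euclid_dist E y)^-1 ^+ (d - 1))%:E.
Proof.
move=> nEy; have E0 := equilibrium_nonempty muE.
set delta := euclid_dist E y.
have delta0 : (0 < delta)%R.
  by apply: euclid_dist_gt0 => //; exact: compact_set_closed.
have deltaE z : E z -> (delta <= enorm (z - y))%R.
  by move=> /(euclid_dist_le y); rewrite enormB.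
have [muE0 _] := muE.
have mE := measurable_compact_set cE.
set K := (delta^-1 ^+ (d - 2))%R.
have newK z : E z -> newton y z <= K%:E.
  by move=> Ez; rewrite newtonC; apply: (newton_le hd delta0); exact: deltaE.
have muK : potential mu y <= K%:E.
  rewrite /potential (integral_full mE muE0)//; last 2 first.
  - exact: measurable_newton'.
  - by move=> z; exact: newton_ge0.
  apply: (@le_trans _ _ (\int[mu]_(x in E) cst K%:E x)).
    apply: ge0_le_integral => //.
    - by move=> z _; exact: newton_ge0.
    - by apply: measurable_funTS; exact: measurable_newton'.
  rewrite (integral_cst mu mE); apply: (@le_trans _ _ (K%:E * 1)); last by rewrite mule1.
  apply: lee_wpmul2l; last exact: probability_le1.
  by rewrite lee_fin exprn_ge0// invr_ge0 ltW.
have newfin k : newton y (X k) \is a fin_num.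
  rewrite ge0_fin_numE; last exact: newton_ge0.
  by rewrite (le_lt_trans (newK _ (XE k)))// ltry.
have tauE : potential (tau X) y = (n%:R^-1 * \sum_k fine (newton y (X k)))%:E.
  rewrite (potential_tau hd) EFinM -sumEFin; congr (_ * _).
  by apply: eq_bigr => k _; rewrite fineK.
have mufin : potential mu y \is a fin_num.
  rewrite ge0_fin_numE; last exact: potential_ge0.
  by rewrite (le_lt_trans muK)// ltry.
have r1 : (0 <= 2 * r * delta^-1 ^+ (d - 1))%R.
  by rewrite !mulr_ge0 ?(ltW r0)// exprn_ge0// invr_ge0 ltW.
rewrite tauE -(fineK mufin) -EFinB abse_EFin lee_fin.
have [near|far] := leP delta (2 * r)%R.
  have mu0 : (0 <= fine (potential mu y))%R by apply: fine_ge0; exact: potential_ge0.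
  have muK' : (fine (potential mu y) <= K)%R by rewrite -lee_fin fineK.
  have t0 : (0 <= n%:R^-1 * \sum_k fine (newton y (X k)))%R.
    rewrite mulr_ge0 ?(ltW n0)//; apply: sumr_ge0 => k _; apply: fine_ge0.
    exact: newton_ge0.
  have tK : (n%:R^-1 * \sum_k fine (newton y (X k)) <= K)%R.
    rewrite mulrC ler_pdivrMr ?ltr0n ?(leq_trans _ n2)//.
    rewrite mulr_natr -[X in (_ <= _ *+ X)%R](card_ord n) -sumr_const.
    by apply: ler_sum => k _; rewrite -lee_fin fineK//; exact: newK.
  have KE : (K <= 2 * r * delta^-1 ^+ (d - 1))%R.
    have -> : K = (delta * delta^-1 ^+ (d - 1))%R.
      rewrite /K (_ : (d - 1 = (d - 2).+1)%N); last by rewrite subnSK// ltnW.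
      by rewrite exprS mulrA mulfV ?mul1r// gt_eqF.
    by apply: ler_wpM2r => //; rewrite exprn_ge0// invr_ge0 ltW.
  have := sqrtr_ge0 (D * (delta / 2)^-1 ^+ (d - 2)).
  rewrite ler_norml => ?; apply/andP; split; lra.
have rho0 : (0 < delta / 2)%R by rewrite divr_gt0.
have [b hb] := exists_masses.
have [c hc] : exists P : probability B R, sphere_mass y (delta / 2) P.
  exact: sphere_measure.
have dev := deviation hd cE Wfin muE A0 s0 greenE n2 Xinj XE hX r0 rho0 hb hc.
have muc : mutual mu c = potential mu y.
  apply: (mutual_mass_eq hd mE muE0 hc) => z /deltaE; apply: lt_le_trans; lra.
have bc k : mutual (b k) c = newton y (X k).
  rewrite newtonC; apply: (mutual_masses_eq hd (hb k) hc r0 rho0).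
  by apply: lt_le_trans (deltaE _ (XE k)); lra.
move: dev; rewrite muc; under eq_bigr do rewrite bc.
move=> dev; apply: (@le_trans _ _ (Num.sqrt (D * (delta / 2)^-1 ^+ (d - 2)))); last by lra.
rewrite -sqrtr_sqr; apply: ler_wsqrtr; apply: (le_trans dev); apply: ler_wpM2r => //.
by rewrite exprn_ge0// invr_ge0 ltW.
Qed.

End Estimates.

Lemma exprV_powR (R : realType) (x : R) m : 0 < x -> x^-1 ^+ m = x `^ (- m%:R).
Proof. by move=> x0; rewrite powRN powR_mulrn ?ltW// exprVn. Qed.

Lemma sqrt_mul_sqr (R : realType) (a b : R) : 0 <= a -> 0 <= b ->
  Num.sqrt (a * b ^+ 2) = Num.sqrt a * b.
Proof. by move=> a0 b0; rewrite sqrtrM// sqrtr_sqr ger0_norm. Qed.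

Theorem theorem2p2 (R : realType) (d : nat) (s : R)
  (hd : (3 <= d)%N) (hs0 : 0 < s) (hs1 : s <= 1) :
  let p : R := s / (d%:R + s - 2) in
  exists q : R, 0 < q /\
  forall (E : set 'rV[R]_d) (muE : probability (borel_rV R d) R),
    compact E ->
    (robin E < +oo)%E ->
    equilibrium E muE ->
    (exists A : R, 0 < A /\
       forall x : 'rV[R]_d, Omega E (Some x) ->
         (green E muE x <= (A * euclid_dist E x `^ s)%:E)%E) ->
    forall C1 : R, 0 < C1 ->
    exists C2 C3 : R, [/\ 0 < C2, 0 < C3 &
      forall (n : nat) (X : 'I_n -> 'rV[R]_d),
        (2 <= n)%N ->
        injective X ->
        (forall k, E (X k)) ->
        (discrete_energy X - robin E <= (C1 * n%:R `^ (- p))%:E)%E ->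
        (forall y : 'rV[R]_d, ~ E y ->
           (`| potential muE y - potential (tau X) y | <=
            (C2 * (euclid_dist E y `^ (1 - d%:R) * n%:R `^ (- p / s) +
                   euclid_dist E y `^ (1 - d%:R / 2) * n%:R `^ (- p / 2)))%:E)%E) /\
        (ereal_sup [set potential muE y - potential (tau X) y | y in setT] <=
         (C3 * n%:R `^ (- q))%:E)%E].
Proof.
move=> p; have d3 : (3 <= d%:R :> R) by rewrite (ler_nat _ 3).
have P0 : 0 < d%:R + s - 2 by lra.
have Q0 : 0 < 2 * s + d%:R - 2 by lra.
have p0 : 0 < p by rewrite divr_gt0.
(* With [rho = n^(-kappa)] the terms [n^(-p/2) rho^(1-d/2)] and [rho^s] are equal. *)
pose kappa := p / (2 * s + d%:R - 2).
have k0 : 0 < kappa by rewrite divr_gt0.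
exists (kappa * s); split; first by rewrite mulr_gt0.
move=> E mu cE Wfin muE [A [A0 greenE]] C1 C10.
pose C := C1 + 2 * A + 1.
have C0 : 0 < C by rewrite /C; lra.
exists (2 + Num.sqrt (C * 2 ^+ (d - 2))), (Num.sqrt C + A * 2 `^ s); split.
- by rewrite ltr_pwDl// sqrtr_ge0.
- by rewrite ltr_pwDl ?sqrtr_gt0// mulr_ge0 ?powR_ge0// ltW.
move=> n X n2 Xinj XE hX.
have N0 : 0 < n%:R :> R by rewrite ltr0n (leq_trans _ n2).
have d2 : (d - 2)%:R = d%:R - 2 :> R by rewrite natrB// ltnW.
have d1 : (d - 1)%:R = d%:R - 1 :> R by rewrite natrB// (leq_trans _ hd).
(* This radius makes [r^s] and [n^-1 r^(2-d)] both equal to [n^(-p)]. *)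
pose r := n%:R `^ (- (d%:R + s - 2)^-1) : R.
have r0 : 0 < r by rewrite powR_gt0.
have rs : r `^ s = n%:R `^ (- p).
  by rewrite /r -powRrM mulNr mulrC.
have rd : n%:R^-1 * r^-1 ^+ (d - 2) = n%:R `^ (- p).
  rewrite exprV_powR// /r -powRrM -[X in X * _](powR_inv1 (ltW N0)) -powRD; last first.
    by rewrite (gt_eqF N0) implybT.
  congr (_ `^ _); rewrite d2 /p; field; lra.
have hD : C1 * n%:R `^ (- p) + 2 * (A * r `^ s) + n%:R^-1 * r^-1 ^+ (d - 2) <=
    C * n%:R `^ (- p).
  by rewrite rs rd /C le_eqVlt; apply/orP; left; apply/eqP; ring.
have half (x a : R) : 0 < x -> x `^ a = (x `^ (a / 2)) ^+ 2.
  by move=> x0; rewrite -powR_mulrn ?powR_ge0// -powRrM; congr (_ `^ _); field.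
split.
  move=> y nEy; have E0 := equilibrium_nonempty muE.
  have dl0 : 0 < euclid_dist E y.
    by apply: euclid_dist_gt0 => //; exact: compact_set_closed.
  apply: (le_trans (outer_estimate hd cE Wfin muE A0 hs0 greenE n2 Xinj XE hX r0 hD nEy)).
  rewrite lee_fin; move: (euclid_dist E y) dl0 => dl dl0.
  have -> : dl^-1 ^+ (d - 1) = dl `^ (1 - d%:R).
    by rewrite exprV_powR// d1 opprB.
  have -> : r = n%:R `^ (- p / s).
    by rewrite /r; congr (_ `^ _); rewrite /p; field; rewrite gt_eqF//=; lra.
  have -> : Num.sqrt (C * n%:R `^ (- p) * (dl / 2)^-1 ^+ (d - 2)) =
      Num.sqrt (C * 2 ^+ (d - 2)) * (dl `^ (1 - d%:R / 2) * n%:R `^ (- p / 2)).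
    rewrite -sqrt_mul_sqr ?mulr_ge0 ?powR_ge0 ?exprn_ge0 ?(ltW C0)//.
    congr Num.sqrt; rewrite invf_div exprMn exprV_powR// d2 (half _ (- p)) // (half dl) //.
    rewrite exprMn (_ : - (d%:R - 2) / 2 = 1 - d%:R / 2); last by field.
    by ring.
  have a0 := powR_ge0 dl (1 - d%:R); have b0 := powR_ge0 (n%:R : R) (- p / s).
  have c0 := powR_ge0 dl (1 - d%:R / 2); have e0 := powR_ge0 (n%:R : R) (- p / 2).
  have q0 := sqrtr_ge0 (C * 2 ^+ (d - 2)).
  have ab := mulr_ge0 a0 b0; have ce := mulr_ge0 c0 e0.
  have := mulr_ge0 q0 ab.
  rewrite mulrDl !mulrDr; lra.
apply: ge_ereal_sup => _ [y _ <-].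
pose rho := n%:R `^ (- kappa) : R.
have rho0 : 0 < rho by rewrite powR_gt0.
apply: (le_trans (upper_estimate hd cE Wfin muE A0 hs0 greenE n2 Xinj XE hX r0 hD y rho0)).
rewrite lee_fin [leRHS]mulrDl; apply: lerD.
  rewrite exprV_powR// /rho -powRrM -mulrA -powRD; last by rewrite (gt_eqF N0) implybT.
  rewrite half// sqrt_mul_sqr ?powR_ge0// ?(ltW C0)//.
  rewrite (_ : _ / 2 = - (kappa * s))// d2 /kappa; field; lra.
by rewrite powRM ?powR_ge0// /rho -powRrM mulNr mulrA.
Qed.
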